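(* Let $\sigma>0$, let $\mathcal{H}$ be a Hilbert space and let $\mathcal{B}_0,\mathcal{B}_1$ be Banach spaces. For each $t\in\mathbb{R}$, suppose we have an operator $U(t):\mathcal{H}\to\mathcal{B}_0^*$ such that $$\|U(t)f\|_{\mathcal{B}_0^*}\lesssim\|f\|_{\mathcal{H}}\qquad\text{and}\qquad \|U(t)U^*(s)g\|_{\mathcal{B}_1^*}\lesssim |t-s|^{-\sigma}\|g\|_{\mathcal{B}_1},$$ with implicit constants independent of $t,s$ (with $t\neq s$), $f$ and $g$. Let $\theta,\tilde\theta\in[0,1]$ and suppose one of the following conditions holds: - $\sigma<1$ and $\theta,\tilde\theta\in[0,1]$; - $\sigma=1$ and $\theta,\tilde\theta\in[0,1)$; - $\sigma>1$ and $$\frac{\sigma-1}{\sigma}(1-\theta)\le 1-\tilde\theta,\qquad \frac{\sigma-1}{\sigma}(1-\tilde\theta)\le 1-\theta .$$ Then for all exponents $q$ and $\tilde q$ satisfying $$\sigma\theta=\frac1q<\frac{1}{\tilde q'}=1-\sigma\Big(\frac{\tilde\theta}{2}-\frac{\theta}{2}\Big),\qquad \theta\le\tilde\theta,$$ the estimate $$\bigg\|\int_{s<t}U(t)U^*(s)F(s,\cdot)\,\mathrm{d}s\bigg\|_{L^{q,\infty}_t\mathcal{B}_\theta^*}\lesssim\|F\|_{L^{\tilde q'}_t\mathcal{B}_{\tilde\theta}}$$ holds, with implicit constant independent of $F$.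
   Context: $A\lesssim B$ means $A\le CB$ for a constant $C>0$ independent of the functions involved and of $t,s$. The spaces $\mathcal{B}_0,\mathcal{B}_1$ form a compatible (interpolation) couple of Banach spaces. For $\theta\in(0,1)$, $\mathcal{B}_\theta=(\mathcal{B}_0,\mathcal{B}_1)_{\theta,2}$ is the real interpolation space with second index $2$; for $\theta=0$ and $\theta=1$, $\mathcal{B}_\theta$ is $\mathcal{B}_0$, respectively $\mathcal{B}_1$. $\mathcal{B}_\theta^*$ denotes the dual space of $\mathcal{B}_\theta$. The operators $U(t)$ are linear, and $U^*(s):\mathcal{B}_0\to\mathcal{H}$ denotes the adjoint of $U(s)$; the second hypothesis is understood for $g\in\mathcal{B}_0\cap\mathcal{B}_1$. The measurability in time needed for the expressions to make sense is implicit, and the conclusion is understood as an a priori estimate for $F$ (say, simple functions of time with bounded support and values in $\mathcal{B}_0\cap\mathcal{B}_1$). For elements $h\in\mathcal{B}_0^*$ (viewed as functionals on $\mathcal{B}_0\cap\mathcal{B}_1$), $\|h\|_{\mathcal{B}_\theta^*}$ is the supremum of $|h(b)|$ over $b\in\mathcal{B}_0\cap\mathcal{B}_1$ with $\|b\|_{\mathcal{B}_\theta}\le1$. Exponents $q,\tilde q$ lie in $[1,\infty]$, and $\tilde q'$ is the conjugate exponent, $\frac1{\tilde q}+\frac1{\tilde q'}=1$. For a Banach space $\mathcal{B}$, $\|G\|_{L^p_t\mathcal{B}}$ is the $L^p(\mathbb{R})$ norm of $t\mapsto\|G(t)\|_{\mathcal{B}}$, and $\|G\|_{L^{q,\infty}_t\mathcal{B}}=\sup_{\lambda>0}\lambda\,|\{t\in\mathbb{R}:\|G(t)\|_{\mathcal{B}}>\lambda\}|^{1/q}$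 for $q<\infty$, with $L^{\infty,\infty}=L^\infty$. *)

(* Defs.v *)
From HB Require Import structures.
From mathcomp Require Import all_boot all_order all_algebra.
From mathcomp Require Import complex.
From mathcomp Require Import all_classical all_reals all_analysis measurable_realfun.

Set Implicit Arguments.
Unset Strict Implicit.
Unset Printing Implicit Defensive.

Import Order.TTheory GRing.Theory Num.Theory.
Import numFieldNormedType.Exports.

Local Open Scope classical_set_scope.
Local Open Scope ring_scope.

(* The scalars of all vector spaces are either the real or the complex
   numbers.  Over a numFieldType K the library's norms take values in K; they
   are turned into real numbers with sRe. *)
Variant scalar_kind := RealScalars | ComplexScalars.

Definition scalar_field (R : realType) (k : scalar_kind) : numFieldType :=
  match k with
  | RealScalars => R
  | ComplexScalars => R[i]%C
  end.

Section scalars.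
Context {R : realType} {k : scalar_kind}.
Local Notation K := (scalar_field R k).

Definition sRe : K -> R :=
  match k return scalar_field R k -> R with
  | RealScalars => fun x => x
  | ComplexScalars => fun x => complex.Re x
  end.

Definition sIm : K -> R :=
  match k return scalar_field R k -> R with
  | RealScalars => fun=> 0
  | ComplexScalars => fun x => complex.Im x
  end.

Definition sconj : K -> K :=
  match k return scalar_field R k -> scalar_field R k with
  | RealScalars => fun x => x
  | ComplexScalars => fun x => conjc x
  end.

(* The scalar with given real and imaginary parts; over the reals the latter is
   always 0. *)
Definition smk : R -> R -> K :=
  match k return R -> R -> scalar_field R k with
  | RealScalars => fun x _ => x
  | ComplexScalars => fun x y => (x +i* y)%C
  end.

Definition real_norm (V : normedModType K) (v : V) : R := sRe `|v|.

Definition real_abs (x : K) : R := sRe `|x|.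

Definition scalar_measurable (f : R -> K) :=
  measurable_fun [set: R] (sRe \o f) /\ measurable_fun [set: R] (sIm \o f).

Definition scalar_integral (D : set R) (f : R -> K) : K :=
  smk (\int[lebesgue_measure]_(s in D) sRe (f s))
      (\int[lebesgue_measure]_(s in D) sIm (f s)).

End scalars.

(* A Hilbert space is a complete normed space whose norm comes from an inner
   product; in {dot H for sconj} the form is linear in its first argument. *)
Definition hilbert_norm (R : realType) (k : scalar_kind)
    (H : completeNormedModType (scalar_field R k)) (ip : {dot H for sconj}) :=
  forall x : H, `|x| ^+ 2 = ip x x.

Record banach_couple (R : realType) (k : scalar_kind) := BanachCouple {
  ambient : topologicalLmodType (scalar_field R k) ;
  sp0 : completeNormedModType (scalar_field R k) ;
  sp1 : completeNormedModType (scalar_field R k) ;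
  emb0 : {linear sp0 -> ambient} ;
  emb1 : {linear sp1 -> ambient} ;
  ambient_hausdorff : hausdorff_space ambient ;
  emb0_injective : injective emb0 ;
  emb1_injective : injective emb1 ;
  emb0_continuous : continuous emb0 ;
  emb1_continuous : continuous emb1
}.

Arguments emb0 {R k b}.
Arguments emb1 {R k b}.

Section couple.
Context {R : realType} {k : scalar_kind} (B : banach_couple R k).
Local Notation K := (scalar_field R k).

(* B_0 `&` B_1: an element is given by its two representatives. *)
Definition couple_cap : set (sp0 B * sp1 B) :=
  [set b | emb0 b.1 = emb1 b.2].

Definition Kfunctional (t : R) (v : ambient B) : \bar R :=
  ereal_inf [set (real_norm x.1 + t * real_norm x.2)%:E
            | x in [set x : sp0 B * sp1 B | emb0 x.1 + emb1 x.2 = v]].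

(* The norm of (B_0, B_1)_{theta, 2} for 0 < theta < 1, and of B_0, B_1 at the
   endpoints. *)
Definition interp_norm (theta : R) (b : sp0 B * sp1 B) : \bar R :=
  if theta == 0 then (real_norm b.1)%:E
  else if theta == 1 then (real_norm b.2)%:E
  else ((\int[lebesgue_measure]_(t in `]0%R, +oo[)
          (((t `^ (- theta))%:E * Kfunctional t (emb0 b.1)) ^+ 2 * (t^-1)%:E))
        `^ (2^-1))%E.

(* Functionals are tested on B_0 `&` B_1 only. *)
Definition dual_norm (theta : R) (h : sp0 B -> K) : \bar R :=
  ereal_sup [set (real_abs (h b.1))%:E
            | b in [set b | couple_cap b /\ (interp_norm theta b <= 1)%E]].

(* Linear operators from H to the dual (continuous linear functionals) of
   B_0.  Its adjoint T* : B_0 -> H is characterized by T f g = <f, T* g>; over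
   the complex numbers T* is therefore conjugate-linear, which affects none of
   the norms. *)
Definition dual_operator (H : normedModType K) (T : H -> sp0 B -> K) :=
  (forall f : H, scalar (T f) /\ continuous (T f : sp0 B -> K^o)) /\
  (forall b : sp0 B, scalar (T ^~ b)).

Definition time_simple (F : R -> sp0 B * sp1 B) :=
  [/\ finite_set (range F),
      forall x, measurable (F @^-1` [set x]),
      exists M : R, forall s, M < `|s| -> F s = 0 &
      forall s, couple_cap (F s)].

(* The integral over s < t of U(t) U*(s) F(s), as a functional: it is taken in
   the weak sense, i.e. after testing against b. *)
Definition retarded (H : normedModType K) (U : R -> H -> sp0 B -> K)
    (Ustar : R -> sp0 B -> H) (F : R -> sp0 B * sp1 B) (t : R) : sp0 B -> K :=
  fun b => scalar_integral `]-oo, t[ (fun s => U t (Ustar s (F s).1) b).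

End couple.

Definition weak_Lnorm (R : realType) (q : \bar R) (g : R -> \bar R) : \bar R :=
  match q with
  | r%:E => ereal_sup
      [set (lambda%:E * lebesgue_measure [set t | (lambda%:E < g t)%E] `^ r^-1)%E
      | lambda in [set lambda : R | 0 < lambda]]
  | _ => 'N[lebesgue_measure]_(+oo%E)[g]
  end.

(* Main.v *)
(* The estimate is dual to a bound for u(b) = <U*(t)b, int_{s<t} U*(s)F(s) ds>.
   Real interpolation between the energy and the dispersive bounds controls the
   kernel by |t-s|^(-sigma theta) when both entries are measured in B_theta, and a
   TT* argument gives |int U*(s)F(s) ds|_H <= C |F|_{L^p B_a} with
   1/p = 1 - sigma a/2: by Hardy-Littlewood-Sobolev if sigma a < 1, and at the
   endpoint sigma a = 1 < sigma by splitting F along its J-method decomposition,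
   the pieces of which give almost orthogonal vectors of H.  If F is supported at
   distance at least rho from t, reiterating between this estimate (paired with
   energy) and the dispersive bound, with a cut that depends on the size of F(s),
   yields the factor rho^(-sigma theta) |F|_{L^p B_thetat}.  Summing over the dyadic
   shells |t-s| ~ 2^(-j) rho bounds the remaining near part by rho^epsilon W(t)^(1/p),
   where W is the convolution of |F|^p with the locally integrable kernel
   |r|^(-(sigma theta + epsilon) p) 1_{|r| < rho}; this is where the strict inequality
   1/q < 1/p is used.  Choosing rho in terms of the level lambda and applying
   Chebyshev's inequality to W gives the weak-type bound. *)

From HB Require Import structures.
Require Import Defs.
From mathcomp Require Import all_boot all_order all_algebra.
From mathcomp Require Import complex ring lra zify.
From mathcomp Require Import all_classical all_reals all_analysis measurable_realfun.

Set Implicit Arguments.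
Unset Strict Implicit.
Unset Printing Implicit Defensive.

Import Order.TTheory GRing.Theory Num.Theory.
Import numFieldNormedType.Exports.

Local Open Scope classical_set_scope.
Local Open Scope ring_scope.

(** The analysis takes place on the intersection of the two spaces, seen as an additive group with
    two seminorms, and in H with the real part of its inner product. Interpolation norms enter only
    through finite J-decompositions with terms in the intersection ([jle]). Both F and the test
    vector b come with upper bounds for their interpolation norms, so one half of the equivalence of
    the K- and J-methods suffices; it is proved in discrete form. For theta < thetat write thetat =
    theta + (1 - theta) a: the conditions on the exponents then say that sigma a < 1, or that sigma
    a = 1 < sigma, which is the range of the TT* estimate. The obstacle is to keep the second index
    2 while the time exponent changes. The scales of F and of b are both square summable, so their
    pairing closes by Cauchy-Schwarz, and l^2 and L^p can be exchanged in the required direction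
    because p <= 2. The decompositions are not canonical; as F takes finitely many values they are
    chosen value by value, and everything built from them stays measurable in time. *)

Lemma le_of_eq d (T : porderType d) (x y : T) : x = y -> (x <= y)%O.
Proof. by move=> ->. Qed.

(** * Kernels on the line *)

Section power_integrals.
Context {R : realType}.
Implicit Types (t rho beta sigma : R) (k : R -> R).
Local Notation mu := (@lebesgue_measure R).

Lemma lebesgue_measure_shift t (A : set R) : measurable A ->
  pushforward mu (fun s => s + t : measurableTypeR R) A = mu A.
Proof.
move=> mA; apply/esym/lebesgue_measure_unique => //=.
  by apply: measurable_funD => //; exact: measurable_cst.
move=> mf _ [[a b]] _ <-.
rewrite /pushforward (_ : _ @^-1` _ = `]a - t, b - t]%classic); last first.
  by apply/seteqP; split => x /=; rewrite !in_itv/= ltrBlDr lerBrDr.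
rewrite !lebesgue_measure_itv/= !lte_fin ltrD2r.
by rewrite -!EFinD opprB addrA subrK.
Qed.

Lemma ge0_integral_shift t (f : R -> \bar R) : measurable_fun setT f ->
  (forall x, (0 <= f x)%E) -> (\int[mu]_s f (s + t)%R = \int[mu]_s f s)%E.
Proof.
move=> mf f0.
have mphi : measurable_fun setT (fun s : measurableTypeR R => s + t : measurableTypeR R).
  by apply: measurable_funD => //; exact: measurable_cst.
have := @ge0_integral_pushforward _ _ _ _ _ _ mphi mu setT f measurableT mf (fun y _ => f0 y).
rewrite preimage_setT /= => <-.
apply: eq_measure_integral => //= A mA _; exact/lebesgue_measure_shift.
Qed.

Lemma ge0_integral_even (f : R -> \bar R) : measurable_fun setT f ->
  (forall x, (0 <= f x)%E) -> (forall x, f (- x) = f x) ->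
  (\int[mu]_s f s <= 2%:E * \int[mu]_(s in `[0%R, +oo[) f s)%E.
Proof.
move=> mf f0 fe.
rewrite -(setUv `[0%R, +oo[%classic) ge0_integral_setU//=; last 2 first.
- by rewrite setUv.
- exact/disj_setPCl.
rewrite mule_natl mule2n leeD2l// ge0_integration_by_substitution0//.
rewrite [leRHS](_ : _ = \int[mu]_(r in `]-oo, 0%R]) f r)%E; last first.
  by apply: eq_integral => x _; rewrite fe.
apply: ge0_subset_integral => //=.
- exact: measurableC.
- exact: measurable_funS mf.
- by move=> x /=; rewrite !in_itv/= andbT => /negP; rewrite -ltNge => /ltW.
exact: measurableC.
Qed.

(** For [beta = 0] this is the indicator of [|r| < rho], the form in which the energy bound is
    localised. The convention for powers of 0 makes the value at [r = 0] finite. *)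
Definition near_kernel beta rho (r : R) : R :=
  if `|r| < rho then `|r| `^ (- beta) else 0.
Definition far_kernel sigma rho (r : R) : R :=
  if `|r| < rho then 0 else `|r| `^ (- sigma).

Lemma near_kernel_ge0 beta rho r : 0 <= near_kernel beta rho r.
Proof. by rewrite /near_kernel; case: ifP => // _; rewrite powR_ge0. Qed.

Lemma far_kernel_ge0 beta rho r : 0 <= far_kernel beta rho r.
Proof. by rewrite /far_kernel; case: ifP => // _; rewrite powR_ge0. Qed.

Lemma measurable_near_kernel beta rho : measurable_fun setT (near_kernel beta rho).
Proof.
apply: measurable_fun_ifT => //; first exact: measurable_fun_ltr.
by apply: (@measurableT_comp _ _ _ _ _ _ (@powR R ^~ (- beta))) => //.
Qed.

Lemma measurable_far_kernel beta rho : measurable_fun setT (far_kernel beta rho).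
Proof.
apply: measurable_fun_ifT => //; first exact: measurable_fun_ltr.
by apply: (@measurableT_comp _ _ _ _ _ _ (@powR R ^~ (- beta))) => //.
Qed.

Lemma integral_powR_itv (e a b : R) : 0 < a -> a < b -> e + 1 != 0 ->
  (\int[mu]_(x in `[a, b]) (x `^ e)%:E =
   ((e + 1)^-1 * (b `^ (e + 1) - a `^ (e + 1)))%:E)%E.
Proof.
move=> a0 ab e1.
have cF p x : 0 < x -> {for x, continuous (@powR R ^~ p)}.
  move=> x0; apply: differentiable_continuous; apply/derivable1_diffP.
  by apply: derivable_powR; rewrite in_itv/= x0.
pose F x : R := (e + 1)^-1 * x `^ (e + 1).
have dF x : 0 < x -> derivable F x 1.
  move=> x0; apply: derivableM => //.
  by apply: derivable_powR; rewrite in_itv/= x0.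
have ctF x : 0 < x -> {for x, continuous F}.
  by move=> x0; apply: differentiable_continuous; apply/derivable1_diffP/dF.
rewrite (@continuous_FTC2 _ (@powR R ^~ e) F) //.
- by rewrite -EFinB /F mulrBr.
- apply: continuous_in_subspaceT => x; rewrite inE/= in_itv/= => /andP[ax _].
  exact/cF/(lt_le_trans a0).
- split.
  + move=> x; rewrite in_itv/= => /andP[ax _]; exact/dF/(lt_trans a0).
  + exact/cvg_at_right_filter/ctF.
  + exact/cvg_at_left_filter/ctF/(lt_trans a0).
- move=> x; rewrite in_itv/= => /andP[ax _].
  have x0 := lt_trans a0 ax.
  rewrite /F derive1E deriveM //; last by apply: derivable_powR; rewrite in_itv/= x0.
  rewrite derive_cst scaler0 addr0 -derive1E powR_derive1 ?in_itv/= ?x0//.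
  by rewrite addrK /GRing.scale/= mulrA mulVf// mul1r.
Qed.

Lemma ge0_integral_bigcup_le (F : (set R)^nat) (f : R -> \bar R) (M : \bar R) :
  (forall i, measurable (F i)) -> nondecreasing_seq F ->
  measurable_fun setT f -> (forall x, (0 <= f x)%E) ->
  (forall i, (\int[mu]_(x in F i) f x <= M)%E) ->
  (\int[mu]_(x in \bigcup_i F i) f x <= M)%E.
Proof.
move=> mF ndF mf f0 FM.
have c : (\int[mu]_(x in F i) f x @[i --> \oo] -->
    \int[mu]_(x in \bigcup_i F i) f x)%E.
  apply: ge0_nondecreasing_set_cvg_integral => //.
  by move=> i; exact: measurable_funTS.
rewrite -(cvg_lim _ c)//; apply: lime_le; first by apply/cvg_ex; eexists; exact: c.
by near=> n; exact: FM.
Unshelve. all: end_near. Qed.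

Lemma integral_far_kernel sigma rho t : 1 < sigma -> 0 < rho ->
  (\int[mu]_s (far_kernel sigma rho (s - t))%:E
    <= (2 / (sigma - 1) * rho `^ (1 - sigma))%:E)%E.
Proof.
move=> s1 r0.
have mk : measurable_fun setT (fun x => (far_kernel sigma rho x)%:E).
  by apply/measurable_EFinP; exact: measurable_far_kernel.
have k0 x : (0 <= (far_kernel sigma rho x)%:E)%E by rewrite lee_fin far_kernel_ge0.
rewrite (ge0_integral_shift (- t) mk k0).
apply: (le_trans (ge0_integral_even mk k0 _)).
  by move=> x; rewrite /far_kernel normrN.
rewrite -mulrA EFinM lee_wpmul2l//.
have -> : (\int[mu]_(s in `[0%R, +oo[) (far_kernel sigma rho s)%:E =
   \int[mu]_(s in `[rho, +oo[) (s `^ (- sigma))%:E)%E.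
  rewrite integral_mkcond [RHS]integral_mkcond; apply: eq_integral => x _.
  rewrite /patch /= !mem_setE !in_itv/= !andbT /far_kernel.
  case: (leP 0 x) => [x0|x0].
    by rewrite ger0_norm//; case: leP.
  by rewrite leNgt (lt_trans x0 r0).
rewrite (_ : `[rho, +oo[%classic = \bigcup_n `[rho, rho + n.+1%:R]%classic); last first.
  apply/seteqP; split => x /=; rewrite in_itv/= andbT.
    move=> rx; exists (Num.trunc (x - rho)) => //=; rewrite in_itv/= rx/= -lerBlDl.
    by rewrite ltW// truncnS_gt.
  by case=> n _ /=; rewrite in_itv/= => /andP[].
apply: ge0_integral_bigcup_le => //.
- move=> m n mn; apply/subsetPset => x /=; rewrite !in_itv/= => /andP[-> /=] /le_trans; apply.
  by rewrite lerD2l ler_nat.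
- apply/measurable_EFinP; exact: measurable_powR.
- by move=> x; rewrite lee_fin powR_ge0.
- move=> n; rewrite integral_powR_itv//; last 2 first.
    by rewrite ltrDl.
    by rewrite addrC subr_eq0 lt_eqF.
  rewrite lee_fin (addrC _ 1) -[X in X^-1 * _]opprB invrN mulNr -mulrN opprB.
  apply: ler_wpM2l; first by rewrite invr_ge0 subr_ge0 ltW.
  by rewrite lerBlDr lerDl powR_ge0.
Qed.

Lemma integral_near_kernel beta rho t : 0 <= beta < 1 -> 0 < rho ->
  (\int[mu]_s (near_kernel beta rho (s - t))%:E
    <= (2 / (1 - beta) * rho `^ (1 - beta))%:E)%E.
Proof.
move=> /andP[b0 b1] r0.
have mk : measurable_fun setT (fun x => (near_kernel beta rho x)%:E).
  by apply/measurable_EFinP; exact: measurable_near_kernel.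
have k0 x : (0 <= (near_kernel beta rho x)%:E)%E by rewrite lee_fin near_kernel_ge0.
rewrite (ge0_integral_shift (- t) mk k0).
apply: (le_trans (ge0_integral_even mk k0 _)).
  by move=> x; rewrite /near_kernel normrN.
rewrite -mulrA EFinM lee_wpmul2l//.
apply: (@le_trans _ _ (\int[mu]_(s in `]0%R, rho]) (s `^ (- beta))%:E)%E).
  rewrite -integral_itv_obnd_cbnd; last exact: measurable_funTS.
  rewrite integral_mkcond [leRHS]integral_mkcond.
  apply: ge0_le_integral => //.
  - by move=> x _; apply: erestrict_ge0.
  - by apply/(measurable_restrictT _ _).1 => //; exact: measurable_funTS.
  - apply/(measurable_restrictT _ _).1 => //; apply: measurable_funTS.
    by apply/measurable_EFinP; exact: measurable_powR.
  - move=> x _; rewrite /patch /= !mem_setE !in_itv/= !andbT /near_kernel.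
    case: (ltP 0 x) => [x0|x0] //=; rewrite gtr0_norm//.
    case: ltP => [/ltW ->//|_]; case: ifP => // _.
    by rewrite lee_fin powR_ge0.
(* The left ends start at [rho / 2], so that every interval is nondegenerate, as [integral_powR_itv]
   demands. *)
rewrite (_ : `]0%R, rho]%classic = \bigcup_n `[rho / n.+2%:R, rho]%classic); last first.
  apply/seteqP; split => x /=; rewrite in_itv/=.
    move=> /andP[x0 xr]; exists (Num.trunc (rho / x)) => //=; rewrite in_itv/= xr andbT.
    rewrite ler_pdivrMr// -ler_pdivrMl// mulrC ltW//.
    by rewrite (lt_trans (truncnS_gt _))// ltr_nat.
  case=> n _ /=; rewrite in_itv/= => /andP[+ ->]; rewrite andbT; apply: lt_le_trans.
  by rewrite divr_gt0.
apply: ge0_integral_bigcup_le => //.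
- move=> m n mn; apply/subsetPset => x /=; rewrite !in_itv/= => /andP[+ ->]; rewrite andbT.
  apply: le_trans; rewrite ler_pM2l// lef_pV2 ?posrE// ler_nat.
  by rewrite !ltnS.
- apply/measurable_EFinP; exact: measurable_powR.
- by move=> x; rewrite lee_fin powR_ge0.
- move=> n; rewrite integral_powR_itv//; last 3 first.
    by rewrite divr_gt0.
    by rewrite ltr_pdivrMr// ltr_pMr// ltr1n.
    by rewrite addrC subr_eq0 gt_eqF.
  rewrite lee_fin (addrC _ 1).
  apply: ler_wpM2l; first by rewrite invr_ge0 subr_ge0 ltW.
  by rewrite lerBlDr lerDl powR_ge0.
Qed.

End power_integrals.

(** * Exponential sums and Schur's test *)

Section discrete.
Context {R : realType}.

Lemma sub_sum_ge0 (I : eqType) (r r' : seq I) (f : I -> R) :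
  uniq r -> {subset r <= r'} -> (forall i, 0 <= f i) ->
  \sum_(i <- r) f i <= \sum_(i <- r') f i.
Proof.
move=> ur rr' f0; elim: r' r ur rr' => [|x r' IH] r ur rr'.
  by case: r rr' {ur} => [|y r] // /(_ y); rewrite mem_head => /(_ isT).
rewrite big_cons; have [xr|xr] := boolP (x \in r); last first.
  apply: (le_trans (IH r ur _)); last by rewrite lerDr.
  move=> y yr; have := rr' _ yr; rewrite inE => /orP[/eqP yx|//].
  by rewrite -yx yr in xr.
rewrite (big_rem x)//= lerD2l; apply: IH; first exact: rem_uniq.
move=> y; rewrite mem_rem_uniq// inE => /andP[yx /rr'].
by rewrite inE (negbTE yx).
Qed.

Lemma geometric_sum_le (q : R) (s : seq nat) : 0 <= q < 1 -> uniq s ->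
  \sum_(n <- s) q ^+ n <= (1 - q)^-1.
Proof.
move=> /andP[q0 q1] us.
apply: (@le_trans _ _ (\sum_(n <- iota 0 (\max_(i <- s) i).+1) q ^+ n)).
  apply: sub_sum_ge0 => // [n ns|n]; last exact: exprn_ge0.
  by rewrite mem_iota/= add0n ltnS leq_bigmax_seq.
set N := (\max_(i <- s) i).+1.
rewrite -[X in iota 0 X]subn0 -/(index_iota 0 N) big_mkord.
rewrite -[leRHS]mul1r ler_pdivlMr ?subr_gt0// mulrC.
by rewrite -opprB mulNr -subrX1 opprB lerBlDr lerDl exprn_ge0.
Qed.

(** Uniformity in the centre [x] is the point: moving [x] to its floor costs a factor [expR delta],
    and the integers on either side of the floor then give a geometric series each. *)
Lemma exp_sum_le (delta : R) : 0 < delta ->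
  exists C : R, 0 < C /\ forall (x : R) (r : seq int), uniq r ->
    \sum_(k <- r) expR (- (delta * `|k%:~R - x|)) <= C.
Proof.
move=> d0; set q := expR (- delta).
have q0 : 0 < q by exact: expR_gt0.
have q1 : q < 1 by rewrite expR_lt1 oppr_lt0.
exists (expR delta * ((1 - q)^-1 + (1 - q)^-1)); split.
  by rewrite mulr_gt0 ?expR_gt0// addr_gt0// invr_gt0 subr_gt0.
move=> x r ur; set k0 := Num.floor x.
apply: (@le_trans _ _ (\sum_(k <- r) expR delta * q ^+ `|k - k0|%N)).
  apply: ler_sum => k _; rewrite /q -expRM_natl -expRD ler_expR.
  have fx := floor_itv x; rewrite -/k0 in fx.
  have -> : `|k - k0|%N%:R = `|k%:~R - k0%:~R| :> R.
    by rewrite -intrB -intr_norm -abszE.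
  move: fx; rewrite intrD => /andP[fx1 fx2].
  rewrite mulrN -subr_ge0 opprK.
  rewrite (_ : _ + _ = delta * (1 - `|k%:~R - k0%:~R| + `|k%:~R - x|)); last by ring.
  rewrite mulr_ge0 ?ltW//.
  have := ler_normD (k%:~R - x) (x - k0%:~R).
  rewrite subrKA (ger0_norm (_ : 0 <= x - k0%:~R)) ?subr_ge0//.
  by move=> h; lra.
rewrite -mulr_sumr ler_wpM2l ?expR_ge0//.
rewrite (bigID (fun k => k0 <= k))/=; apply: lerD.
  rewrite -big_filter -(big_map (fun k => `|k - k0|%N) xpredT (fun n => q ^+ n)).
  apply: geometric_sum_le; first by rewrite ltW.
  rewrite map_inj_in_uniq ?filter_uniq// => k l; rewrite !mem_filter.
  by move=> /andP[k1 _] /andP[l1 _]; lia.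
rewrite -big_filter -(big_map (fun k => `|k - k0|%N) xpredT (fun n => q ^+ n)).
apply: geometric_sum_le; first by rewrite ltW.
rewrite map_inj_in_uniq ?filter_uniq// => k l; rewrite !mem_filter.
by rewrite -!ltNge => /andP[k1 _] /andP[l1 _]; lia.
Qed.

(** The optimal weight is [lam = v / u]; if [u] or [v] vanishes, [lam] is sent to one end of its
    range at the cost of an arbitrarily small [e]. *)
Lemma le_mul_of_amgm (X u v : R) : 0 <= u -> 0 <= v ->
  (forall lam, 0 < lam -> X *+ 2 <= lam * u ^+ 2 + lam^-1 * v ^+ 2) -> X <= u * v.
Proof.
move=> u0 v0 H; apply/ler_addgt0Pr => e e0.
have := u0; rewrite le_eqVlt => /predU1P[u_0|u_gt0]; last first.
  have := v0; rewrite le_eqVlt => /predU1P[v_0|v_gt0]; last first.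
    have := H (v / u) (divr_gt0 v_gt0 u_gt0).
    have -> : v / u * u ^+ 2 + (v / u)^-1 * v ^+ 2 = (u * v) *+ 2.
      by field; rewrite !gt_eqF.
    by rewrite lerMn2r/= => /le_trans; apply; rewrite lerDl ltW.
  have := H (e / u ^+ 2) (divr_gt0 e0 (exprn_gt0 _ u_gt0)).
  rewrite -v_0 mulr0 expr0n mulr0 addr0 add0r divfK ?gt_eqF ?exprn_gt0//.
  rewrite mulr2n => h.
  by have [X0|X0] := lerP X 0; [exact: le_trans X0 (ltW e0)|lra].
(* For [u = 0] this large [lam] leaves a term of size at most [e]; the [+ 1] keeps it positive when
   [v = 0]. *)
have := H ((v ^+ 2 + 1) / e) (divr_gt0 _ e0).
rewrite -u_0 mul0r expr0n mulr0 add0r.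
move=> /(_ _)/wrap[|]; first by rewrite ltr_wpDl// sqr_ge0.
rewrite invf_div mulrAC -mulrA mulr2n => h.
have : e * (v ^+ 2 / (v ^+ 2 + 1)) <= e.
  apply: ler_piMr; first exact: ltW.
  have w0 : 0 < v ^+ 2 + 1 by rewrite ltr_wpDl// sqr_ge0.
  by rewrite ler_pdivrMr// mul1r lerDl.
have [X0|X0] := lerP X 0; first by rewrite add0r (le_trans X0 (ltW e0)).
by move=> ?; lra.
Qed.

(** Weighted arithmetic-geometric means separate [a] from [b], each then sees only row sums or
    column sums of [W], and the weight is optimised at the end. *)
Lemma schur_test (I J : Type) (r : seq I) (s : seq J) (W : I -> J -> R) (A c d : R)
    (a : I -> R) (b : J -> R) :
  (forall i j, 0 <= W i j) -> 0 <= A -> 0 <= c -> 0 <= d ->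
  (forall i, \sum_(j <- s) W i j <= A) -> (forall j, \sum_(i <- r) W i j <= A) ->
  \sum_(i <- r) a i ^+ 2 <= c ^+ 2 -> \sum_(j <- s) b j ^+ 2 <= d ^+ 2 ->
  \sum_(i <- r) \sum_(j <- s) W i j * (a i * b j) <= A * (c * d).
Proof.
move=> W0 A0 c0 d0 row col ac bd.
have -> : A * (c * d) = (A * c) * d by rewrite mulrA.
suff H lam : 0 < lam ->
    (\sum_(i <- r) \sum_(j <- s) W i j * (a i * b j)) *+ 2 <=
    A * (lam * c ^+ 2 + lam^-1 * d ^+ 2).
  have := A0; rewrite le_eqVlt => /predU1P[A_0|A_gt0].
    by have := H 1 ltr01; rewrite -A_0 !mul0r pmulrn_lle0.
  apply: le_mul_of_amgm => //; first exact: mulr_ge0.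
  move=> lam lam0; have := H _ (mulr_gt0 A_gt0 lam0); congr (_ <= _).
  by field; rewrite !gt_eqF.
move=> lam0; rewrite mulr2n -big_split/=.
apply: (@le_trans _ _ (\sum_(i <- r) \sum_(j <- s) W i j * (lam * a i ^+ 2) +
   \sum_(i <- r) \sum_(j <- s) W i j * (lam^-1 * b j ^+ 2))).
  rewrite -big_split/=; apply: ler_sum => i _; rewrite -!big_split/=.
  apply: ler_sum => j _; rewrite -!mulrDr ler_wpM2l//.
  rewrite -subr_ge0 (_ : _ - _ = lam^-1 * (lam * a i - b j) ^+ 2); last first.
    by field; rewrite gt_eqF.
  by rewrite mulr_ge0 ?sqr_ge0// invr_ge0 ltW.
rewrite mulrDr; apply: lerD.
  under eq_bigr do rewrite -mulr_suml.
  apply: (@le_trans _ _ (\sum_(i <- r) A * (lam * a i ^+ 2))).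
    by apply: ler_sum => i _; rewrite ler_wpM2r// mulr_ge0 ?sqr_ge0// ltW.
  by rewrite -!mulr_sumr ler_wpM2l// ler_wpM2l// ltW.
rewrite exchange_big/=.
under eq_bigr do rewrite -mulr_suml.
apply: (@le_trans _ _ (\sum_(j <- s) A * (lam^-1 * b j ^+ 2))).
  by apply: ler_sum => i _; rewrite ler_wpM2r// mulr_ge0 ?sqr_ge0// invr_ge0 ltW.
by rewrite -!mulr_sumr ler_wpM2l// ler_wpM2l// invr_ge0 ltW.
Qed.

(** Duality: [schur_test] is applied with [a] equal to the image of [b] itself, and one factor of
    its l^2 norm is divided out. *)
Lemma schur_test_sqr (I J : Type) (r : seq I) (s : seq J) (W : I -> J -> R) (A d : R)
    (b : J -> R) :
  (forall i j, 0 <= W i j) -> 0 <= A -> 0 <= d ->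
  (forall i, \sum_(j <- s) W i j <= A) -> (forall j, \sum_(i <- r) W i j <= A) ->
  \sum_(j <- s) b j ^+ 2 <= d ^+ 2 ->
  \sum_(i <- r) (\sum_(j <- s) W i j * b j) ^+ 2 <= (A * d) ^+ 2.
Proof.
move=> W0 A0 d0 row col bd.
set X := \sum_(i <- r) _.
have X0 : 0 <= X by apply: sumr_ge0 => i _; exact: sqr_ge0.
have Xs : Num.sqrt X ^+ 2 = X by rewrite sqr_sqrtr.
have : X <= A * (Num.sqrt X * d).
  have := @schur_test I J r s W A (Num.sqrt X) d (fun i => \sum_(j <- s) W i j * b j) b W0 A0.
  rewrite Xs => /(_ (sqrtr_ge0 _) d0 row col (lexx _) bd); apply: le_trans.
  apply: ler_sum => i _; rewrite expr2 [leLHS]mulr_sumr; apply: ler_sum => j _.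
  by rewrite mulrCA.
have := X0; rewrite le_eqVlt => /predU1P[<-|X_gt0]; first by rewrite sqr_ge0.
rewrite -[X in X <= _ -> _]Xs -[X in _ -> X <= _]Xs expr2 mulrCA.
rewrite ler_pM2l ?sqrtr_gt0// => h.
by rewrite -expr2 ler_pXn2r// nnegrE ?sqrtr_ge0 ?mulr_ge0.
Qed.

End discrete.

(** * Convolution inequalities and the Hardy-Littlewood-Sobolev inequality *)

Section kernels.
Context {R : realType}.
Local Notation mu := (@lebesgue_measure R).
Implicit Types (f g k : R -> R).

Lemma powR_expR (a x : R) : expR a `^ x = expR (x * a).
Proof. by rewrite /powR gt_eqF ?expR_gt0// expRK. Qed.

(* Holds for non-measurable functions too, the integral of a nonnegative function
   being the supremum of those of the simple functions below it. *)
Lemma le_ge0_integral d (T : measurableType d) (m : {measure set T -> \bar R})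
    (f g : T -> \bar R) : (forall x, (0 <= f x)%E) ->
  (forall x, (f x <= g x)%E) -> (\int[m]_x f x <= \int[m]_x g x)%E.
Proof.
move=> f0 fg.
have g0 x : (0 <= g x)%E by exact: le_trans (fg x).
rewrite !ge0_integralTE//; apply: ereal_sup_le => _ [h hf <-].
by exists h => // x; exact: le_trans (fg x).
Qed.

Lemma measurable_conv f g k : measurable_fun setT f -> measurable_fun setT g ->
  measurable_fun setT k ->
  measurable_fun setT (fun z : R * R => (f z.1 * g z.2 * k (z.1 - z.2))%:E).
Proof.
move=> mf mg mk; apply/measurable_EFinP; apply: measurable_funM.
  by apply: measurable_funM; [exact: measurableT_comp mf _|exact: measurableT_comp mg _].
by apply: (measurableT_comp mk); exact: measurable_funB.
Qed.

Lemma tonelli_conv g k (A : R) : measurable_fun setT g -> measurable_fun setT k ->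
  (forall x, 0 <= g x) -> (forall x, 0 <= k x) ->
  (forall t, \int[mu]_s (k (s - t))%:E <= A%:E)%E ->
  (\int[mu]_s \int[mu]_s' (g s' * k (s - s'))%:E <= A%:E * \int[mu]_s (g s)%:E)%E.
Proof.
move=> mg mk g0 k0 kA.
have A0 : (0 <= A%:E)%E.
  by apply: le_trans (kA 0); apply: integral_ge0 => x _; rewrite lee_fin.
have mgk : measurable_fun setT (fun z : R * R => (g z.2 * k (z.1 - z.2))%:E).
  have := measurable_conv (@measurable_cst _ _ R R setT 1) mg mk.
  by under eq_fun do rewrite mul1r.
have gk0 (z : R * R) : (0 <= (g z.2 * k (z.1 - z.2))%:E)%E by rewrite lee_fin mulr_ge0.
have /= -> := fubini_tonelli (m1 := mu) (m2 := mu) _ mgk gk0.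
rewrite -ge0_integralZl//; last 2 first.
- exact/measurable_EFinP.
- by move=> x _; rewrite lee_fin.
apply: le_ge0_integral => t.
  by apply: integral_ge0 => s _; rewrite lee_fin mulr_ge0.
under eq_integral do rewrite EFinM.
rewrite ge0_integralZl//.
- by rewrite muleC lee_wpmul2r// lee_fin.
- apply/measurable_EFinP; apply: (measurableT_comp mk).
  by apply: measurable_funB => //; exact: measurable_cst.
- by move=> x _; rewrite lee_fin.
- by rewrite lee_fin.
Qed.

(** Pointwise [x y <= x^2 + y^2], then Tonelli once in each variable; since [k] is even its mass is
    the same in both. *)
Lemma schur_integral f g k (A : R) : measurable_fun setT f ->
  measurable_fun setT g -> measurable_fun setT k ->
  (forall x, 0 <= f x) -> (forall x, 0 <= g x) -> (forall x, 0 <= k x) ->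
  (forall x, k (- x) = k x) ->
  (forall t, \int[mu]_s (k (s - t))%:E <= A%:E)%E ->
  (\int[mu]_s \int[mu]_s' (f s * g s' * k (s - s'))%:E
     <= A%:E * (\int[mu]_s (f s ^+ 2)%:E + \int[mu]_s (g s ^+ 2)%:E))%E.
Proof.
move=> mf mg mk f0 g0 k0 ke kA.
have A0 : (0 <= A%:E)%E.
  by apply: le_trans (kA 0); apply: integral_ge0 => x _; rewrite lee_fin.
have mf2 : measurable_fun setT (fun x => f x ^+ 2) by exact: measurable_funX.
have mg2 : measurable_fun setT (fun x => g x ^+ 2) by exact: measurable_funX.
have m1 : measurable_fun setT (fun z : R * R => (f z.1 ^+ 2 * k (z.1 - z.2))%:E).
  have := measurable_conv mf2 (@measurable_cst _ _ R R setT 1) mk.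
  by under eq_fun do rewrite mulr1.
have m2 : measurable_fun setT (fun z : R * R => (g z.2 ^+ 2 * k (z.1 - z.2))%:E).
  have := measurable_conv (@measurable_cst _ _ R R setT 1) mg2 mk.
  by under eq_fun do rewrite mul1r.
have mt t : measurable_fun setT (fun s : R => (k (t - s))%:E).
  apply/measurable_EFinP; apply: (measurableT_comp mk).
  by apply: measurable_funB => //; exact: measurable_cst.
apply: (@le_trans _ _ (\int[mu]_s (\int[mu]_s' (f s ^+ 2 * k (s - s'))%:E +
   \int[mu]_s' (g s' ^+ 2 * k (s - s'))%:E))%E).
  apply: le_ge0_integral => s.
    by apply: integral_ge0 => s' _; rewrite lee_fin !mulr_ge0.
  rewrite -ge0_integralD//.
  - apply: le_ge0_integral => s'; first by rewrite lee_fin !mulr_ge0.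
    rewrite -EFinD lee_fin -mulrDl ler_wpM2r//.
    rewrite (@le_trans _ _ ((f s ^+ 2 + g s' ^+ 2) / 2))//.
      rewrite -subr_ge0 (_ : _ - _ = (f s - g s') ^+ 2 / 2); last by field.
      by rewrite divr_ge0// sqr_ge0.
    by rewrite ler_pdivrMr// ler_peMr ?addr_ge0 ?sqr_ge0// ler1n.
  - by move=> x _; rewrite lee_fin mulr_ge0 ?sqr_ge0.
  - exact: (measurableT_comp m1 (pair1_measurable s)).
  - by move=> x _; rewrite lee_fin mulr_ge0 ?sqr_ge0.
  - exact: (measurableT_comp m2 (pair1_measurable s)).
rewrite ge0_integralD//.
- rewrite muleDr//; last first.
    by apply: ge0_adde_def; rewrite inE; apply: integral_ge0 => x _; rewrite lee_fin sqr_ge0.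
  apply: leeD; last first.
    by apply: tonelli_conv => // x; exact: sqr_ge0.
  rewrite -ge0_integralZl//; last 2 first.
  + exact/measurable_EFinP.
  + by move=> x _; rewrite lee_fin sqr_ge0.
  apply: le_ge0_integral => t.
    by apply: integral_ge0 => s _; rewrite lee_fin mulr_ge0 ?sqr_ge0.
  under eq_integral do rewrite EFinM.
  rewrite ge0_integralZl//.
  + rewrite muleC lee_wpmul2r ?lee_fin ?sqr_ge0//.
    apply: le_trans (kA t); apply: le_of_eq.
    by apply: eq_integral => x _; rewrite -ke opprB.
  + exact: mt.
  + by move=> x _; rewrite lee_fin.
  + by rewrite lee_fin sqr_ge0.
- by move=> x _; apply: integral_ge0 => s _; rewrite lee_fin mulr_ge0 ?sqr_ge0.
- apply: (measurable_fun_fubini_tonelli_F (m2 := mu) _ m1) => z.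
  by rewrite lee_fin mulr_ge0 ?sqr_ge0.
- by move=> x _; apply: integral_ge0 => s _; rewrite lee_fin mulr_ge0 ?sqr_ge0.
- apply: (measurable_fun_fubini_tonelli_F (m2 := mu) _ m2) => z.
  by rewrite lee_fin mulr_ge0 ?sqr_ge0.
Qed.

Lemma ge0_powRD (x a b : R) : 0 < x -> x `^ (a + b) = x `^ a * x `^ b.
Proof. by move=> x0; rewrite powRD// (gt_eqF x0) implybT. Qed.

Lemma pos_expR (x : R) : 0 < x -> exists l, x = expR l.
Proof. by move=> x0; exists (ln x); rewrite lnK. Qed.

(* Applied to the values [y] of [f] below [x = f s]; the cut radius [rho] balances
   the contributions of the two kernels. *)
Lemma hls_pointwise (al B x y r : R) : let p := 2 / (2 - al) in
  let rho := B * x `^ (- p) in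
  0 < al < 1 -> 0 < B -> 0 < x -> 0 <= y <= x -> 0 <= r ->
  y * r `^ (- al) <= x * near_kernel al rho r + x * rho `^ (2 - al) * far_kernel 2 rho r
    + y `^ p * (x `^ (1 - p) * rho `^ (- al)).
Proof.
move=> p rho /andP[a0 a1] B0 x0 /andP[y0 yx] r0.
have rho0 : 0 < rho by rewrite mulr_gt0// powR_gt0.
have rest : 0 <= y `^ p * (x `^ (1 - p) * rho `^ (- al)) by rewrite !mulr_ge0 ?powR_ge0.
rewrite /near_kernel /far_kernel ger0_norm//; case: ltP => [rr|rr].
  rewrite mulr0 addr0 (le_trans (ler_wpM2r (powR_ge0 _ _) yx))//.
  by rewrite lerDl.
have {}r0 : 0 < r by exact: lt_le_trans rr.
rewrite mulr0 add0r.
(* At this threshold the last two terms coincide. Below it the far kernel alone suffices; above it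
   write y = y^p y^(1-p), where y^(1-p) is at most the same power of the threshold because p > 1,
   and [(2 - al) * (p - 1) = al] removes [r]. *)
have [yz|yz] := lerP y (x * (rho / r) `^ (2 - al)).
  rewrite ler_wpDr// (le_trans (ler_wpM2r (powR_ge0 _ _) yz))//.
  apply: le_of_eq.
  move: rho0 x0 r0; rewrite -/rho; clearbody rho.
  move=> /pos_expR[lrho ->] /pos_expR[lx ->] /pos_expR[lr ->].
  rewrite -expRN -expRD !powR_expR -!expRD; congr expR; ring.
apply: ler_wpDl; first by rewrite !mulr_ge0 ?powR_ge0// ltW.
have {}y0 : 0 < y by apply: le_lt_trans yz; rewrite mulr_ge0 ?powR_ge0 ?ltW.
have pE : p - 1 = al / (2 - al) by rewrite /p; field; lra.
have p10 : 0 <= p - 1 by rewrite pE divr_ge0//; lra.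
have -> : y `^ p = y * y `^ (p - 1).
  by rewrite -[X in X * _]powRr1 ?ltW// -ge0_powRD//; congr (_ `^ _); ring.
rewrite -mulrA; apply: ler_wpM2l; first exact: ltW.
have h : (x * (rho / r) `^ (2 - al)) `^ (p - 1) <= y `^ (p - 1).
  by apply: ge0_ler_powR => //; rewrite ?nnegrE ?mulr_ge0 ?powR_ge0 //; exact: ltW.
apply: (@le_trans _ _ ((x * (rho / r) `^ (2 - al)) `^ (p - 1) * (x `^ (1 - p) * rho `^ (- al)))).
  apply: le_of_eq; rewrite pE (_ : 1 - p = - (al / (2 - al)));
      last first.
    by rewrite -pE; ring.
  move: rho0 x0 r0; rewrite -/rho; clearbody rho.
  move=> /pos_expR[lrho ->] /pos_expR[lx ->] /pos_expR[lr ->].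
  rewrite -expRN -expRD !powR_expR -!expRD powR_expR -expRD; congr expR; field; lra.
by rewrite ler_wpM2r ?mulr_ge0 ?powR_ge0.
Qed.

(** With rho = B f(s)^(-p) and [p * (2 - al) = 2], each of the three terms of [hls_pointwise]
    integrates to a multiple of B^(1-al) f(s)^p. The multiples are the masses [2 / (1 - al)] and [2]
    of the two kernels, and [1] for the term bounded by [B]. *)
Lemma hls_inner (al B s : R) f : let p := 2 / (2 - al) in
  0 < al < 1 -> measurable_fun setT f -> (forall x, 0 <= f x) -> 0 < B ->
  (\int[mu]_x (f x `^ p)%:E <= B%:E)%E -> 0 < f s ->
  (\int[mu]_s' (if f s' <= f s then f s * f s' * `|s - s'| `^ (- al) else 0)%:E
    <= ((2 / (1 - al) + 2 + 1) * B `^ (1 - al) * f s `^ p)%:E)%E.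
Proof.
move=> p al01 mf f0 B0 fB fs0; have /andP[al0 al1] := al01.
have mfp : measurable_fun setT (fun x => f x `^ p).
  by apply: (@measurableT_comp _ _ _ _ _ _ (@powR R ^~ p)).
have Phi0 s' : (0 <= (if f s' <= f s then f s * f s' * `|s - s'| `^ (- al) else 0)%:E)%E.
  by rewrite lee_fin; case: ifP => // _; rewrite !mulr_ge0// powR_ge0.
set rho := B * f s `^ (- p).
have rho0 : 0 < rho by apply: mulr_gt0 => //; exact: powR_gt0.
set x := f s.
pose a1 := x * x; pose a2 := x * (x * rho `^ (2 - al)).
pose a3 := x * (x `^ (1 - p) * rho `^ (- al)).
have [a10 a20 a30] : [/\ 0 <= a1, 0 <= a2 & 0 <= a3].
  by split; rewrite !mulr_ge0 ?powR_ge0 ?ltW.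
pose g s' := (a1%:E * (near_kernel al rho (s' - s))%:E + a2%:E * (far_kernel 2 rho (s' - s))%:E
    + a3%:E * (f s' `^ p)%:E)%E.
have mshift : measurable_fun setT (fun s' : R => s' - s).
  by apply: measurable_funB => //; exact: measurable_cst.
apply: (@le_trans _ _ (\int[mu]_s' g s')%E).
  apply: le_ge0_integral => s' //.
  rewrite /g -!EFinM -!EFinD lee_fin.
  case: ifPn => [h|_]; last first.
    by rewrite !addr_ge0// mulr_ge0 ?near_kernel_ge0 ?far_kernel_ge0 ?powR_ge0.
  have /= := @hls_pointwise al B (f s) (f s') `|s' - s| al01 B0 fs0 _ (normr_ge0 _).
  rewrite f0 h => /(_ isT); rewrite -/p -/rho /near_kernel /far_kernel normr_id.
  move=> /(ler_wpM2l (ltW fs0)); rewrite distrC -/x !mulrA; congr (_ <= _).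
  by rewrite /a1 /a2 /a3; ring.
have mn : measurable_fun setT (fun s' : R => (near_kernel al rho (s' - s))%:E).
  apply/measurable_EFinP; exact: (measurableT_comp (measurable_near_kernel al rho) mshift).
have mr : measurable_fun setT (fun s' : R => (far_kernel 2 rho (s' - s))%:E).
  apply/measurable_EFinP; exact: (measurableT_comp (measurable_far_kernel 2 rho) mshift).
have mp : measurable_fun setT (fun s' : R => (f s' `^ p)%:E) by exact/measurable_EFinP.
have n0 s' : (0 <= (near_kernel al rho (s' - s))%:E)%E by rewrite lee_fin near_kernel_ge0.
have r0 s' : (0 <= (far_kernel 2 rho (s' - s))%:E)%E by rewrite lee_fin far_kernel_ge0.
have p0 s' : (0 <= (f s' `^ p)%:E)%E by rewrite lee_fin powR_ge0.
rewrite /g !ge0_integralD//; last 8 first.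
- by move=> s' _; rewrite mule_ge0.
- exact: measurable_funeM.
- by move=> s' _; rewrite mule_ge0.
- exact: measurable_funeM.
- by move=> s' _; rewrite adde_ge0// mule_ge0.
- by apply: emeasurable_funD; exact: measurable_funeM.
- by move=> s' _; rewrite mule_ge0.
- exact: measurable_funeM.
rewrite !ge0_integralZl//.
have al01' : 0 <= al < 1 by rewrite ltW.
have I1 := @integral_near_kernel _ al rho s al01' rho0.
have I2 := @integral_far_kernel _ 2 rho s (ltr1n _ _) rho0.
apply: (@le_trans _ _ (a1%:E * (2 / (1 - al) * rho `^ (1 - al))%:E +
  a2%:E * (2 / (2 - 1) * rho `^ (1 - 2))%:E + a3%:E * B%:E)%E).
  by rewrite !leeD// lee_wpmul2l.
rewrite -!EFinM -!EFinD lee_fin; apply: le_of_eq.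
have E1 : a1 * rho `^ (1 - al) = B `^ (1 - al) * x `^ p.
  rewrite /a1 /rho /x; have /pos_expR[b ->] := B0; have /pos_expR[l ->] := fs0.
  rewrite !powR_expR -!expRD powR_expR -!expRD; congr expR; rewrite /p; field; lra.
have E2 : a2 * rho `^ (1 - 2) = B `^ (1 - al) * x `^ p.
  rewrite /a2 /rho /x; have /pos_expR[b ->] := B0; have /pos_expR[l ->] := fs0.
  rewrite !powR_expR -!expRD !powR_expR -!expRD; congr expR; rewrite /p; field; lra.
have E3 : a3 * B = B `^ (1 - al) * x `^ p.
  rewrite /a3 /rho /x; have /pos_expR[b ->] := B0; have /pos_expR[l ->] := fs0.
  rewrite !powR_expR -!expRD !powR_expR -!expRD; congr expR; rewrite /p; field; lra.
rewrite [a1 * _]mulrCA [a2 * _]mulrCA E1 E2 E3; field; lra.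
Qed.

(** By symmetry the larger of the two values of [f] may be taken to be [f s], at the cost of a
    factor 2; [hls_inner] then leaves the single integral of f^p. *)
Lemma hls (al : R) : 0 < al < 1 -> exists C : R, 0 < C /\
  forall f B, measurable_fun setT f -> (forall x, 0 <= f x) -> 0 < B ->
  (\int[mu]_s (f s `^ (2 / (2 - al)))%:E <= B%:E)%E ->
  (\int[mu]_s \int[mu]_s' (f s * f s' * `|s - s'| `^ (- al))%:E
    <= (C * B `^ (2 - al))%:E)%E.
Proof.
move=> al01; have /andP[al0 al1] := al01; set p := 2 / (2 - al).
pose c := 2 / (1 - al) + 2 + 1.
have c0 : 0 < c by rewrite !addr_gt0// divr_gt0// subr_gt0.
exists (2 * c); split; first by rewrite mulr_gt0.
move=> f B mf f0 B0 fB.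
pose Phi (z : R * R) : R := if f z.2 <= f z.1 then f z.1 * f z.2 * `|z.1 - z.2| `^ (- al) else 0.
have Phi0 z : (0 <= (Phi z)%:E)%E.
  by rewrite lee_fin /Phi; case: ifP => // _; rewrite !mulr_ge0// powR_ge0.
have mabs : measurable_fun setT (fun x : R => `|x| `^ (- al)).
  by apply: (@measurableT_comp _ _ _ _ _ _ (@powR R ^~ (- al))) => //.
have mPhi : measurable_fun setT (fun z => (Phi z)%:E).
  apply/measurable_EFinP; apply: measurable_fun_ifT => //.
    by apply: measurable_fun_ler; [exact: measurableT_comp mf _|exact: measurableT_comp mf _].
  by have /measurable_EFinP := measurable_conv mf mf mabs.
have mPhi' : measurable_fun setT (fun z => (Phi (z.2, z.1))%:E).
  apply: (@measurableT_comp _ _ _ _ _ _ (fun z => (Phi z)%:E)) => //.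
  exact: measurable_swap.
apply: (@le_trans _ _ (\int[mu]_s (\int[mu]_s' (Phi (s, s'))%:E +
   \int[mu]_s' (Phi (s', s))%:E))%E).
  apply: le_ge0_integral => s.
    by apply: integral_ge0 => s' _; rewrite lee_fin !mulr_ge0 ?powR_ge0.
  rewrite -ge0_integralD//.
  - apply: le_ge0_integral => s'; first by rewrite lee_fin !mulr_ge0 ?powR_ge0.
    rewrite -EFinD lee_fin /Phi/=; have [h|h] := leP (f s') (f s).
      by rewrite lerDl; case: ifP => // _; rewrite !mulr_ge0// powR_ge0.
    by rewrite add0r (ltW h) distrC (mulrC (f s')).
  - exact: (measurableT_comp mPhi (pair1_measurable s)).
  - exact: (measurableT_comp mPhi' (pair1_measurable s)).
rewrite ge0_integralD//; last 4 first.
- by move=> x _; exact: integral_ge0.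
- exact: (measurable_fun_fubini_tonelli_F (m2 := mu) _ mPhi).
- by move=> x _; exact: integral_ge0.
- exact: (measurable_fun_fubini_tonelli_F (m2 := mu) _ mPhi').
have FT : (\int[mu]_s \int[mu]_s' (Phi (s, s'))%:E =
    \int[mu]_s \int[mu]_s' (Phi (s', s))%:E)%E.
  exact: (fubini_tonelli (m1 := mu) (m2 := mu) _ mPhi Phi0).
suff H : (\int[mu]_s \int[mu]_s' (Phi (s, s'))%:E <= (c * B `^ (2 - al))%:E)%E.
  have H' := H; rewrite FT in H'.
  apply: (le_trans (leeD H H')).
  by rewrite -EFinD lee_fin -mulrA mulr_natl mulr2n.
move=> {FT mPhi mPhi' mabs}.
have mfp : measurable_fun setT (fun x => f x `^ p).
  by apply: (@measurableT_comp _ _ _ _ _ _ (@powR R ^~ p)).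
apply: (@le_trans _ _ (\int[mu]_s ((c * B `^ (1 - al))%:E * (f s `^ p)%:E))%E).
  apply: le_ge0_integral => s; first exact: integral_ge0.
  have [fs0|fs0] := eqVneq (f s) 0.
    rewrite integral0_eq; first by rewrite -EFinM lee_fin !mulr_ge0 ?powR_ge0 ?ltW.
    by move=> s' _; rewrite /Phi /= fs0 !mul0r; case: ifP.
  have {}fs0 : 0 < f s by rewrite lt_neqAle eq_sym fs0 f0.
  rewrite -EFinM.
  exact: hls_inner.
have cB : 0 <= c * B `^ (1 - al) by apply: mulr_ge0; [exact: ltW|exact: powR_ge0].
rewrite ge0_integralZl//; last 2 first.
- exact/measurable_EFinP.
- by move=> s _; rewrite lee_fin powR_ge0.
apply: (@le_trans _ _ ((c * B `^ (1 - al))%:E * B%:E)%E).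
  exact: lee_wpmul2l.
rewrite -EFinM lee_fin -mulrA; apply: ler_wpM2l; first exact: ltW.
rewrite (_ : 2 - al = (1 - al) + 1); last by ring.
by rewrite (ge0_powRD (1 - al) 1 B0) (powRr1 (ltW B0)).
Qed.

End kernels.

(** * Weak integrals in a Hilbert space *)

Section real_hilbert.
Context {R : realType} {H : zmodType}.
Variables (rip : H -> H -> R) (rs : R -> H -> H).

Definition rnorm (x : H) : R := Num.sqrt (rip x x).

(* [rs] is the multiplication by real scalars. *)
Record real_hilbert := RealHilbert {
  ripDl : forall x y z, rip (x + y) z = rip x z + rip y z ;
  ripC : forall x y, rip x y = rip y x ;
  rip_ge0 : forall x, 0 <= rip x x ;
  ripZl : forall c x y, rip (rs c x) y = c * rip x y ;
  rip_complete : forall f : nat -> H,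
    (forall e, 0 < e -> exists N, forall m n, (N <= m)%N -> (N <= n)%N ->
      rnorm (f m - f n) <= e) ->
    exists v, forall e, 0 < e -> exists N, forall n, (N <= n)%N ->
      rnorm (f n - v) <= e }.

Hypothesis hH : real_hilbert.

Lemma ripDr x y z : rip x (y + z) = rip x y + rip x z.
Proof. by rewrite !(ripC hH x) ripDl. Qed.

Lemma rip0l x : rip 0 x = 0.
Proof. by apply: (@addrI _ (rip 0 x)); rewrite -ripDl// !addr0. Qed.

Lemma ripNl x y : rip (- x) y = - rip x y.
Proof. by apply/eqP; rewrite -addr_eq0 -ripDl// addNr rip0l. Qed.

Lemma discriminant_le (a b e : R) : 0 <= a -> 0 <= e ->
  (forall t, 0 <= e + t * b *+ 2 + t ^+ 2 * a) -> b ^+ 2 <= a * e.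
Proof.
move=> a0 e0 h; have := a0; rewrite le_eqVlt => /predU1P[a_0|a_gt0].
  have [->|b0] := eqVneq b 0; first by rewrite expr0n mulr_ge0.
  (* For this [t] the hypothesis would read [0 <= - e - 2]. *)
  have := h (- (e + 1) / b).
  rewrite -a_0 mulr0 addr0 divfK// mulr2n.
  by move=> {}h; exfalso; lra.
have := h (- b / a).
rewrite (_ : _ + _ = (a * e - b ^+ 2) / a); last by field; rewrite gt_eqF.
by rewrite pmulr_lge0 ?invr_gt0// subr_ge0.
Qed.

Lemma rnorm_ge0 x : 0 <= rnorm x. Proof. exact: sqrtr_ge0. Qed.

Lemma sqr_rnorm x : rnorm x ^+ 2 = rip x x.
Proof. by rewrite sqr_sqrtr// rip_ge0. Qed.

Lemma ripDZ x y t : rip (x + rs t y) (x + rs t y) =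
  rip x x + t * rip x y *+ 2 + t ^+ 2 * rip y y.
Proof.
have Zr c u v : rip u (rs c v) = c * rip u v by rewrite ripC// ripZl// ripC.
by rewrite ripDl// !ripDr ripZl// Zr ripZl// Zr (ripC hH y x); ring.
Qed.

Lemma rip_cauchy x y : `|rip x y| <= rnorm x * rnorm y.
Proof.
rewrite -(ler_pXn2r (ltn0Sn 1)) ?nnegrE ?mulr_ge0 ?rnorm_ge0//.
rewrite real_normK ?num_real// exprMn !sqr_rnorm mulrC.
apply: discriminant_le => [||t]; rewrite ?rip_ge0//.
by rewrite -ripDZ rip_ge0.
Qed.

(** Minimises |x|^2 - 2 l(x). By the discriminant inequality a point within 1/(n+1) of the infimum
    represents [l] up to an error (n+1)^(-1/2) |h|, so a minimising sequence is Cauchy and its limit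
    represents [l]. *)
Lemma riesz (l : H -> R) (C : R) : 0 <= C ->
  (forall x y, l (x + y) = l x + l y) -> (forall c x, l (rs c x) = c * l x) ->
  (forall x, `|l x| <= C * rnorm x) ->
  exists v, forall x, rip x v = l x.
Proof.
move=> C0 lD lZ lC.
pose q x := rip x x - l x *+ 2.
have qge x : - C ^+ 2 <= q x.
  rewrite /q -sqr_rnorm; have := lC x; rewrite ler_norml => /andP[_ h].
  have := sqr_ge0 (rnorm x - C); rewrite sqrrB => h2; lra.
pose S := [set q x | x in setT].
have hS : has_inf S.
  split; first by exists (q 0), 0.
  by exists (- C ^+ 2) => _ [x _ <-].
have xn n : exists x, q x < inf S + n.+1%:R^-1.
  have [||_ [x _ <-] xS] := @inf_adherent _ S n.+1%:R^-1 => //.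
  by exists x.
have {xn} /choice[f fS] := xn.
have fl n h : `|rip (f n) h - l h| <= Num.sqrt n.+1%:R^-1 * rnorm h.
  rewrite -(ler_pXn2r (ltn0Sn 1)) ?nnegrE ?mulr_ge0 ?rnorm_ge0 ?sqrtr_ge0//.
  rewrite real_normK ?num_real// exprMn sqr_rnorm sqr_sqrtr ?invr_ge0// mulrC.
  apply: discriminant_le => [||t]; rewrite ?rip_ge0 ?invr_ge0//.
  have : inf S <= q (f n + rs t h) by apply: ge_inf; [exact: hS.2|exists (f n + rs t h)].
  have := fS n; rewrite /q ripDZ lD lZ => h1 h2.
  move: (inf S) n.+1%:R^-1 h1 h2 => i0 ee; rewrite mulrBr.
  move: (t * _) (t * _) (t ^+ 2 * _) (l _) (rip _ _) => ? ? ? ? ?; lra.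
have sq e : 0 < e -> exists N, forall n, (N <= n)%N -> Num.sqrt n.+1%:R^-1 <= e :> R.
  move=> e0; exists (Num.trunc (e ^- 2)) => n Nn.
  rewrite -(ler_pXn2r (ltn0Sn 1)) ?nnegrE ?sqrtr_ge0 ?(ltW e0)//.
  rewrite sqr_sqrtr ?invr_ge0// -[leRHS]invrK lef_pV2 ?posrE ?invr_gt0 ?exprn_gt0//.
  rewrite ltW// (lt_le_trans (truncnS_gt _))// ler_nat.
  by rewrite ltnS.
have [|v fv] := rip_complete hH (f := f).
  move=> e e0; have [N hN] := sq (e / 2) (divr_gt0 e0 (ltr0Sn _ 1)).
  exists N => m n Nm Nn; set d := f m - f n.
  have [d0|d0] := eqVneq (rnorm d) 0; first by rewrite d0 ltW.
  have {}d0 : 0 < rnorm d by rewrite lt_neqAle eq_sym d0 rnorm_ge0.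
  have E : rip d d = rip (f m) d - rip (f n) d by rewrite -ripNl -(ripDl hH).
  rewrite -(ler_pM2r d0) -expr2 sqr_rnorm E.
  have := fl m d; rewrite ler_norml => /andP[_ h1].
  have := fl n d; rewrite ler_norml => /andP[h2 _].
  have h3 := ler_wpM2r (ltW d0) (hN _ Nm).
  have h4 := ler_wpM2r (ltW d0) (hN _ Nn).
  lra.
exists v => x; rewrite ripC//; apply/eqP; rewrite -subr_eq0 -normr_le0.
apply/ler_addgt0Pr => e e0; rewrite add0r.
have x1 : 0 < rnorm x + 1 by rewrite ltr_wpDl// rnorm_ge0.
pose e' := e / 2 / (rnorm x + 1).
have e'0 : 0 < e' by rewrite !divr_gt0.
have [N1 h1] := sq _ e'0; have [N2 h2] := fv _ e'0.
have {}h1 := h1 (maxn N1 N2) (leq_maxl _ _).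
have {}h2 := h2 (maxn N1 N2) (leq_maxr _ _).
move: h1 h2; set n := maxn _ _ => h1 h2.
have -> : rip v x - l x = (rip (f n) x - l x) - rip (f n - v) x.
  by rewrite ripDl// ripNl; ring.
apply: le_trans (ler_normB _ _) _.
have E : e = e' * (rnorm x + 1) + e' * (rnorm x + 1).
  by rewrite /e'; field; rewrite gt_eqF.
rewrite E; apply: lerD.
  apply: le_trans (fl n x) _; apply: ler_pM; rewrite ?sqrtr_ge0 ?rnorm_ge0//.
  by rewrite lerDl.
apply: le_trans (rip_cauchy _ _) _; apply: ler_pM; rewrite ?rnorm_ge0//.
by rewrite lerDl.
Qed.

End real_hilbert.

(** * Simple functions of time *)

Section simple_functions.
Context {R : realType}.
Local Notation mu := (@lebesgue_measure R).

Record simple (V : zmodType) (F : R -> V) : Prop := Simple {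
  simple_finite : finite_set (range F) ;
  simple_fiber : forall x, measurable (F @^-1` [set x]) ;
  simple_support : exists M : R, forall s, M < `|s| -> F s = 0 }.

Definition cut (V : zmodType) (b : R -> bool) (F : R -> V) (s : R) : V :=
  if b s then F s else 0.

(** The finitely many fibres reduce the claim to a fixed value of [F], so [h] may depend on that
    value in any way, and [V] carries no sigma-algebra. This is what allows norms and decompositions
    to be chosen value by value. *)
Lemma measurable_simple (V : zmodType) d (T : measurableType d) (F : R -> V)
    (h : V -> R -> T) : simple F -> (forall x, measurable_fun setT (h x)) ->
  measurable_fun setT (fun s => h (F s) s).
Proof.
move=> [finF mF _] mh _ A mA; rewrite setTI.
rewrite (_ : _ @^-1` _ = \bigcup_(x in range F) (F @^-1` [set x] `&` h x @^-1` A)).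
  apply: fin_bigcup_measurable => // x _; apply: measurableI => //.
  by rewrite -[_ @^-1` _]setTI; exact: mh.
apply/seteqP; split => [s /= As|s [x _ [/= -> //]]].
by exists (F s) => //; exists s.
Qed.

Lemma simple_comp (V W : zmodType) (F : R -> V) (phi : V -> W) : simple F ->
  phi 0 = 0 -> simple (phi \o F).
Proof.
move=> [finF mF [M FM]] phi0; split.
- rewrite (_ : range _ = phi @` range F); first exact: finite_image.
  by rewrite image_comp.
- move=> y; rewrite (_ : _ @^-1` _ = \bigcup_(x in range F `&` phi @^-1` [set y]) (F @^-1` [set
    x])).
    apply: fin_bigcup_measurable => [|x _ //].
    exact: sub_finite_set finF.
  apply/seteqP; split => [s /= As|s [x [_ /= xy] /= Fx]]; last by rewrite Fx.
  by exists (F s) => //; split => //; exists s.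
- by exists M => s /FM /= ->.
Qed.

Lemma simple_cut (V : zmodType) (F : R -> V) (b : R -> bool) : simple F ->
  measurable_fun setT b -> simple (cut b F).
Proof.
move=> [finF mF [M FM]] mb; split.
- apply: (@sub_finite_set _ _ (range F `|` [set 0])); last first.
    by rewrite finite_setU; split.
  move=> _ [s _ <-]; rewrite /cut; case: (b s); [left; exists s => //|right => //].
- move=> y.
  have mB : measurable (b @^-1` [set true]) by rewrite -[_ @^-1` _]setTI; exact: mb.
  have mB' : measurable (b @^-1` [set false]) by rewrite -[_ @^-1` _]setTI; exact: mb.
  have [y0|y0] := eqVneq y 0.
    rewrite (_ : _ @^-1` _ = (b @^-1` [set true] `&` F @^-1` [set 0]) `|` b @^-1` [set false]).
      by apply: measurableU => //; exact: measurableI.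
    apply/seteqP; split => s /=; rewrite /cut y0; case: (b s);
      by [left|right|case=> [[]|]].
  rewrite (_ : _ @^-1` _ = (b @^-1` [set true] `&` F @^-1` [set y])).
    exact: measurableI.
  apply/seteqP; split => s /=; rewrite /cut; case: (b s) => //.
  + by move=> /esym/eqP; rewrite (negbTE y0).
  + by case.
  + by case.
- by exists M => s /FM Fs; rewrite /cut Fs if_same.
Qed.

Lemma simple_bounded (V : zmodType) (F : R -> V) (f : V -> R) : simple F ->
  exists M, 0 <= M /\ forall s, f (F s) <= M.
Proof.
move=> [finF _ _].
have : finite_set [set f (F s) | s in setT].
  rewrite (_ : [set _ | _ in _] = f @` range F); first exact: finite_image.
  by rewrite image_comp.
move=> /finite_seqP[r rE]; exists (\sum_(x <- r) `|x|); split; first exact: sumr_ge0.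
move=> s; have : [set` r] (f (F s)) by rewrite -rE; exists s.
move=> /= sr; rewrite (big_rem _ sr)/= (le_trans (ler_norm _))// lerDl.
exact: sumr_ge0.
Qed.

Lemma integrable_bounded_support (g : R -> R) (K M : R) : measurable_fun setT g ->
  (forall s, `|g s| <= K) -> (forall s, M < `|s| -> g s = 0) ->
  mu.-integrable setT (EFin \o g).
Proof.
move=> mg gK gM.
have -> : EFin \o g = (EFin \o g) \_ `[- M, M].
  apply/funext => s; rewrite /patch /= mem_setE in_itv/= -ler_norml.
  by case: leP => // /gM ->.
suff h : mu.-integrable `[- M, M] (EFin \o g).
  by apply/(integrable_mkcond _ _).1.
apply: measurable_bounded_integrable => //.
- rewrite /= lebesgue_measure_itv/=; case: ifP => // _; rewrite -EFinD ltry//.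
- exact: measurable_funTS.
- exists K; split; first exact: num_real.
  by move=> x Kx s _ /=; rewrite (le_trans (gK s))// ltW.
Qed.

(* The exceptional point [t] is the diagonal, where dispersion says nothing. *)
Lemma Rintegral_abs_le (g : R -> R) (h : R -> \bar R) (t : R) :
  mu.-integrable setT (EFin \o g) -> (forall s, 0 <= h s)%E ->
  (forall s, s != t -> `|g s|%:E <= h s)%E ->
  (`|\int[mu]_s g s|%:E <= \int[mu]_s h s)%E.
Proof.
move=> ig h0 gh; have [/measurable_EFinP mg _] := integrableP _ _ _ ig.
rewrite EFin_normr_Rintegral//.
apply: le_trans (le_abse_integral _ _ _) _ => //; first exact/measurable_EFinP.
rewrite -(@integral_setD1 _ (fun x => `|g x|%:E) t) /=; last 2 first.
- exact: measurableD.
- by apply: measurable_funTS; apply/measurable_EFinP; exact: measurableT_comp.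
rewrite integral_mkcond; apply: le_ge0_integral => s.
  by apply: erestrict_ge0 => x _; rewrite lee_fin.
rewrite /patch; case: ifPn => // /set_mem [_ /eqP st]; exact: gh.
Qed.

End simple_functions.

(** * The dispersive family and its weak integrals *)

Section dispersive.
Context {R : realType} {V H : zmodType}.
Variables (n0 n1 : V -> R) (rip : H -> H -> R) (rs : R -> H -> H).
Variables (u : R -> V -> H) (sigma E D : R).
Local Notation mu := (@lebesgue_measure R).

Record seminorm (n : V -> R) := Seminorm {
  seminorm0 : n 0 = 0 ;
  seminormN : forall x, n (- x) = n x ;
  seminormD : forall x y, n (x + y) <= n x + n y }.

(* [u s] stands for U*(s), restricted to the intersection [V] of the two
   spaces, whose norms are [n0] and [n1]. *)
Record dispersive := Dispersive {
  disp_hilbert : real_hilbert rip rs ;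
  disp_n0 : seminorm n0 ;
  disp_n1 : seminorm n1 ;
  disp_uD : forall s x y f, rip f (u s (x + y)) = rip f (u s x) + rip f (u s y) ;
  disp_E : 0 < E ;
  disp_D : 0 < D ;
  disp_energy : forall s x, rnorm rip (u s x) <= E * n0 x ;
  disp_decay : forall s t x y, s != t ->
    `|rip (u s x) (u t y)| <= D * `|s - t| `^ (- sigma) * (n1 x * n1 y) ;
  disp_meas : forall f x, measurable_fun setT (fun s => rip f (u s x)) }.

Lemma seminorm_ge0 n x : seminorm n -> 0 <= n x.
Proof.
move=> hn; have := seminormD hn x (- x).
by rewrite subrr seminorm0// seminormN// -mulr2n pmulrn_lge0.
Qed.

Lemma seminorm_sum (I : Type) (r : seq I) (F : I -> V) n : seminorm n ->
  n (\sum_(i <- r) F i) <= \sum_(i <- r) n (F i).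
Proof.
move=> hn; elim: r => [|i r IH]; first by rewrite !big_nil seminorm0.
by rewrite !big_cons (le_trans (seminormD hn _ _))// lerD2l.
Qed.

Hypothesis hU : dispersive.
Let hH := disp_hilbert hU.

Lemma n0_ge0 x : 0 <= n0 x. Proof. exact: seminorm_ge0 (disp_n0 hU). Qed.
Lemma n1_ge0 x : 0 <= n1 x. Proof. exact: seminorm_ge0 (disp_n1 hU). Qed.

Lemma rip_u0 f s : rip f (u s 0) = 0.
Proof. by apply: (@addrI _ (rip f (u s 0))); rewrite -disp_uD// !addr0. Qed.

Lemma rip_u_sum (I : Type) (r : seq I) (F : I -> V) f s :
  rip f (u s (\sum_(i <- r) F i)) = \sum_(i <- r) rip f (u s (F i)).
Proof.
by elim: r => [|i r IH]; rewrite ?big_nil ?rip_u0// !big_cons disp_uD// IH.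
Qed.

Lemma rip_u_energy f s x : `|rip f (u s x)| <= rnorm rip f * (E * n0 x).
Proof.
apply: le_trans (rip_cauchy hH _ _) _.
by rewrite ler_wpM2l ?rnorm_ge0// disp_energy.
Qed.

Section weak_integral.
Implicit Types (F G : R -> V) (f : H).

Lemma measurable_rip_u F f : simple F ->
  measurable_fun setT (fun s => rip f (u s (F s))).
Proof.
by move=> sF; apply: (measurable_simple (h := fun x s => rip f (u s x))) => // x; exact: disp_meas.
Qed.

Lemma integrable_rip_u F f : simple F ->
  mu.-integrable setT (EFin \o (fun s => rip f (u s (F s)))).
Proof.
move=> sF; have [M FM] := simple_support sF.
have [K [K0 FK]] := simple_bounded n0 sF.
apply: (@integrable_bounded_support _ _ (rnorm rip f * (E * K)) M).
- exact: measurable_rip_u.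
- move=> s; apply: (le_trans (rip_u_energy _ _ _)).
  by rewrite ler_wpM2l ?rnorm_ge0// ler_wpM2l// ltW// disp_E.
- by move=> s /FM ->; rewrite rip_u0.
Qed.

(** The integral of U*(s)F(s), in the weak sense: the hypotheses give measurability only after
    pairing with a fixed vector. Existence is the Riesz representation in [vintP]; the default 0 is
    never met for simple [F]. *)
Definition vint F : H :=
  xget 0 [set v | forall f, rip f v = \int[mu]_s rip f (u s (F s))].

Lemma vintP F f : simple F -> rip f (vint F) = \int[mu]_s rip f (u s (F s)).
Proof.
move=> sF; rewrite /vint; case: xgetP => [v _ -> //|/forallNP nv]; exfalso.
have [M FM] := simple_support sF.
have [K [K0 FK]] := simple_bounded n0 sF.
have E0 := ltW (disp_E hU).
(* The energy constant times a bound for the values of [F], times the length of an interval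
   containing its support. *)
pose C := E * K * (2 * `|M|).
have C0 : 0 <= C by rewrite !mulr_ge0// ltW// disp_E.
have [||f0|v vE] := @riesz _ _ _ _ hH (fun f => \int[mu]_s rip f (u s (F s))) C C0.
- move=> x y; rewrite -RintegralD//; [|exact: integrable_rip_u..].
  by apply: eq_Rintegral => s _; rewrite (ripDl hH).
- move=> c x; rewrite -RintegralZl//; last exact: integrable_rip_u.
  by apply: eq_Rintegral => s _; rewrite (ripZl hH).
- rewrite -lee_fin; set N := rnorm rip f0.
  have N0 : 0 <= N by exact: rnorm_ge0.
  pose h (s : R) : \bar R := ((N * (E * K))%:E * (\1_`[(- `|M|)%R, `|M|%R] s)%:E)%E.
  apply: (@le_trans _ _ (\int[mu]_s h s)%E).
    apply: (@Rintegral_abs_le _ _ _ 0); first exact: integrable_rip_u.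
      by move=> s; rewrite /h mule_ge0// lee_fin ?indicE// !mulr_ge0// ltW// disp_E.
    move=> s _; rewrite /h indicE mem_setE in_itv/= -ler_norml.
    have [Ms|Ms] := leP `|s| `|M|.
      rewrite mule1 lee_fin (le_trans (rip_u_energy _ _ _))//.
      by rewrite ler_wpM2l// ler_wpM2l// ltW// disp_E.
    rewrite FM ?rip_u0 ?normr0 ?mule0//.
    exact: le_lt_trans (ler_norm _) Ms.
  rewrite /h ge0_integralZl//; last 2 first.
  + by apply/measurable_EFinP; exact: measurable_indic.
  + by rewrite lee_fin !mulr_ge0// ltW// disp_E.
  rewrite integral_indic// setIT /= lebesgue_measure_itv/= lte_fin.
  rewrite -EFinD opprK; case: ifP => _; rewrite ?mule0 -?EFinM lee_fin ?mulr_ge0//.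
  by rewrite le_eqVlt /C; apply/orP; left; apply/eqP; ring.
- by apply: nv; exists v.
Qed.

Lemma vint_sum (I : Type) (r : seq I) (G : I -> R -> V) F f :
  (forall i, simple (G i)) -> simple F -> (forall s, F s = \sum_(i <- r) G i s) ->
  rip f (vint F) = \sum_(i <- r) rip f (vint (G i)).
Proof.
move=> sG sF FG; rewrite vintP//.
rewrite (@eq_Rintegral _ _ _ mu setT (fun s => \sum_(i <- r) rip f (u s (G i s)))); last first.
  by move=> s _; rewrite FG rip_u_sum.
under eq_bigr do rewrite vintP//.
elim: r {FG} => [|i r IH].
  rewrite big_nil; under eq_Rintegral do rewrite big_nil.
  by rewrite Rintegral_cst// mul0r.
rewrite big_cons; under eq_Rintegral do rewrite big_cons.
rewrite RintegralD// ?IH//; first exact: integrable_rip_u.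
rewrite (_ : _ \o _ = (fun s => \sum_(j <- r) (rip f (u s (G j s)))%:E)%E); last first.
  by apply/funext => s; rewrite /= sumEFin.
by apply: integrable_sum => // j _; exact: integrable_rip_u.
Qed.

Lemma vint_cut F f b : simple F -> measurable_fun setT b ->
  rip f (vint F) = rip f (vint (cut b F)) + rip f (vint (cut (fun s => ~~ b s) F)).
Proof.
move=> sF mb.
have mb' : measurable_fun setT (fun s => ~~ b s) by exact: measurable_neg.
pose G (i : bool) := if i then cut b F else cut (fun s => ~~ b s) F.
rewrite (@vint_sum _ [:: true; false] G)//.
- by rewrite !big_cons big_nil addr0.
- by case; exact: simple_cut.
- move=> s; rewrite !big_cons big_nil /G /cut.
  by case: (b s); rewrite ?addr0 ?add0r.
Qed.

Lemma vint_le F f (h : R -> \bar R) t : simple F -> (forall s, 0 <= h s)%E ->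
  (forall s, s != t -> `|rip f (u s (F s))|%:E <= h s)%E ->
  (`|rip f (vint F)|%:E <= \int[mu]_s h s)%E.
Proof.
by move=> sF h0 Fh; rewrite vintP//; apply: (@Rintegral_abs_le _ _ _ t) => //;
    exact: integrable_rip_u.
Qed.

(* Only iterated integrals occur here: the function of (s, s') need not be
   jointly measurable. *)
Lemma vint_pair_le F G (h : R -> R -> \bar R) : simple F -> simple G ->
  (forall s s', 0 <= h s s')%E ->
  (forall s s', s != s' -> `|rip (u s (F s)) (u s' (G s'))|%:E <= h s s')%E ->
  (`|rip (vint F) (vint G)|%:E <= \int[mu]_s \int[mu]_s' h s s')%E.
Proof.
move=> sF sG h0 hFG; rewrite (ripC hH); apply: (@vint_le _ _ _ 0) => // s.
  exact: integral_ge0.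
move=> _; rewrite (ripC hH); apply: (@vint_le _ _ _ s) => // s' ss'.
by apply: hFG; rewrite eq_sym.
Qed.

End weak_integral.

End dispersive.

(** * Estimates for the adjoint of the propagator *)

Section j_decomposition.
Context {R : realType} {V : zmodType}.
Variables (n0 n1 : V -> R).

(* A discrete J-method decomposition, with e^k in place of the usual 2^k. *)
Record jdec (a : R) (x : V) (c : R) (r : seq int) (d : int -> V) (phi : int -> R) : Prop := Jdec {
  jdec_uniq : uniq r ;
  jdec_sum : x = \sum_(k <- r) d k ;
  jdec_out : forall k, k \notin r -> d k = 0 /\ phi k = 0 ;
  jdec_n0 : forall k, n0 (d k) <= expR (a * k%:~R) * phi k ;
  jdec_n1 : forall k, n1 (d k) <= expR (- (1 - a) * k%:~R) * phi k ;
  jdec_sqr : \sum_(k <- r) phi k ^+ 2 <= c ^+ 2 }.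

(* "The J-norm of [x] in the real interpolation space of exponents [a], 2 is at
   most [c]". *)
Definition jle (a : R) (x : V) (c : R) : Prop := 0 <= c /\
  if a == 0 then is_true (n0 x <= c) else if a == 1 then is_true (n1 x <= c)
  else exists r d phi, jdec a x c r d phi.

Lemma jle_dec a x c : 0 < a < 1 -> jle a x c -> exists r d phi, jdec a x c r d phi.
Proof. by move=> /andP[a0 a1] [_]; rewrite gt_eqF// lt_eqF. Qed.

End j_decomposition.

Section kernel_estimates.
Context {R : realType} {V H : zmodType}.
Variables (n0 n1 : V -> R) (rip : H -> H -> R) (rs : R -> H -> H).
Variables (u : R -> V -> H) (sigma E D : R).
Local Notation mu := (@lebesgue_measure R).
Hypothesis hU : dispersive n0 n1 rip rs u sigma E D.
Let hH := disp_hilbert hU.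

Lemma pair_energy s t x y : `|rip (u s x) (u t y)| <= E ^+ 2 * (n0 x * n0 y).
Proof.
have E0 := ltW (disp_E hU).
apply: le_trans (rip_cauchy hH _ _) _.
rewrite (_ : _ * (_ * _) = (E * n0 x) * (E * n0 y)); last by ring.
by apply: ler_pM; rewrite ?rnorm_ge0//; exact: (disp_energy hU).
Qed.

(** With r = |s - t| and z = k + l + sigma ln r, energy gives r^(-sigma a) e^(a z) and dispersion
    gives r^(-sigma a) e^(-(1-a) z). Choosing by the sign of z yields decay away from the
    antidiagonal z = 0. *)
Lemma pair_bound a s t (x y : V) (phi psi : R) (k l : int) : 0 < a < 1 -> s != t ->
  n0 x <= expR (a * k%:~R) * phi -> n1 x <= expR (- (1 - a) * k%:~R) * phi ->
  n0 y <= expR (a * l%:~R) * psi -> n1 y <= expR (- (1 - a) * l%:~R) * psi ->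
  `|rip (u s x) (u t y)| <= (E ^+ 2 + D) * (phi * psi) * `|s - t| `^ (- (sigma * a)) *
    expR (- (Num.min a (1 - a) * `|k%:~R + l%:~R + sigma * ln `|s - t| |)).
Proof.
move=> /andP[a0 a1] st x0 x1 y0 y1.
have phi0 : 0 <= phi by rewrite -(pmulr_rge0 _ (expR_gt0 (a * k%:~R))) (le_trans (n0_ge0 hU x)).
have psi0 : 0 <= psi by rewrite -(pmulr_rge0 _ (expR_gt0 (a * l%:~R))) (le_trans (n0_ge0 hU y)).
have h0 : `|rip (u s x) (u t y)| <= E ^+ 2 * (expR (a * (k%:~R + l%:~R)) * (phi * psi)).
  apply: le_trans (pair_energy _ _ _ _) _; rewrite ler_wpM2l ?sqr_ge0//.
  rewrite mulrDr expRD (_ : _ * (phi * psi) = (expR (a * k%:~R) * phi) * (expR (a * l%:~R) *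
      psi)); last by ring.
  by apply: ler_pM; rewrite ?(n0_ge0 hU).
have h1 : `|rip (u s x) (u t y)| <= D * `|s - t| `^ (- sigma) *
    (expR (- (1 - a) * (k%:~R + l%:~R)) * (phi * psi)).
  apply: le_trans (disp_decay hU _ _ st) _; apply: ler_wpM2l.
    by rewrite mulr_ge0 ?powR_ge0// ltW// (disp_D hU).
  rewrite mulrDr expRD (_ : _ * (phi * psi) = (expR (- (1 - a) * k%:~R) * phi) * (expR (- (1 -
      a) * l%:~R) * psi)); last by ring.
  by apply: ler_pM; rewrite ?(n1_ge0 hU).
have st0 : 0 < `|s - t| by rewrite normr_gt0 subr_eq0.
move: h0 h1 st0; set X := `|rip _ _|; set p := phi * psi.
set n : R := k%:~R + l%:~R.
have p0 : 0 <= p by exact: mulr_ge0.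
clearbody X p n; move: `|s - t| => r h0 h1 /pos_expR[L rE]; move: h0 h1;
    rewrite rE expRK !powR_expR.
set z := n + sigma * L; set de := Num.min a (1 - a).
have D0 := ltW (disp_D hU).
move=> + h1; move: (sqr_ge0 E); move: (E ^+ 2) => E2 E20 h0; case: (leP 0 z) => z0.
  rewrite (ger0_norm z0); apply: (le_trans h1).
  rewrite [leLHS](_ : _ = D * (p * (expR (- sigma * L) * expR (- (1 - a) * n)))); last by ring.
  rewrite -!mulrA; apply: ler_pM => //.
  + by rewrite !mulr_ge0 ?expR_ge0.
  + by rewrite lerDr.
  + rewrite ler_wpM2l// -!expRD ler_expR.
    have : de * z <= (1 - a) * z by rewrite ler_wpM2r// /de ge_min lexx orbT.
    by rewrite /z; move=> ?; lra.
rewrite (ltr0_norm z0); apply: (le_trans h0); rewrite -!mulrA; apply: ler_pM.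
+ exact: E20.
+ by rewrite !mulr_ge0 ?expR_ge0.
+ by rewrite lerDl.
+ rewrite mulrC; apply: ler_wpM2l => //; rewrite -!expRD ler_expR.
  have : a * z <= de * z by rewrite ler_wnM2r ?(ltW z0)// /de ge_min lexx.
  by rewrite /z; move=> ?; lra.
Qed.

(** Both entries are expanded in J-decompositions. The decay in [pair_bound] makes row and column
    sums bounded uniformly in [s] and [t], because [exp_sum_le] does not see the centre, and Schur's
    test matches the two square sums. *)
Lemma kernel_le a : 0 <= a <= 1 -> exists K : R, 0 < K /\
  forall s t x y c d, s != t -> jle n0 n1 a x c -> jle n0 n1 a y d ->
  `|rip (u s x) (u t y)| <= K * `|s - t| `^ (- (sigma * a)) * (c * d).
Proof.
move=> /andP[a0 a1]; have E0 := disp_E hU; have D0 := disp_D hU.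
have [a_0|an0] := eqVneq a 0.
  exists (E ^+ 2); rewrite exprn_gt0//; split=> // s t x y c d st [c0 xc] [d0 yd].
  move: xc yd; rewrite a_0 eqxx mulr0 oppr0 powRr0 mulr1 => xc yd.
  apply: le_trans (pair_energy _ _ _ _) _; rewrite ler_wpM2l ?sqr_ge0//.
  by apply: ler_pM; rewrite ?(n0_ge0 hU).
have [a_1|an1] := eqVneq a 1.
  exists D; split=> // s t x y c d st [c0 xc] [d0 yd].
  move: xc yd; rewrite a_1 oner_eq0 eqxx mulr1 => xc yd.
  apply: le_trans (disp_decay hU _ _ st) _; apply: ler_wpM2l.
    by rewrite mulr_ge0 ?powR_ge0// ltW.
  by apply: ler_pM; rewrite ?(n1_ge0 hU).
have a01 : 0 < a < 1 by rewrite !lt_neqAle a0 a1 an1 eq_sym an0.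
set de := Num.min a (1 - a).
have de0 : 0 < de by rewrite lt_min subr_gt0; case/andP: a01 => -> ->.
have [C [C0 hC]] := exp_sum_le de0.
exists ((E ^+ 2 + D) * C); split.
  by rewrite mulr_gt0// addr_gt0// exprn_gt0.
move=> s t x y c d st xc yd.
have [c0 _] := xc; have [d0 _] := yd.
have [r [e [phi [ur xE _ e0 e1 phic]]]] := jle_dec a01 xc.
have [r' [e' [psi [ur' yE _ e'0 e'1 psid]]]] := jle_dec a01 yd.
set W := fun k l : int => expR (- (de * `|k%:~R + l%:~R + sigma * ln `|s - t| |)).
have -> : rip (u s x) (u t y) = \sum_(k <- r) \sum_(l <- r') rip (u s (e k)) (u t (e' l)).
  rewrite xE (ripC hH) (rip_u_sum hU); apply: eq_bigr => k _.
  by rewrite (ripC hH) yE (rip_u_sum hU).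
set P := `|s - t| `^ _.
apply: (@le_trans _ _ (\sum_(k <- r) \sum_(l <- r') (E ^+ 2 + D) * P * (W k l * (phi k * psi l)))).
  apply: le_trans (ler_norm_sum _ _ _) _; apply: ler_sum => k _.
  apply: le_trans (ler_norm_sum _ _ _) _; apply: ler_sum => l _.
  apply: le_trans (pair_bound a01 st (e0 k) (e1 k) (e'0 l) (e'1 l)) _.
  by apply: le_of_eq; rewrite -/P -/de -/(W k l); ring.
under eq_bigr do rewrite -mulr_sumr.
rewrite -mulr_sumr [leRHS](_ : _ = (E ^+ 2 + D) * P * (C * (c * d))); last by ring.
apply: ler_wpM2l; first by rewrite mulr_ge0 ?powR_ge0// addr_ge0 ?sqr_ge0// ltW.
apply: schur_test => //.
- by move=> k l; exact: expR_ge0.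
- exact: ltW.
- move=> k; apply: le_trans (hC (- (k%:~R + sigma * ln `|s - t|)) r' ur').
  apply: ler_sum => l _; rewrite /W ler_expR lerN2 opprK.
  by apply: le_of_eq; congr (_ * `| _ |); ring.
- move=> l; apply: le_trans (hC (- (l%:~R + sigma * ln `|s - t|)) r ur).
  apply: ler_sum => k _; rewrite /W ler_expR lerN2 opprK.
  by apply: le_of_eq; congr (_ * `| _ |); ring.
Qed.

(** The square of the norm is a double integral of the kernel, bounded by [hls]. The map [Y] is
    present because the reiteration below replaces each value of [F] by a part of it, while sizes
    are still recorded as functions of the original value. *)
Lemma strichartz_subcritical a : 0 < a <= 1 -> 0 < sigma -> sigma * a < 1 ->
  exists C : R, 0 < C /\ forall (F : R -> V) (Y : V -> V) (nu : V -> R) B,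
  simple F -> Y 0 = 0 -> 0 < B -> (forall s, jle n0 n1 a (Y (F s)) (nu (F s))) ->
  (\int[mu]_s (nu (F s) `^ (2 / (2 - sigma * a)))%:E <= B%:E)%E ->
  rnorm rip (vint rip u (Y \o F)) <= C * B `^ (1 - sigma * a / 2).
Proof.
move=> /andP[a0 a1] s0 sa1.
have a01 : 0 <= a <= 1 by rewrite (ltW a0).
have [K [K0 hK]] := kernel_le a01.
have sa01 : 0 < sigma * a < 1 by rewrite mulr_gt0.
have [C [C0 hC]] := hls sa01.
exists (Num.sqrt (K * C)); split; first by rewrite sqrtr_gt0 mulr_gt0.
move=> F Y nu B sF Y0 B0 hF hB.
have sYF := simple_comp sF Y0.
have mnu : measurable_fun setT (fun s => nu (F s)).
  by apply: (measurable_simple (h := fun x _ => nu x)) => // x; exact: measurable_cst.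
have nu0 s : 0 <= nu (F s) by case: (hF s).
have {}hC := hC _ _ mnu nu0 B0 hB.
rewrite -(ler_pXn2r (ltn0Sn 1)) ?nnegrE ?mulr_ge0 ?rnorm_ge0 ?sqrtr_ge0 ?powR_ge0//.
rewrite (sqr_rnorm hH) exprMn sqr_sqrtr ?mulr_ge0 ?(ltW K0) ?(ltW C0)//.
rewrite -[X in _ <= _ * X]powR_mulrn ?powR_ge0// -powRrM.
rewrite (_ : (1 - sigma * a / 2) * 2 = 2 - sigma * a); last by field.
apply: le_trans (ler_norm _) _; rewrite -lee_fin.
pose h s s' : \bar R := (K%:E * (nu (F s) * nu (F s') * `|s - s'| `^ (- (sigma * a)))%:E)%E.
apply: (@le_trans _ _ (\int[mu]_s \int[mu]_s' h s s')%E).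
  apply: (vint_pair_le hU) => //.
  - by move=> s s'; rewrite /h -EFinM lee_fin !mulr_ge0 ?powR_ge0 ?(ltW K0).
  - move=> s s' ss'; rewrite /h -EFinM lee_fin.
    apply: le_trans (hK _ _ _ _ _ _ ss' (hF s) (hF s')) _.
    by apply: le_of_eq; ring.
have mabs : measurable_fun setT (fun x : R => `|x| `^ (- (sigma * a))).
  by apply: (@measurableT_comp _ _ _ _ _ _ (@powR R ^~ (- (sigma * a)))) => //.
have mm := measurable_conv mnu mnu mabs.
rewrite /h.
under eq_integral.
  move=> s _; rewrite ge0_integralZl//.
  - over.
  - exact: (measurableT_comp mm (pair1_measurable s)).
  - by move=> s' _; rewrite lee_fin !mulr_ge0 ?powR_ge0.
  - by rewrite lee_fin ltW.
rewrite ge0_integralZl//.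
- by rewrite -mulrA EFinM lee_wpmul2l// lee_fin ltW.
- apply: (measurable_fun_fubini_tonelli_F (m2 := mu) _ mm) => z.
  by rewrite lee_fin !mulr_ge0 ?powR_ge0.
- by move=> s _; apply: integral_ge0 => s' _; rewrite lee_fin !mulr_ge0 ?powR_ge0.
- by rewrite lee_fin ltW.
Qed.

End kernel_estimates.

(** * The endpoint a = 1 / sigma for sigma > 1 *)

Section endpoint.
Context {R : realType} {V H : zmodType}.
Variables (n0 n1 : V -> R) (rip : H -> H -> R) (rs : R -> H -> H).
Variables (u : R -> V -> H) (sigma E D : R).
Local Notation mu := (@lebesgue_measure R).
Hypothesis hU : dispersive n0 n1 rip rs u sigma E D.
Let hH := disp_hilbert hU.
Hypothesis sigma1 : 1 < sigma.
Local Notation a := (sigma^-1).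
Local Notation vint := (vint rip u).

(* The values of [G] are single terms, of index [k], of J-decompositions. *)
Record piece (k : int) (G : R -> V) (Phi : R -> R) : Prop := Piece {
  piece_simple : simple G ;
  piece_meas : measurable_fun setT Phi ;
  piece_n0 : forall s, n0 (G s) <= expR (a * k%:~R) * Phi s ;
  piece_n1 : forall s, n1 (G s) <= expR (- (1 - a) * k%:~R) * Phi s }.

Lemma piece_ge0 k G Phi s : piece k G Phi -> 0 <= Phi s.
Proof.
move=> hG; rewrite -(pmulr_rge0 _ (expR_gt0 (a * k%:~R))).
exact: le_trans (n0_ge0 hU (G s)) (piece_n0 hG s).
Qed.

Lemma piece_cut k G Phi b : piece k G Phi -> measurable_fun setT b ->
  piece k (cut b G) (fun s => if b s then Phi s else 0).
Proof.
move=> hG mb; split.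
- exact: simple_cut (piece_simple hG) mb.
- by apply: measurable_fun_ifT => //; exact: piece_meas hG.
- move=> s; rewrite /cut; case: (b s); first exact: piece_n0 hG s.
  by rewrite (seminorm0 (disp_n0 hU)) mulr0.
- move=> s; rewrite /cut; case: (b s); first exact: piece_n1 hG s.
  by rewrite (seminorm0 (disp_n1 hU)) mulr0.
Qed.

Lemma integral_sqr_ge0 (Phi : R -> R) : (0 <= \int[mu]_s (Phi s ^+ 2)%:E)%E.
Proof. by apply: integral_ge0 => s _; rewrite lee_fin sqr_ge0. Qed.

(** For one piece both norms of [G] are controlled by the same [Phi], so energy near the diagonal
    and dispersion away from it give a kernel of finite mass; [1 < sigma] makes its tail
    integrable. *)
Lemma piece_single : exists K : R, 0 < K /\ forall k G Phi, piece k G Phi ->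
  ((rip (vint G) (vint G))%:E <= K%:E * \int[mu]_s (Phi s ^+ 2)%:E)%E.
Proof.
have E0 := disp_E hU; have D0 := disp_D hU.
have s0 : 0 < sigma by exact: lt_trans sigma1.
pose A := E ^+ 2 * 2 + D * (2 / (sigma - 1)).
have A0 : 0 < A by rewrite addr_gt0// !mulr_gt0 ?invr_gt0 ?subr_gt0// exprn_gt0.
exists (A * 2); split; first by rewrite mulr_gt0.
move=> k G Phi hG; set kk : R := k%:~R.
(* At [a = 1 / sigma] this radius makes the masses of the near and the far part both independent of
   [k]. *)
pose rho := expR (- (2 * a * kk)); have rho0 : 0 < rho by exact: expR_gt0.
pose c1 := E ^+ 2 * expR (2 * a * kk).
pose c2 := D * expR (- (2 * (1 - a) * kk)).
have c10 : 0 <= c1 by rewrite mulr_ge0 ?sqr_ge0 ?expR_ge0.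
have c20 : 0 <= c2 by rewrite mulr_ge0 ?expR_ge0 ?(ltW D0).
pose ker r := c1 * near_kernel 0 rho r + c2 * far_kernel sigma rho r.
have ker0 r : 0 <= ker r by rewrite addr_ge0// mulr_ge0 ?near_kernel_ge0 ?far_kernel_ge0.
have mn := measurable_near_kernel 0 rho.
have mf := measurable_far_kernel sigma rho.
have mker : measurable_fun setT ker.
  by apply: measurable_funD; apply: measurable_funM => //; exact: measurable_cst.
have Phi0 s : 0 <= Phi s by exact: piece_ge0 hG.
have mPhi := piece_meas hG.
have kerA t : (\int[mu]_s (ker (s - t))%:E <= A%:E)%E.
  have ms : measurable_fun setT (fun s : R => s - t).
    by apply: measurable_funB => //; exact: measurable_cst.
  have mn' : measurable_fun setT (fun s : R => (near_kernel 0 rho (s - t))%:E).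
    by apply/measurable_EFinP; exact: (measurableT_comp mn ms).
  have mf' : measurable_fun setT (fun s : R => (far_kernel sigma rho (s - t))%:E).
    by apply/measurable_EFinP; exact: (measurableT_comp mf ms).
  rewrite [X in (X <= _)%E](_ : _ = \int[mu]_s (c1%:E * (near_kernel 0 rho (s - t))%:E +
      c2%:E * (far_kernel sigma rho (s - t))%:E))%E; last exact: eq_integral.
  rewrite ge0_integralD//; last 4 first.
  - by move=> s _; rewrite mule_ge0 ?lee_fin// near_kernel_ge0.
  - exact: measurable_funeM.
  - by move=> s _; rewrite mule_ge0 ?lee_fin// far_kernel_ge0.
  - exact: measurable_funeM.
  rewrite !ge0_integralZl//; last 2 first.
  - by move=> s _; rewrite lee_fin far_kernel_ge0.
  - by move=> s _; rewrite lee_fin near_kernel_ge0.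
  have I1 := @integral_near_kernel _ 0 rho t _ rho0.
  have I2 := @integral_far_kernel _ sigma rho t sigma1 rho0.
  apply: (@le_trans _ _ (c1%:E * (2 / (1 - 0) * rho `^ (1 - 0))%:E + c2%:E * (2 / (sigma - 1) *
      rho `^ (1 - sigma))%:E)%E).
    by apply: leeD; apply: lee_wpmul2l; rewrite ?lee_fin//; apply: I1; rewrite lexx ltr01.
  rewrite -!EFinM -EFinD lee_fin !subr0 divr1 powRr1 ?(ltW rho0)//.
  apply: le_of_eq; rewrite /c1 /c2 /A /rho powR_expR.
  congr (_ + _).
    by rewrite mulrCA -(mulrA (E ^+ 2)) -expRD subrr expR0 mulr1 mulrC.
  rewrite [LHS](_ : _ = D * (2 / (sigma - 1)) * (expR (- (2 * (1 - a) * kk)) *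
    expR ((1 - sigma) * - (2 / sigma * kk)))); last by ring.
  rewrite -expRD [X in expR X](_ : _ = 0) ?expR0 ?mulr1//.
  by field; rewrite gt_eqF.
pose h s s' : \bar R := (Phi s * Phi s' * ker (s - s'))%:E.
apply: (@le_trans _ _ (\int[mu]_s \int[mu]_s' h s s')%E).
  apply: le_trans (_ : (`|rip (vint G) (vint G)|%:E <= _)%E); first by rewrite lee_fin ler_norm.
  apply: (vint_pair_le hU); do ?[exact: piece_simple hG].
    by move=> s s'; rewrite lee_fin !mulr_ge0.
  move=> s s' ss'; rewrite lee_fin.
  have b0 := piece_n0 hG s; have b0' := piece_n0 hG s'.
  have b1 := piece_n1 hG s; have b1' := piece_n1 hG s'.
  rewrite /ker /near_kernel /far_kernel; case: ltP => _.
    rewrite mulr0 addr0 oppr0 powRr0 mulr1 (le_trans (pair_energy hU _ _ _ _))//.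
    rewrite /c1 [leRHS](_ : _ = E ^+ 2 * ((expR (a * kk) * Phi s) * (expR (a * kk) * Phi s'))).
      by rewrite ler_wpM2l ?sqr_ge0// ler_pM ?(n0_ge0 hU).
    by rewrite (_ : 2 * a * kk = a * kk + a * kk) ?expRD; ring.
  rewrite mulr0 add0r (le_trans (disp_decay hU _ _ ss'))//.
  rewrite /c2 [leRHS](_ : _ = D * `|s - s'| `^ (- sigma) * ((expR (- (1 - a) * kk) * Phi s) *
      (expR (- (1 - a) * kk) * Phi s'))).
    rewrite ler_wpM2l ?mulr_ge0 ?powR_ge0 ?(ltW D0)//.
    by rewrite ler_pM ?(n1_ge0 hU).
  by rewrite (_ : - (2 * (1 - a) * kk) = - (1 - a) * kk + - (1 - a) * kk) ?expRD; ring.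
apply: le_trans (schur_integral mPhi mPhi mker Phi0 Phi0 ker0 _ kerA) _.
  by move=> r; rewrite /ker /near_kernel /far_kernel normrN.
by rewrite EFinM -muleA lee_wpmul2l ?lee_fin ?(ltW A0)// mule_natl mule2n.
Qed.

(* Splitting [G'] near and far from the time [s]: the near part is controlled
   by energy and by the single-piece estimate, the far part by dispersion. *)
Lemma piece_pair_pointwise K1 k l G G' Phi Psi rho s : 0 < K1 -> 0 < rho ->
  (forall k G Phi, piece k G Phi ->
    ((rip (vint G) (vint G))%:E <= K1%:E * \int[mu]_s (Phi s ^+ 2)%:E)%E) ->
  piece k G Phi -> piece l G' Psi ->
  (`|rip (vint G') (u s (G s))|%:E <=
     (E * expR (a * k%:~R) * Num.sqrt rho * Phi s ^+ 2)%:E +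
     (E * expR (a * k%:~R) * K1 / Num.sqrt rho)%:E *
       \int[mu]_s' (Psi s' ^+ 2 * near_kernel 0 rho (s - s'))%:E +
     (D * expR (- (1 - a) * (k%:~R + l%:~R)))%:E *
       \int[mu]_s' (Phi s * Psi s' * far_kernel sigma rho (s - s'))%:E)%E.
Proof.
move=> K10 rho0 hK hG hG'.
have E0 := ltW (disp_E hU); have D0 := ltW (disp_D hU).
pose b s' := `|s - s'| < rho.
have mb : measurable_fun setT b.
  apply: measurable_fun_ltr => //; apply: measurableT_comp => //.
  by apply: measurable_funB => //; exact: measurable_cst.
have mb' : measurable_fun setT (fun s' => ~~ b s') by exact: measurable_neg.
set f := u s (G s).
have -> : rip (vint G') f = rip f (vint (cut b G')) + rip f (vint (cut (fun s' => ~~ b s') G')).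
  by rewrite (ripC hH) (vint_cut hU _ (piece_simple hG') mb).
apply: le_trans (_ : (`|rip f (vint (cut b G'))|%:E + `|rip f (vint (cut (fun s' =>
    ~~ b s') G'))|%:E <= _)%E).
  by rewrite -EFinD lee_fin ler_normD.
have Phi0 := piece_ge0 s hG.
have hE : rnorm rip f <= E * expR (a * k%:~R) * Phi s.
  apply: le_trans (disp_energy hU _ _) _; rewrite -mulrA ler_wpM2l//.
  exact: piece_n0 hG s.
have sq0 : 0 < Num.sqrt rho by rewrite sqrtr_gt0.
apply: leeD.
  set v := vint (cut b G').
  have hv := hK _ _ _ (piece_cut hG' mb).
  rewrite -/v -(sqr_rnorm hH) in hv.
  (* The weight [sqrt rho] anticipates the integration in [s], which brings a factor [rho] to the
     second term, so that both then carry [sqrt rho]. *)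
  apply: (@le_trans _ _ ((E * expR (a * k%:~R) * Num.sqrt rho * Phi s ^+ 2)%:E +
     (E * expR (a * k%:~R) / Num.sqrt rho)%:E * (rnorm rip v ^+ 2)%:E)%E).
    rewrite -EFinM -EFinD lee_fin (le_trans (rip_cauchy hH _ _))//.
    apply: (le_trans (ler_wpM2r (rnorm_ge0 _ _) hE)).
    set q := Num.sqrt rho in sq0 *; set x := rnorm rip v.
    rewrite [leRHS](_ : _ = E * expR (a * k%:~R) * (q * Phi s ^+ 2 + x ^+ 2 / q)); last by ring.
    rewrite -[leLHS]mulrA ler_wpM2l ?mulr_ge0 ?expR_ge0//.
    have : 0 <= (q * Phi s - x) ^+ 2 / q by rewrite divr_ge0 ?sqr_ge0// ltW.
    rewrite (_ : _ / q = q * Phi s ^+ 2 + x ^+ 2 / q - Phi s * x *+ 2); last first.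
      by field; rewrite gt_eqF.
    have : 0 <= Phi s * x by rewrite mulr_ge0// rnorm_ge0.
    by move=> ? ?; lra.
  apply: leeD2l.
  rewrite [X in (_ <= X%:E * _)%E](_ : _ = (E * expR (a * k%:~R) / Num.sqrt rho) * K1);
      last by ring.
  rewrite (EFinM _ K1) -muleA; apply: lee_wpmul2l.
    by rewrite lee_fin divr_ge0 ?mulr_ge0 ?expR_ge0// ltW.
  apply: (le_trans hv); rewrite lee_wpmul2l ?lee_fin ?(ltW K10)//.
  apply: le_of_eq; apply: eq_integral => s' _.
  by rewrite /near_kernel /b; case: ifP => _; rewrite ?oppr0 ?powRr0 ?mulr1 ?mulr0 ?expr0n.
have mPsi := piece_meas hG'.
rewrite -ge0_integralZl//; last 3 first.
- apply/measurable_EFinP; apply: measurable_funM.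
    by apply: measurable_funM => //; exact: measurable_cst.
  apply: (measurableT_comp (measurable_far_kernel sigma rho)).
  by apply: measurable_funB => //; exact: measurable_cst.
- by move=> s' _; rewrite lee_fin !mulr_ge0 ?far_kernel_ge0// (piece_ge0 _ hG').
- by rewrite lee_fin mulr_ge0 ?expR_ge0.
apply: (@vint_le _ _ _ _ _ _ _ _ _ _ _ hU _ _ _ s).
- exact: simple_cut (piece_simple hG') mb'.
- move=> s'; rewrite -EFinM lee_fin !mulr_ge0 ?far_kernel_ge0 ?expR_ge0//.
  exact: (piece_ge0 _ hG').
- move=> s' s's; rewrite -EFinM lee_fin /cut /b /far_kernel; case: ifPn => /= [/negbTE ->|].
    rewrite /f (le_trans (disp_decay hU _ _ _))//; first by rewrite eq_sym.
    rewrite [leRHS](_ : _ = D * `|s - s'| `^ (- sigma) * ((expR (- (1 - a) * k%:~R) * Phi s) *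
        (expR (- (1 - a) * l%:~R) * Psi s'))).
      rewrite ler_wpM2l ?mulr_ge0 ?powR_ge0//.
      by rewrite ler_pM ?(n1_ge0 hU)//; [exact: piece_n1 hG s|exact: piece_n1 hG' s'].
    by rewrite mulrDr expRD; ring.
  by move=> _; rewrite (rip_u0 hU) normr0 !mulr_ge0 ?expR_ge0 ?(piece_ge0 _ hG')//; case: ifP =>
      // _; exact: powR_ge0.
Qed.

End endpoint.

Section common_decomposition.
Context {R : realType} {V : zmodType}.
Variables (n0 n1 : V -> R).

Lemma sub_sum_eq (I : eqType) (W : zmodType) (r r' : seq I) (f : I -> W) :
  uniq r -> uniq r' -> {subset r <= r'} -> (forall i, i \notin r -> f i = 0) ->
  \sum_(i <- r') f i = \sum_(i <- r) f i.
Proof.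
move=> ur ur' rr' f0.
rewrite (bigID (mem r))/= [X in _ + X]big1 ?addr0//.
rewrite -big_filter; apply: perm_big; apply: uniq_perm; rewrite ?filter_uniq//.
by move=> i; rewrite mem_filter; apply: andb_idr; exact: rr'.
Qed.

Lemma jdec_widen a x c r d phi r' : jdec n0 n1 a x c r d phi -> uniq r' ->
  {subset r <= r'} -> jdec n0 n1 a x c r' d phi.
Proof.
move=> [ur xE out h0 h1 sq] ur' rr'; split => //.
- by rewrite xE; apply/esym/sub_sum_eq => // k /out[].
- by move=> k kr'; apply: out; apply: contra kr'; exact: rr'.
- rewrite (@sub_sum_eq _ _ r r')// => k /out[_ ->].
  by rewrite expr0n.
Qed.

(** One decomposition is chosen for each value of [F], and the finitely many index sets are merged.
    The value 0 gets the zero decomposition, which keeps the support of each piece bounded. *)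
Lemma common_jdec a (F : R -> V) (Y : V -> V) (nu : V -> R) : n0 0 = 0 -> n1 0 = 0 ->
  simple F -> Y 0 = 0 -> 0 < a < 1 -> (forall s, jle n0 n1 a (Y (F s)) (nu (F s))) ->
  exists (r : seq int) (d : V -> int -> V) (phi : V -> int -> R),
    [/\ forall s, jdec n0 n1 a (Y (F s)) (nu (F s)) r (d (F s)) (phi (F s)),
        uniq r, forall k, d 0 k = 0 & forall k, phi 0 k = 0].
Proof.
move=> n00 n10 sF Y0 a01 hF.
have /choice[g hg] (x : V) : exists z : seq int * (int -> V) * (int -> R),
    (range F x -> jdec n0 n1 a (Y x) (nu x) z.1.1 z.1.2 z.2) /\
    (x = 0 -> z.1.2 = (fun=> 0) /\ z.2 = (fun=> 0)).
  have [->|x0] := eqVneq x 0.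
    exists ([::], (fun=> 0), (fun=> 0)); split => // -[s _ Fs].
    by split; rewrite /= ?Y0 ?big_nil ?sqr_ge0// => k; rewrite ?n00 ?n10 ?mulr0.
  have [[s _ Fs]|nx] := pselect (range F x); last first.
    by exists ([::], (fun=> 0), (fun=> 0)); split => // x_0.
  have [r [d [phi h]]] := jle_dec a01 (hF s).
  exists (r, d, phi); split => [_|x_0]; first by rewrite -Fs.
  by rewrite x_0 eqxx in x0.
have [vs vsE] := (finite_seqP _).1 (simple_finite sF).
pose r := undup (flatten [seq (g x).1.1 | x <- vs]).
exists r, (fun x => (g x).1.2), (fun x => (g x).2); split.
- move=> s; have Fs : range F (F s) by exists s.
  have h := (hg (F s)).1 Fs.
  apply: (jdec_widen h); first exact: undup_uniq.
  move=> k kr; rewrite mem_undup; apply/flattenP.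
  exists (g (F s)).1.1 => //; apply/mapP; exists (F s) => //.
  by move: Fs; rewrite vsE.
- exact: undup_uniq.
- by move=> k; have [-> _] := (hg 0).2 erefl.
- by move=> k; have [_ ->] := (hg 0).2 erefl.
Qed.

End common_decomposition.

Section endpoint_strichartz.
Context {R : realType} {V H : zmodType}.
Variables (n0 n1 : V -> R) (rip : H -> H -> R) (rs : R -> H -> H).
Variables (u : R -> V -> H) (sigma E D : R).
Local Notation mu := (@lebesgue_measure R).
Hypothesis hU : dispersive n0 n1 rip rs u sigma E D.
Let hH := disp_hilbert hU.
Hypothesis sigma1 : 1 < sigma.
Local Notation a := (sigma^-1).
Local Notation vint := (vint rip u).
Local Notation piece := (piece n0 n1 sigma).

(** [piece_pair_pointwise] is integrated in [s] for [k <= l]. Its splitting radius is free, and the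
    scales [k] and [l] leave room for a choice that makes the near and the far contributions decay
    in [l - k] together. *)
Lemma piece_almost_orthogonal : exists K de : R, [/\ 0 < K, 0 < de &
  forall (k l : int) G G' Phi Psi (A B : R), piece k G Phi -> piece l G' Psi ->
  (\int[mu]_s (Phi s ^+ 2)%:E <= A%:E)%E -> (\int[mu]_s (Psi s ^+ 2)%:E <= B%:E)%E ->
  `|rip (vint G) (vint G')| <= K * expR (- (de * `|k%:~R - l%:~R|)) * (A + B)].
Proof.
have E0 := disp_E hU; have D0 := disp_D hU.
have s0 : 0 < sigma by exact: lt_trans sigma1.
have a0 : 0 < a by rewrite invr_gt0.
have a1 : a < 1 by rewrite invf_lt1.
have [K1 [K10 hK]] := piece_single hU sigma1.
pose c := 2 / (sigma - 1).
have c0 : 0 < c by rewrite divr_gt0// subr_gt0.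
pose K := E + 2 * E * K1 + D * c.
pose de := Num.min (a / 4) ((1 - a) / 2).
have de0 : 0 < de by rewrite lt_min !divr_gt0// subr_gt0.
have Dc0 : 0 < D * c by exact: mulr_gt0.
exists K, de; split => //; first by rewrite !addr_gt0// !mulr_gt0.
suff key (k l : int) G G' Phi Psi (A B : R) : piece k G Phi -> piece l G' Psi ->
    (\int[mu]_s (Phi s ^+ 2)%:E <= A%:E)%E -> (\int[mu]_s (Psi s ^+ 2)%:E <= B%:E)%E ->
    (k%:~R : R) <= l%:~R ->
    `|rip (vint G) (vint G')| <= K * expR (- (de * `|k%:~R - l%:~R|)) * (A + B).
  move=> k l G G' Phi Psi A B hG hG' hA hB.
  have [kl|/ltW lk] := leP (k%:~R : R) l%:~R; first exact: key hG hG' hA hB kl.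
  by rewrite (ripC hH) (distrC k%:~R) (addrC A); exact: key hG' hG hB hA lk.
move=> hG hG' hA hB; set x : R := k%:~R; set y : R := l%:~R => xy.
have A0 : 0 <= A by rewrite -lee_fin (le_trans (integral_sqr_ge0 Phi) hA).
have B0 : 0 <= B by rewrite -lee_fin (le_trans (integral_sqr_ge0 Psi) hB).
(* The radius e^(-2 a z) leaves the exponents a (x - z) from the near part and (1 - a)(2 z - x - y)
   from the far part, so [z] must lie strictly between [x] and the midpoint; this choice gives the
   two entries of [de]. *)
pose z := x + (y - x) / 4.
pose q := expR (- (a * z)); pose rho := q ^+ 2.
have q0 : 0 < q by exact: expR_gt0.
have rho0 : 0 < rho by exact: exprn_gt0.
have sq : Num.sqrt rho = q by rewrite sqrtr_sqr gtr0_norm.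
pose c1 := E * expR (a * x) * q.
pose c2 := E * expR (a * x) * K1 / q.
pose c3 := D * expR (- (1 - a) * (x + y)).
have c10 : 0 <= c1 by rewrite !mulr_ge0 ?expR_ge0 ?(ltW E0)//.
have c20 : 0 <= c2 by rewrite divr_ge0 ?(ltW q0)// !mulr_ge0 ?expR_ge0 ?(ltW E0) ?(ltW K10).
have c30 : 0 <= c3 by rewrite mulr_ge0 ?expR_ge0 ?(ltW D0).
have mPhi := piece_meas hG; have mPsi := piece_meas hG'.
have Phi0 s : 0 <= Phi s by exact: (piece_ge0 hU s hG).
have Psi0 s : 0 <= Psi s by exact: (piece_ge0 hU s hG').
pose t1 s : \bar R := (Phi s ^+ 2)%:E.
pose t2 s : \bar R := (\int[mu]_s' (Psi s' ^+ 2 * near_kernel 0 rho (s - s'))%:E)%E.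
pose t3 s : \bar R := (\int[mu]_s' (Phi s * Psi s' * far_kernel sigma rho (s - s'))%:E)%E.
have t10 s : (0 <= t1 s)%E by rewrite lee_fin sqr_ge0.
have t20 s : (0 <= t2 s)%E.
  by apply: integral_ge0 => s' _; rewrite lee_fin mulr_ge0 ?near_kernel_ge0 ?sqr_ge0.
have t30 s : (0 <= t3 s)%E.
  by apply: integral_ge0 => s' _; rewrite lee_fin !mulr_ge0 ?far_kernel_ge0.
have mPsi2 : measurable_fun setT (fun s => Psi s ^+ 2) by exact: measurable_funX.
have mt1 : measurable_fun setT t1 by apply/measurable_EFinP; exact: measurable_funX.
have mt2 : measurable_fun setT t2.
  have m2 : measurable_fun setT (fun w : R * R =>
      (Psi w.2 ^+ 2 * near_kernel 0 rho (w.1 - w.2))%:E).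
    have := measurable_conv (@measurable_cst _ _ R R setT 1) mPsi2 (measurable_near_kernel 0 rho).
    by under eq_fun do rewrite mul1r.
  apply: (measurable_fun_fubini_tonelli_F (m2 := mu) _ m2) => w.
  by rewrite lee_fin mulr_ge0 ?near_kernel_ge0 ?sqr_ge0.
have mt3 : measurable_fun setT t3.
  have m3 := measurable_conv mPhi mPsi (measurable_far_kernel sigma rho).
  apply: (measurable_fun_fubini_tonelli_F (m2 := mu) _ m3) => w.
  by rewrite lee_fin !mulr_ge0 ?far_kernel_ge0.
rewrite -lee_fin.
pose h s := (c1%:E * t1 s + c2%:E * t2 s + c3%:E * t3 s)%E.
apply: (@le_trans _ _ (\int[mu]_s h s)%E).
  rewrite (ripC hH); apply: (@vint_le _ _ _ _ _ _ _ _ _ _ _ hU _ _ _ 0).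
  - exact: piece_simple hG.
  - by move=> s; rewrite /h !adde_ge0// mule_ge0.
  - move=> s _; have := piece_pair_pointwise hU s K10 rho0 hK hG hG'.
    by rewrite sq.
rewrite /h !ge0_integralD//; last 8 first.
- by move=> s _; rewrite mule_ge0.
- exact: measurable_funeM.
- by move=> s _; rewrite mule_ge0.
- exact: measurable_funeM.
- by move=> s _; rewrite adde_ge0// mule_ge0.
- by apply: emeasurable_funD; exact: measurable_funeM.
- by move=> s _; rewrite mule_ge0.
- exact: measurable_funeM.
rewrite !ge0_integralZl//.
have I2 : (\int[mu]_s t2 s <= (2 * rho)%:E * B%:E)%E.
  apply: (@le_trans _ _ ((2 * rho)%:E * \int[mu]_s (Psi s ^+ 2)%:E)%E); last first.
    by apply: lee_wpmul2l => //; rewrite lee_fin; apply: mulr_ge0 => //; exact: ltW.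
  apply: tonelli_conv => //.
  + exact: measurable_near_kernel.
  + by move=> s; exact: sqr_ge0.
  + by move=> s; exact: near_kernel_ge0.
  + move=> t; have := @integral_near_kernel _ 0 rho t _ rho0.
    rewrite !subr0 divr1 powRr1 ?(ltW rho0)//; apply.
    by rewrite lexx ltr01.
have I3 : (\int[mu]_s t3 s <= (c * rho `^ (1 - sigma))%:E * (A%:E + B%:E))%E.
  apply: (@le_trans _ _ ((c * rho `^ (1 - sigma))%:E * (\int[mu]_s (Phi s ^+ 2)%:E + \int[mu]_s
      (Psi s ^+ 2)%:E))%E); last first.
    apply: lee_wpmul2l; last exact: leeD.
    by rewrite lee_fin; apply: mulr_ge0; [exact: ltW|exact: powR_ge0].
  apply: schur_integral => //.
  + exact: measurable_far_kernel.
  + by move=> s; exact: far_kernel_ge0.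
  + by move=> s; rewrite /far_kernel normrN.
  + by move=> t; exact: integral_far_kernel.
apply: (@le_trans _ _ (c1%:E * A%:E + c2%:E * ((2 * rho)%:E * B%:E) + c3%:E * ((c * rho `^ (1 -
    sigma))%:E * (A%:E + B%:E)))%E).
  by rewrite !leeD// lee_wpmul2l.
rewrite [X in (X <= _)%E](_ : _ = (c1 * A + c2 * (2 * rho * B) +
  c3 * (c * rho `^ (1 - sigma) * (A + B)))%:E)// lee_fin.
have nE : `|x - y| = y - x by rewrite ler0_norm ?subr_le0// opprB.
have Ec : expR (a * x) * q <= expR (- (de * `|x - y|)).
  rewrite -expRD ler_expR nE.
  have : de * (y - x) <= a / 4 * (y - x).
    by rewrite ler_wpM2r ?subr_ge0// /de ge_min lexx.
  by rewrite /z => ?; lra.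
have Ec3 : expR (- (1 - a) * (x + y)) * rho `^ (1 - sigma) <= expR (- (de * `|x - y|)).
  rewrite /rho /q -expRM_natl powR_expR -expRD ler_expR nE.
  have : de * (y - x) <= (1 - a) / 2 * (y - x).
    by rewrite ler_wpM2r ?subr_ge0// /de ge_min lexx orbT.
  move=> h1; apply: le_trans (_ : _ <= - ((1 - a) / 2 * (y - x))) _; last by rewrite lerN2.
  apply: le_of_eq; rewrite /z; field.
  by rewrite gt_eqF.
set e := expR (- (de * _)) in Ec Ec3 *.
have e0 : 0 <= e by exact: expR_ge0.
have H1 : c1 * A <= E * e * (A + B).
  apply: ler_pM => //; last by rewrite lerDl.
  by rewrite /c1 -mulrA ler_wpM2l// ltW.
have H2 : c2 * (2 * rho * B) <= 2 * E * K1 * e * (A + B).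
  rewrite (_ : c2 * (2 * rho * B) = 2 * E * K1 * (expR (a * x) * q) * B); last first.
    by rewrite /c2 /rho; field; rewrite gt_eqF.
  apply: ler_pM => //; last by rewrite lerDr.
    by rewrite !mulr_ge0 ?expR_ge0 ?(ltW E0) ?(ltW K10) ?(ltW q0).
  by rewrite ler_wpM2l// !mulr_ge0 ?(ltW E0) ?(ltW K10).
have H3 : c3 * (c * rho `^ (1 - sigma) * (A + B)) <= D * c * e * (A + B).
  rewrite (_ : _ * (_ * (A + B)) = D * c * (expR (- (1 - a) * (x + y)) * rho `^ (1 - sigma)) *
      (A + B)); last first.
    by rewrite /c3; ring.
  rewrite ler_wpM2r ?addr_ge0// ler_wpM2l// mulr_ge0 ?(ltW D0) ?(ltW c0)//.
apply: le_trans (lerD (lerD H1 H2) H3) _.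
by apply: le_of_eq; rewrite /K; ring.
Qed.

(* The J-decompositions of the values of [F] split [vint F] into almost
   orthogonal vectors. *)
Lemma strichartz_endpoint : exists C : R, 0 < C /\
  forall (F : R -> V) (Y : V -> V) (nu : V -> R) B, simple F -> Y 0 = 0 -> 0 < B ->
  (forall s, jle n0 n1 a (Y (F s)) (nu (F s))) ->
  (\int[mu]_s (nu (F s) ^+ 2)%:E <= B%:E)%E ->
  rnorm rip (vint (Y \o F)) <= C * Num.sqrt B.
Proof.
have s0 : 0 < sigma by exact: lt_trans sigma1.
have a01 : 0 < a < 1 by rewrite invr_gt0 s0 invf_lt1.
have [K [de [K0 de0 hK]]] := piece_almost_orthogonal.
have [C [C0 hC]] := exp_sum_le de0.
exists (Num.sqrt (K * (C * 2))); split; first by rewrite sqrtr_gt0 !mulr_gt0.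
move=> F Y nu B sF Y0 B0 hF hB.
have sYF := simple_comp sF Y0.
have [r [d [phi [hd ur d0 phi0]]]] := common_jdec (seminorm0 (disp_n0 hU)) (seminorm0 (disp_n1
    hU)) sF Y0 a01 hF.
pose G k s := d (F s) k; pose Phi k s := phi (F s) k.
have pG k : piece k (G k) (Phi k).
  split.
  - exact: (@simple_comp _ _ _ F (fun x => d x k) sF (d0 k)).
  - by apply: (measurable_simple (h := fun x _ => phi x k)) => // x; exact: measurable_cst.
  - by move=> s; exact: (jdec_n0 (hd s) k).
  - by move=> s; exact: (jdec_n1 (hd s) k).
have mPhi k := piece_meas (pG k).
have mPhi2 k : measurable_fun setT (fun s => (Phi k s ^+ 2)%:E).
  by apply/measurable_EFinP; exact: measurable_funX.
have sumB : (\sum_(k <- r) \int[mu]_s (Phi k s ^+ 2)%:E <= B%:E)%E.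
  rewrite -ge0_integral_sum//; last by move=> k s _; rewrite lee_fin sqr_ge0.
  apply: le_trans hB; apply: le_ge0_integral => s.
    by apply: sume_ge0 => k _; rewrite lee_fin sqr_ge0.
  by rewrite sumEFin lee_fin (jdec_sqr (hd s)).
pose A k := fine (\int[mu]_s (Phi k s ^+ 2)%:E).
have AE k : k \in r -> (A k)%:E = (\int[mu]_s (Phi k s ^+ 2)%:E)%E.
  move=> kr; rewrite fineK// ge0_fin_numE ?integral_sqr_ge0//.
  apply: le_lt_trans (ltry B); apply: le_trans sumB.
  rewrite (big_rem _ kr)/= leeDl//; apply: sume_ge0 => ? _; exact: integral_sqr_ge0.
have A0 k : 0 <= A k by rewrite fine_ge0// integral_sqr_ge0.
have sumA : \sum_(k <- r) A k <= B.
  rewrite -lee_fin -sumEFin; apply: le_trans sumB.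
  by rewrite big_seq [leRHS]big_seq; apply: lee_sum => k /AE ->.
rewrite -(ler_pXn2r (ltn0Sn 1)) ?nnegrE ?mulr_ge0 ?rnorm_ge0 ?sqrtr_ge0//.
rewrite (sqr_rnorm hH) exprMn !sqr_sqrtr ?(ltW B0)//; last first.
  by rewrite !mulr_ge0 ?(ltW K0) ?(ltW C0).
have vE f : rip f (vint (Y \o F)) = \sum_(k <- r) rip f (vint (G k)).
  apply: (vint_sum hU) => // [k|s]; first exact: piece_simple (pG k).
  exact: jdec_sum (hd s).
rewrite vE; under eq_bigr do rewrite (ripC hH) vE.
apply: (@le_trans _ _ (\sum_(k <- r) \sum_(l <- r) K * expR (- (de * `|k%:~R - l%:~R|)) * (A k +
    A l))).
  rewrite big_seq [leRHS]big_seq; apply: ler_sum => k kr.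
  rewrite big_seq [leRHS]big_seq; apply: ler_sum => l lr.
  apply: le_trans (ler_norm _) _.
  by apply: (hK _ _ _ _ _ _ _ _ (pG k) (pG l)); rewrite AE.
have S1 : \sum_(k <- r) \sum_(l <- r) K * expR (- (de * `|k%:~R - l%:~R|)) * A k <= K * (C * B).
  apply: (@le_trans _ _ (\sum_(k <- r) K * (C * A k))).
    apply: ler_sum => k _; rewrite -mulr_suml -mulr_sumr -mulrA ler_wpM2l ?(ltW K0)//.
    rewrite ler_wpM2r//; apply: le_trans (hC k%:~R r ur).
    by apply: ler_sum => l _; rewrite distrC.
  by rewrite -!mulr_sumr ler_wpM2l ?(ltW K0)// ler_wpM2l ?(ltW C0).
have S2 : \sum_(k <- r) \sum_(l <- r) K * expR (- (de * `|k%:~R - l%:~R|)) * A l <= K * (C * B).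
  rewrite exchange_big/=; apply: le_trans S1; apply: ler_sum => k _.
  by apply: ler_sum => l _; rewrite distrC.
rewrite [leRHS](_ : _ = K * (C * B) + K * (C * B)); last by ring.
apply: le_trans (lerD S1 S2); rewrite -big_split/=; apply: ler_sum => k _.
by rewrite -big_split/=; apply: ler_sum => l _; rewrite mulrDr.
Qed.

End endpoint_strichartz.

(** * Estimates away from the diagonal *)

Section reiteration.
Context {R : realType} {V : zmodType}.
Variables (n0 n1 : V -> R).
Hypotheses (sn0 : seminorm n0) (sn1 : seminorm n1).

Lemma jle00 a : jle n0 n1 a 0 0.
Proof.
split=> //; case: ifP => _; first by rewrite (seminorm0 sn0).
case: ifP => _; first by rewrite (seminorm0 sn1).
exists [::], (fun=> 0), (fun=> 0); split; rewrite ?big_nil ?expr0n//.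
- by move=> k; rewrite (seminorm0 sn0) mulr0.
- by move=> k; rewrite (seminorm0 sn1) mulr0.
Qed.

(** A K-method splitting of [x] for the spaces of exponents [a] and 1, at the parameters e^(-(m +
    w)), with the weights of second index 2. The real shift [w] moves the cut, while [C] is to be
    independent of it, so that [w] may later depend on the size of [x]. *)
Definition reiterated (th a c w C : R) (r : seq int) (x : V)
    (y : int -> V) (eta zeta : int -> R) : Prop :=
  [/\ forall m, jle n0 n1 a (y m) (eta m),
      forall m, n1 (x - y m) <= zeta m,
      \sum_(m <- r) (expR (th * (m%:~R + w)) * eta m) ^+ 2 <= C * c ^+ 2 &
      \sum_(m <- r) (expR (- (1 - th) * (m%:~R + w)) * zeta m) ^+ 2 <= C * c ^+ 2].

(** For [a = 1] both spaces are the same, and [y m] is all of [x] or nothing according to the sign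
    of [m + w]. *)
Lemma reiteration_top th : 0 < th < 1 -> exists C : R, 0 < C /\
  forall x c w r, uniq r -> jle n0 n1 1 x c ->
  exists y eta zeta, reiterated th 1 c w C r x y eta zeta.
Proof.
move=> /andP[th0 th1].
have th0' : 0 < 2 * th by rewrite mulr_gt0.
have th1' : 0 < 2 * (1 - th) by rewrite mulr_gt0// subr_gt0.
have [C1 [C10 hC1]] := exp_sum_le th0'.
have [C2 [C20 hC2]] := exp_sum_le th1'.
exists (C1 + C2); split; first exact: addr_gt0.
move=> x c w r ur [c0]; rewrite oner_eq0 eqxx => xc.
have n1_0 := seminorm0 sn1.
pose P (m : int) := m%:~R + w <= 0.
exists (fun m => if P m then x else 0), (fun m => if P m then c else 0),
  (fun m => if P m then 0 else c); split.
- by move=> m; case: ifP => _; split => //; rewrite oner_eq0 eqxx ?n1_0.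
- by move=> m; case: ifP => _; rewrite ?subrr ?n1_0 ?subr0.
- apply: (@le_trans _ _ (C1 * c ^+ 2)); last first.
    by rewrite ler_wpM2r ?sqr_ge0// lerDl ltW.
  apply: (@le_trans _ _ ((\sum_(m <- r) expR (- (2 * th * `|m%:~R - - w|))) * c ^+ 2)).
    rewrite mulr_suml; apply: ler_sum => m _; rewrite /P opprK; case: ifPn => [mw|_].
      rewrite exprMn -expRM_natl ler_wpM2r ?sqr_ge0// ler_expR ler0_norm//.
      by apply: le_of_eq; ring.
    by rewrite mulr0 expr0n mulr_ge0 ?expR_ge0 ?sqr_ge0.
  by rewrite ler_wpM2r ?sqr_ge0// hC1.
- apply: (@le_trans _ _ (C2 * c ^+ 2)); last first.
    by rewrite ler_wpM2r ?sqr_ge0// lerDr ltW.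
  apply: (@le_trans _ _ ((\sum_(m <- r) expR (- (2 * (1 - th) * `|m%:~R - - w|))) * c ^+ 2)).
    rewrite mulr_suml; apply: ler_sum => m _; rewrite /P opprK; case: ifPn => [_|].
      by rewrite mulr0 expr0n mulr_ge0 ?expR_ge0 ?sqr_ge0.
    rewrite -ltNge => mw.
    rewrite exprMn -expRM_natl ler_wpM2r ?sqr_ge0// ler_expR gtr0_norm//.
    by apply: le_of_eq; ring.
  by rewrite ler_wpM2r ?sqr_ge0// hC2.
Qed.

(** [y m] collects the terms [d k] with Z = m + w + (1-a) k <= 0. After weighting, a kept term
    carries e^(th Z) and a discarded one e^(-(1-th) Z), so both decay away from Z = 0. The J-norms
    of the [y m] are square sums and add up directly; the remainders are estimated by the triangle
    inequality and therefore call for Schur's test. *)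
Lemma reiteration_mid th a : 0 < th < 1 -> 0 < a < 1 -> exists C : R, 0 < C /\
  forall x c w r, uniq r -> jle n0 n1 (th + (1 - th) * a) x c ->
  exists y eta zeta, reiterated th a c w C r x y eta zeta.
Proof.
move=> /andP[th0 th1] a01; have /andP[a0 a1] := a01.
set ka := 1 - a; have ka0 : 0 < ka by rewrite subr_gt0.
have th0' : 0 < 2 * th by rewrite mulr_gt0.
have th1' : 0 < 1 - th by rewrite subr_gt0.
have [C1 [C10 hC1]] := exp_sum_le th0'.
have [C2 [C20 hC2]] := exp_sum_le th1'.
have [C3 [C30 hC3]] := exp_sum_le (mulr_gt0 th1' ka0).
pose A := C2 + C3; have A0 : 0 < A by exact: addr_gt0.
exists (C1 + A ^+ 2); split; first by rewrite addr_gt0// exprn_gt0.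
move=> x c w r ur xc; have [c0 _] := xc.
set tt := th + (1 - th) * a in xc.
have tt01 : 0 < tt < 1.
  have h1 : 0 < (1 - th) * a by rewrite mulr_gt0.
  have h2 : 0 < (1 - th) * (1 - a) by rewrite mulr_gt0.
  by apply/andP; split; rewrite /tt; lra.
have [rr [d [phi hd]]] := jle_dec tt01 xc.
have [urr xE out h0 h1 hs] := hd.
have n0_0 := seminorm0 sn0; have n1_0 := seminorm0 sn1.
have phi0 k : 0 <= phi k.
  rewrite -(pmulr_rge0 _ (expR_gt0 (tt * k%:~R))); apply: le_trans (h0 k).
  exact: seminorm_ge0.
pose Z (m k : int) : R := m%:~R + w + ka * k%:~R.
pose psi (m k : int) := if Z m k <= 0 then expR (th * (ka * k%:~R)) * phi k else 0.
pose eta m := Num.sqrt (\sum_(k <- rr) psi m k ^+ 2).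
have eta2 m : eta m ^+ 2 = \sum_(k <- rr) psi m k ^+ 2.
  by rewrite sqr_sqrtr// sumr_ge0// => k _; exact: sqr_ge0.
exists (fun m => \sum_(k <- rr) if Z m k <= 0 then d k else 0), eta,
  (fun m => \sum_(k <- rr) if Z m k <= 0 then 0 else expR (- (ka * (1 - th)) * k%:~R) * phi k).
split.
- move=> m; split; first exact: sqrtr_ge0.
  rewrite gt_eqF// lt_eqF//.
  exists rr, (fun k => if Z m k <= 0 then d k else 0), (psi m); split => //.
  + by move=> k /out[dk pk]; rewrite /psi dk pk mulr0 !if_same.
  + move=> k; rewrite /psi; case: ifP => _; last by rewrite n0_0 mulr0.
    apply: le_trans (h0 k) _; rewrite mulrA -expRD.
    by apply: le_of_eq; rewrite /tt /ka; congr (expR _ * _); ring.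
  + move=> k; rewrite /psi; case: ifP => _; last by rewrite n1_0 mulr0.
    apply: le_trans (h1 k) _; rewrite mulrA -expRD.
    by apply: le_of_eq; rewrite /tt /ka; congr (expR _ * _); ring.
  + by rewrite eta2.
- move=> m; rewrite [X in X - _]xE -sumrB; apply: le_trans (seminorm_sum _ _ sn1) _.
  apply: ler_sum => k _; case: ifP => _; first by rewrite subrr n1_0.
  rewrite subr0; apply: le_trans (h1 k) _.
  by apply: le_of_eq; rewrite /tt /ka; congr (expR _ * _); ring.
- apply: (@le_trans _ _ (C1 * c ^+ 2)); last first.
    by rewrite ler_wpM2r ?sqr_ge0// lerDl sqr_ge0.
  apply: (@le_trans _ _ (\sum_(k <- rr) C1 * phi k ^+ 2)); last first.
    by rewrite -mulr_sumr ler_wpM2l// ltW.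
  under eq_bigr do rewrite exprMn eta2 mulr_sumr.
  rewrite exchange_big/=; apply: ler_sum => k _.
  apply: (@le_trans _ _ ((\sum_(m <- r) expR (- (2 * th * `|m%:~R - - (w + ka * k%:~R)|))) * phi
      k ^+ 2)).
    rewrite mulr_suml; apply: ler_sum => m _; rewrite /psi opprK addrA -/(Z m k).
    case: ifPn => [mw|_].
      rewrite -exprMn mulrA -expRD exprMn -expRM_natl ler_wpM2r ?sqr_ge0// ler_expR ler0_norm//.
      by apply: le_of_eq; rewrite /Z; ring.
    by rewrite expr0n mulr0 mulr_ge0 ?expR_ge0 ?sqr_ge0.
  by rewrite ler_wpM2r ?sqr_ge0// hC1.
- apply: (@le_trans _ _ (A ^+ 2 * c ^+ 2)); last first.
    by rewrite ler_wpM2r ?sqr_ge0// lerDr ltW.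
  rewrite -exprMn.
  pose W m k := if Z m k <= 0 then 0 else expR (- ((1 - th) * Z m k)).
  rewrite [leLHS](_ : _ = \sum_(m <- r) (\sum_(k <- rr) W m k * phi k) ^+ 2); last first.
    apply: eq_bigr => m _; congr (_ ^+ 2); rewrite mulr_sumr; apply: eq_bigr => k _.
    rewrite /W; case: ifP => _; first by rewrite mulr0 mul0r.
    by rewrite mulrA -expRD; congr (expR _ * _); rewrite /Z; ring.
  have Wle m k : W m k <= expR (- ((1 - th) * `|Z m k|)).
    rewrite /W; case: ifPn => [_|]; first exact: expR_ge0.
    by rewrite -ltNge => z0; rewrite gtr0_norm.
  apply: schur_test_sqr => //.
  + by move=> m k; rewrite /W; case: ifP => // _; exact: expR_ge0.
  + exact: ltW.
  + move=> m; apply: (@le_trans _ _ C3); last by rewrite /A lerDr ltW.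
    apply: le_trans (hC3 (- ((m%:~R + w) / ka)) rr urr); apply: ler_sum => k _.
    apply: le_trans (Wle m k) _; rewrite ler_expR lerN2 -mulrA -[X in X * `|_ - _|]gtr0_norm//.
    rewrite -normrM; apply: le_of_eq; congr (_ * `| _ |).
    by rewrite /Z; field; rewrite gt_eqF.
  + move=> k; apply: (@le_trans _ _ C2); last by rewrite /A lerDl ltW.
    apply: le_trans (hC2 (- (w + ka * k%:~R)) r ur); apply: ler_sum => m _.
    by apply: le_trans (Wle m k) _; rewrite ler_expR lerN2 opprK addrA.
Qed.

Lemma reiteration th a : 0 < th < 1 -> 0 < a <= 1 -> exists C : R, 0 < C /\
  forall x c w r, uniq r -> jle n0 n1 (th + (1 - th) * a) x c ->
  exists y eta zeta, reiterated th a c w C r x y eta zeta.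
Proof.
move=> th01 /andP[a0]; rewrite le_eqVlt => /predU1P[->|a1].
  rewrite mulr1 subrKC; exact: reiteration_top.
by apply: reiteration_mid => //; rewrite a0.
Qed.

End reiteration.

Lemma le0_of_powR_bound {R : realType} (X C q : R) : 0 < C -> 0 < q ->
  (forall e, 0 < e -> X <= C * e `^ q) -> X <= 0.
Proof.
move=> C0 q0 h; apply/ler_addgt0Pr => e e0; rewrite add0r.
have e1 : 0 < (e / C) `^ q^-1 by rewrite powR_gt0// divr_gt0.
apply: le_trans (h _ e1) _.
rewrite -powRrM mulVf ?gt_eqF// powRr1 ?divr_ge0 ?(ltW e0) ?(ltW C0)//.
by rewrite mulrC divfK// gt_eqF.
Qed.

Section strichartz.
Context {R : realType} {V H : zmodType}.
Variables (n0 n1 : V -> R) (rip : H -> H -> R) (rs : R -> H -> H).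
Variables (u : R -> V -> H) (sigma E D : R).
Local Notation mu := (@lebesgue_measure R).
Hypothesis hU : dispersive n0 n1 rip rs u sigma E D.

Lemma strichartz a : 0 < a <= 1 -> 0 < sigma ->
  sigma * a < 1 \/ (sigma * a = 1 /\ 1 < sigma) ->
  exists C : R, 0 < C /\ forall (F : R -> V) (Y : V -> V) (nu : V -> R) B,
  simple F -> Y 0 = 0 -> 0 <= B -> (forall s, jle n0 n1 a (Y (F s)) (nu (F s))) ->
  (\int[mu]_s (nu (F s) `^ (2 / (2 - sigma * a)))%:E <= B%:E)%E ->
  rnorm rip (vint rip u (Y \o F)) <= C * B `^ (1 - sigma * a / 2).
Proof.
move=> a01 s0 sa.
suff [C [C0 hC]] : exists C : R, 0 < C /\ forall (F : R -> V) (Y : V -> V) (nu : V -> R) B,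
    simple F -> Y 0 = 0 -> 0 < B -> (forall s, jle n0 n1 a (Y (F s)) (nu (F s))) ->
    (\int[mu]_s (nu (F s) `^ (2 / (2 - sigma * a)))%:E <= B%:E)%E ->
    rnorm rip (vint rip u (Y \o F)) <= C * B `^ (1 - sigma * a / 2).
  exists C; split => // F Y nu B sF Y0 B0 hF hB.
  move: B0; rewrite le_eqVlt => /predU1P[B_0|B0]; last exact: hC hF hB.
  have q0 : 0 < 1 - sigma * a / 2 by case: sa => [sa1|[-> _]]; lra.
  rewrite -B_0 powR0 ?gt_eqF// mulr0; apply: (le0_of_powR_bound C0 q0) => e e0.
  apply: (hC F Y nu e) => //.
  by apply: le_trans hB _; rewrite -B_0 lee_fin ltW.
case: sa => [sa1|[sa1 s1]]; first exact: (strichartz_subcritical hU a01 s0 sa1).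
have [C [C0 hC]] := strichartz_endpoint hU s1.
have aE : a = sigma^-1 by rewrite -[RHS]mul1r -sa1 mulrAC divff ?mul1r// gt_eqF.
exists C; split => // F Y nu B sF Y0 B0 hF hB.
rewrite sa1 (_ : 1 - 1 / 2 = 2^-1); last by field.
rewrite powR12_sqrt ?(ltW B0)//; apply: (hC F Y nu) => //; first by rewrite -aE.
apply: le_trans hB; apply: le_of_eq.
apply: eq_integral => s _; rewrite sa1 (_ : 2 / (2 - 1) = 2%:R); last by field.
by rewrite powR_mulrn//; case: (hF s).
Qed.

End strichartz.

(** * Inequalities in mixed norms *)

Section minkowski.
Context {R : realType}.
Local Notation mu := (@lebesgue_measure R).

Lemma cauchy_sum (I : Type) (r : seq I) (x y : I -> R) (c d : R) :
  0 <= c -> 0 <= d -> \sum_(i <- r) x i ^+ 2 <= c ^+ 2 ->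
  \sum_(i <- r) y i ^+ 2 <= d ^+ 2 -> \sum_(i <- r) x i * y i <= c * d.
Proof.
move=> c0 d0 hx hy; apply: le_mul_of_amgm => // lam lam0.
apply: (@le_trans _ _ (lam * \sum_(i <- r) x i ^+ 2 + lam^-1 * \sum_(i <- r) y i ^+ 2)).
  rewrite !mulr_sumr -big_split -mulr_natl mulr_sumr/=; apply: ler_sum => i _.
  rewrite -subr_ge0 (_ : _ - _ = lam^-1 * (lam * x i - y i) ^+ 2); last first.
    by field; rewrite gt_eqF.
  by rewrite mulr_ge0 ?sqr_ge0// invr_ge0 ltW.
by apply: lerD; rewrite ler_wpM2l// ?invr_ge0 ltW.
Qed.

Lemma powR_mix (x y p : R) : 0 <= x -> 0 <= y -> 1 <= p <= 2 ->
  x `^ (2 - p) * y `^ p <= x ^+ 2 + y ^+ 2.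
Proof.
move=> x0 y0 /andP[p1 p2].
have sq z : 0 <= z -> z `^ (2 - p) * z `^ p = z ^+ 2.
  move=> z0; rewrite -powRD ?subrK ?powR_mulrn//.
  by rewrite (_ : (2 == 0) = false)//; apply/eqP; lra.
have [xy|/ltW yx] := leP x y.
  apply: (@le_trans _ _ (y ^+ 2)); last by rewrite lerDr sqr_ge0.
  rewrite -(sq y)// ler_wpM2r ?powR_ge0// ge0_ler_powR ?nnegrE ?subr_ge0//.
apply: (@le_trans _ _ (x ^+ 2)); last by rewrite lerDl sqr_ge0.
by rewrite -(sq x)// ler_wpM2l ?powR_ge0// ge0_ler_powR ?nnegrE//; lra.
Qed.

Lemma le_powRN (x y e : R) : 0 < x -> x <= y -> 0 <= e -> y `^ (- e) <= x `^ (- e).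
Proof.
move=> x0 xy e0; have y0 := lt_le_trans x0 xy.
by rewrite !powRN lef_pV2 ?posrE ?powR_gt0// ge0_ler_powR// nnegrE ltW.
Qed.

(* Minkowski's inequality in the mixed spaces L^p(l^2) and l^2(L^p), p <= 2. *)
Lemma l2_minkowski (r : seq int) (h : int -> R -> R) (G : R -> R) (p : R) :
  1 <= p <= 2 -> (forall m, measurable_fun setT (h m)) -> (forall m s, 0 <= h m s) ->
  measurable_fun setT G -> (forall s, 0 <= G s) ->
  (forall s, \sum_(m <- r) h m s ^+ 2 <= G s ^+ 2) ->
  (\int[mu]_s (G s `^ p)%:E <= (2^-1)%:E)%E ->
  exists X : int -> R, [/\ forall m, 0 <= X m,
    {in r, forall m, \int[mu]_s (h m s `^ p)%:E = (X m `^ p)%:E}%E &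
    \sum_(m <- r) X m ^+ 2 <= 1].
Proof.
move=> p12 mh h0 mG G0 hG GI; have /andP[p1 p2] := p12.
have p0 : 0 < p by exact: lt_le_trans p1.
have mhp m : measurable_fun setT (fun s => (h m s `^ p)%:E).
  by apply/measurable_EFinP; apply: (@measurableT_comp _ _ _ _ _ _ (@powR R ^~ p)).
pose J m := fine (\int[mu]_s (h m s `^ p)%:E).
have J0 m : 0 <= J m by apply: fine_ge0; apply: integral_ge0 => s _; rewrite lee_fin powR_ge0.
have JE m : m \in r -> (\int[mu]_s (h m s `^ p)%:E)%E = (J m)%:E.
  move=> mr; rewrite fineK// ge0_fin_numE; last first.
    by apply: integral_ge0 => s _; rewrite lee_fin powR_ge0.
  apply: le_lt_trans (ltry (2^-1 : R)); apply: le_trans GI; apply: le_ge0_integral => s.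
    by rewrite lee_fin powR_ge0.
  rewrite lee_fin ge0_ler_powR ?nnegrE ?(ltW p0)//.
  rewrite -(ler_pXn2r (ltn0Sn 1)) ?nnegrE//; apply: le_trans (hG s).
  by rewrite (big_rem _ mr)/= lerDl; apply: sumr_ge0 => ? _; exact: sqr_ge0.
pose X m := J m `^ p^-1.
have X0 m : 0 <= X m by exact: powR_ge0.
have XJ m : X m `^ p = J m by rewrite -powRrM mulVf ?gt_eqF// powRr1.
exists X; split => //; first by move=> m mr; rewrite JE// XJ.
set S := \sum_(m <- r) _.
have S0 : 0 <= S by apply: sumr_ge0 => m _; exact: sqr_ge0.
have sq m : X m ^+ 2 = X m `^ (2 - p) * J m.
  rewrite -(XJ m) -powRD ?subrK ?powR_mulrn//.
  by rewrite (_ : (2 == 0) = false)//; apply/eqP; lra.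
(* [S] is the sum of X^(2-p) times the integral of h^p. By [powR_mix] applied to X and h / G, the
   summed integrand is at most (1 + S) G^p, and the normalisation of [G] by 1/2 allows [S] to be
   absorbed. *)
suff : S <= (1 + S) * 2^-1 by move=> ?; lra.
rewrite -lee_fin.
apply: (@le_trans _ _ (\int[mu]_s ((1 + S)%:E * (G s `^ p)%:E))%E); last first.
  rewrite ge0_integralZl//.
  - by rewrite EFinM lee_wpmul2l// lee_fin addr_ge0.
  - by apply/measurable_EFinP; apply: (@measurableT_comp _ _ _ _ _ _ (@powR R ^~ p)).
  - by move=> s _; rewrite lee_fin powR_ge0.
  - by rewrite lee_fin addr_ge0.
have -> : S%:E = (\int[mu]_s (\sum_(m <- r) (X m `^ (2 - p))%:E * (h m s `^ p)%:E))%E.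
  rewrite ge0_integral_sum//.
  - rewrite /S -sumEFin big_seq [RHS]big_seq; apply: eq_bigr => m mr.
    rewrite ge0_integralZl//; first by rewrite JE// sq EFinM.
    + exact: mhp.
    + by move=> s _; rewrite lee_fin powR_ge0.
    + by rewrite lee_fin powR_ge0.
  - by move=> m; apply: measurable_funeM; exact: mhp.
  - by move=> m s _; apply: mule_ge0; rewrite lee_fin powR_ge0.
apply: le_ge0_integral => s.
  by apply: sume_ge0 => m _; apply: mule_ge0; rewrite lee_fin powR_ge0.
under eq_bigr do rewrite -EFinM.
rewrite sumEFin -EFinM lee_fin.
have := G0 s; rewrite le_eqVlt => /predU1P[Gs0|Gs0].
  rewrite big_seq big1 ?mulr_ge0 ?powR_ge0 ?addr_ge0// => m mr.
  have : h m s ^+ 2 <= 0.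
    apply: le_trans (_ : _ <= G s ^+ 2) _; last by rewrite -Gs0 expr0n.
    apply: le_trans (hG s); rewrite (big_rem _ mr)/= lerDl.
    by apply: sumr_ge0 => ? _; exact: sqr_ge0.
  rewrite le_eqVlt ltNge sqr_ge0 orbF sqrf_eq0 => /eqP ->.
  by rewrite powR0 ?mulr0// gt_eqF.
apply: (@le_trans _ _ (\sum_(m <- r) (X m ^+ 2 + (h m s / G s) ^+ 2) * G s `^ p)).
  apply: ler_sum => m _.
  rewrite [h m s in leLHS](_ : _ = (h m s / G s) * G s); last by rewrite divfK// gt_eqF.
  rewrite powRM ?divr_ge0// mulrA ler_wpM2r ?powR_ge0// powR_mix// divr_ge0//.
rewrite -mulr_suml ler_wpM2r ?powR_ge0// big_split/= addrC lerD//.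
under eq_bigr do rewrite expr_div_n.
by rewrite -mulr_suml ler_pdivrMr ?exprn_gt0// mul1r.
Qed.

End minkowski.

Section far.
Context {R : realType} {V H : zmodType}.
Variables (n0 n1 : V -> R) (rip : H -> H -> R) (rs : R -> H -> H).
Variables (u : R -> V -> H) (sigma E D : R).
Local Notation mu := (@lebesgue_measure R).
Local Notation vint := (vint rip u).

(* At [th = 0] the factor [rho `^ (- (sigma * th))] is 1, and no separation of the
   support of [F] from [t] is required. *)
Definition far_estimate (th tt p : R) : Prop := exists C : R, 0 < C /\
  forall (F : R -> V) (nu : V -> R) B t b c rho, simple F -> 0 <= B -> 0 < rho ->
  (forall s, jle n0 n1 tt (F s) (nu (F s))) ->
  (\int[mu]_s (nu (F s) `^ p)%:E <= B%:E)%E -> jle n0 n1 th b c ->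
  (forall s, F s != 0 -> th = 0 \/ rho <= `|t - s|) ->
  `|rip (u t b) (vint F)| <= C * rho `^ (- (sigma * th)) * B `^ p^-1 * c.

Hypothesis hU : dispersive n0 n1 rip rs u sigma E D.
Hypothesis sigma0 : 0 < sigma.
Let hH := disp_hilbert hU.

Lemma far_estimate_diag th : 0 <= th <= 1 -> far_estimate th th 1.
Proof.
move=> th01; have /andP[th0 th1] := th01.
have [K [K0 hK]] := kernel_le hU th01.
exists K; split => // F nu B t b c rho sF B0 rho0 hF hB hb hrho.
have c0 : 0 <= c by case: hb.
have nu0 s : 0 <= nu (F s) by case: (hF s).
rewrite invr1 powRr1// -lee_fin.
have mnu : measurable_fun setT (fun s => nu (F s)).
  by apply: (measurable_simple (h := fun x _ => nu x)) => // x; exact: measurable_cst.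
have k0 : 0 <= K * rho `^ (- (sigma * th)) * c by rewrite !mulr_ge0 ?powR_ge0 ?(ltW K0).
apply: (@le_trans _ _ (\int[mu]_s ((K * rho `^ (- (sigma * th)) * c)%:E * (nu (F s))%:E))%E);
    last first.
  have mnu' : measurable_fun setT (fun s => (nu (F s))%:E) by exact/measurable_EFinP.
  rewrite ge0_integralZl//; last by move=> s _; rewrite lee_fin.
  rewrite [X in (_ <= X%:E)%E](_ : _ = K * rho `^ (- (sigma * th)) * c * B); last by ring.
  rewrite (EFinM _ B) lee_wpmul2l//; apply: le_trans hB.
  by apply: le_of_eq; apply: eq_integral => s _; rewrite powRr1.
apply: (@vint_le _ _ _ _ _ _ _ _ _ _ _ hU _ _ _ t) => //.
  by move=> s; rewrite mule_ge0// lee_fin.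
move=> s st; rewrite -EFinM lee_fin.
have [Fs_0|Fs0] := eqVneq (F s) 0.
  by rewrite [in leLHS]Fs_0 (rip_u0 hU) normr0 mulr_ge0.
have ts : t != s by rewrite eq_sym.
apply: le_trans (hK _ _ _ _ _ _ ts hb (hF s)) _.
rewrite -[leRHS]mulrA ler_wpM2r ?mulr_ge0// ler_wpM2l ?(ltW K0)//.
have [th_0|h] := hrho _ Fs0; first by rewrite th_0 mulr0 oppr0 !powRr0.
by apply: le_powRN => //; rewrite mulr_ge0// ltW.
Qed.

Lemma far_estimate_energy a : 0 < a <= 1 ->
  sigma * a < 1 \/ (sigma * a = 1 /\ 1 < sigma) ->
  far_estimate 0 a (2 / (2 - sigma * a)).
Proof.
move=> a01 sa; have [C [C0 hC]] := strichartz hU a01 sigma0 sa.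
have E0 := disp_E hU.
exists (E * C); split; first exact: mulr_gt0.
move=> F nu B t b c rho sF B0 rho0 hF hB [c0]; rewrite eqxx => bc _.
rewrite mulr0 oppr0 powRr0 mulr1 (ripC hH).
apply: le_trans (rip_u_energy hU _ _ _) _.
have := hC F idfun nu B sF erefl B0 hF hB.
rewrite (_ : 1 - sigma * a / 2 = (2 / (2 - sigma * a))^-1); last first.
  by case: sa => [?|[-> _]]; field; lra.
move=> h; rewrite [leRHS](_ : _ = (C * B `^ (2 / (2 - sigma * a))^-1) * (E * c)); last by ring.
by apply: ler_pM; rewrite ?rnorm_ge0 ?mulr_ge0 ?(n0_ge0 hU) ?(ltW E0)// ler_wpM2l ?(ltW E0).
Qed.

End far.

Section far_interpolation.
Context {R : realType} {V H : zmodType}.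
Variables (n0 n1 : V -> R) (rip : H -> H -> R) (rs : R -> H -> H).
Variables (u : R -> V -> H) (sigma E D : R).
Local Notation mu := (@lebesgue_measure R).
Local Notation vint := (vint rip u).
Hypothesis hU : dispersive n0 n1 rip rs u sigma E D.
Hypothesis sigma0 : 0 < sigma.
Let hH := disp_hilbert hU.

(* The cut between the two endpoint estimates is made pointwise in time, at a
   level [w] depending on the size of [F s]; both parts then reproduce the same
   L^p norm of [F]. *)
Lemma far_estimate_interp th a : 0 < th < 1 -> 0 < a <= 1 ->
  sigma * a < 1 \/ (sigma * a = 1 /\ 1 < sigma) ->
  far_estimate n0 n1 rip u sigma th (th + (1 - th) * a) (2 / (2 - sigma * ((1 - th) * a))).
Proof.
move=> th01 a01 sa; have /andP[th0 th1] := th01; have /andP[a0 a1] := a01.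
have [CS [CS0 hCS]] := strichartz hU a01 sigma0 sa.
have [C [C0 hC]] := reiteration (disp_n0 hU) (disp_n1 hU) th01 a01.
have E0 := disp_E hU; have D0 := disp_D hU.
set S := sigma * a in sa hCS.
have S0 : 0 < S by exact: mulr_gt0.
have S1 : S <= 1 by case: sa => [/ltW|[-> _]].
pose q := 2 - (1 - th) * S.
have q1 : 1 < q.
  have : (1 - th) * S <= 1 - th by rewrite ler_piMr// subr_ge0 ltW.
  by rewrite /q => ?; lra.
have q0 : 0 < q by exact: lt_trans q1.
rewrite (_ : sigma * _ = (1 - th) * S); last by rewrite /S; ring.
rewrite -/q; pose p := 2 / q; rewrite -/p.
pose p0 := 2 / (2 - S); rewrite -/p0 in hCS.
have pp : 0 < p by rewrite divr_gt0.
have S2 : 0 < 2 - S by lra.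
have p0p : 0 < p0 by rewrite divr_gt0.
have p01 : 1 <= p0 by rewrite ler_pdivlMr// mul1r; lra.
have p02 : p0 <= 2 by rewrite ler_pdivrMr//; lra.
(* The exponent for which (1 - gam th) p0 and 1 + gam (1 - th) are both equal to [p]: the Strichartz
   part in L^p0 and the dispersive part in L^1 then see the same integral of nu^p. *)
pose gam := S / q.
have gam0 : 0 < gam by rewrite divr_gt0.
have gE1 : 1 - gam * th = (2 - S) / q by rewrite /gam /q; field; rewrite -/q gt_eqF.
have gE2 : 1 + gam * (1 - th) = p by rewrite /gam /p /q; field; rewrite -/q gt_eqF.
have gp : (1 - gam * th) * p0 = p by rewrite gE1 /p0 /p; field; rewrite !gt_eqF.
have g0 : 0 < 1 - gam * th by rewrite gE1 divr_gt0.
pose K := 2 * Num.sqrt C * CS * E + D * Num.sqrt C.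
have sC0 : 0 < Num.sqrt C by rewrite sqrtr_gt0.
have K0 : 0 < K by rewrite addr_gt0// !mulr_gt0.
exists K; split => //.
suff main F nu B t b c rho : simple F -> 0 < B -> 0 < rho ->
    (forall s, jle n0 n1 (th + (1 - th) * a) (F s) (nu (F s))) ->
    (\int[mu]_s (nu (F s) `^ p)%:E <= B%:E)%E -> jle n0 n1 th b c ->
    (forall s, F s != 0 -> rho <= `|t - s|) ->
    `|rip (u t b) (vint F)| <= K * rho `^ (- (sigma * th)) * B `^ p^-1 * c.
  move=> F nu B t b c rho sF B0 rho0 hF hB hb hrho.
  have {}hrho s : F s != 0 -> rho <= `|t - s|.
    by move=> /hrho[th_0|//]; rewrite th_0 ltxx in th0.
  move: B0; rewrite le_eqVlt => /predU1P[B_0|B0]; last exact: (main F nu).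
  rewrite -B_0 powR0 ?mulr0 ?mul0r; last by rewrite invr_neq0// gt_eqF.
  have c0 : 0 <= c by case: hb.
  have q'0 : 0 < p^-1 by rewrite invr_gt0.
  have C'0 : 0 < K * rho `^ (- (sigma * th)) * (c + 1).
    by rewrite !mulr_gt0 ?powR_gt0// ltr_wpDl.
  apply: (le0_of_powR_bound C'0 q'0) => e e0.
  apply: (@le_trans _ _ (K * rho `^ (- (sigma * th)) * e `^ p^-1 * c)).
    by apply: (main F nu) => //; apply: le_trans hB _; rewrite -B_0 lee_fin ltW.
  rewrite -!mulrA ler_wpM2l ?(ltW K0)// ler_wpM2l ?powR_ge0// mulrC.
  by rewrite ler_wpM2r ?powR_ge0// lerDl.
move=> sF B0 rho0 hF hB hb hrho.
have c0 : 0 <= c by case: hb.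
have nu0 s : 0 <= nu (F s) by case: (hF s).
have [r [bb [beta [ur bE _ hb0 hb1 hbs]]]] := jle_dec th01 hb.
have beta0 m : 0 <= beta m.
  by rewrite -(pmulr_rge0 _ (expR_gt0 (th * m%:~R))) (le_trans (n0_ge0 hU (bb m))).
set A := B `^ p^-1.
have A0 : 0 < A by rewrite powR_gt0.
have Ap : A `^ p = B by rewrite -powRrM mulVf ?gt_eqF// powRr1// ltW.
pose n x := nu x / A.
have n_ge0 s : 0 <= n (F s) by rewrite divr_ge0// ltW.
(* The first term gives both parts the factor rho^(-sigma th), once the dispersive rho^(-sigma) is
   included; the second is the dependence on the normalised size of the value. *)
pose w x := sigma * ln rho + gam * ln (n x).
pose P := rho `^ (- (sigma * th)).
have P0 : 0 < P by rewrite powR_gt0.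
have w1 s : expR (- (2 * th * w (F s))) * nu (F s) ^+ 2 = (P * A * n (F s) `^ (1 - gam * th)) ^+ 2.
  have := nu0 s; rewrite le_eqVlt => /predU1P[nu_0|nup].
    by rewrite /n -nu_0 mul0r powR0 ?gt_eqF// mulr0 expr0n mulr0.
  have np : 0 < n (F s) by rewrite divr_gt0.
  have -> : nu (F s) = n (F s) * A by rewrite /n divfK// gt_eqF.
  rewrite /w /P; have /pos_expR[la ->] := A0.
  move: np rho0 => /pos_expR[ln_ ->] /pos_expR[lr ->].
  rewrite !expRK !powR_expR -!expRD -!expRM_natl -expRD; congr expR; ring.
have w2 s : expR ((1 - th) * w (F s)) * nu (F s) <= rho `^ (sigma * (1 - th)) * A * n (F s) `^ p.
  have := nu0 s; rewrite le_eqVlt => /predU1P[nu_0|nup].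
    by rewrite -nu_0 mulr0 !mulr_ge0 ?powR_ge0 ?(ltW A0).
  have np : 0 < n (F s) by rewrite divr_gt0.
  have -> : nu (F s) = n (F s) * A by rewrite /n divfK// gt_eqF.
  rewrite /w -gE2; move: np rho0 => /pos_expR[ln_ ->] /pos_expR[lr ->].
  rewrite !expRK !powR_expR mulrA -expRD [leRHS]mulrAC -expRD.
  apply: le_of_eq; congr (expR _ * _); ring.
have mcomp (f : V -> R) : measurable_fun setT (fun s => f (F s)).
  by apply: (measurable_simple (h := fun x _ => f x)) => // x; exact: measurable_cst.
have In : (\int[mu]_s (n (F s) `^ p)%:E <= 1%:E)%E.
  apply: (@le_trans _ _ (\int[mu]_s ((B^-1)%:E * (nu (F s) `^ p)%:E))%E).
    apply: le_ge0_integral => s; first by rewrite lee_fin powR_ge0.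
    rewrite -EFinM lee_fin /n powRM ?invr_ge0 ?(ltW A0)//.
    by rewrite -powR_inv1 ?(ltW A0)// -powRrM mulN1r powRN Ap mulrC.
  rewrite ge0_integralZl//.
  - apply: (@le_trans _ _ ((B^-1)%:E * B%:E)%E).
      by rewrite lee_wpmul2l// lee_fin invr_ge0 ltW.
    by rewrite -EFinM mulVf ?gt_eqF.
  - by apply/measurable_EFinP; exact: (mcomp (fun x => nu x `^ p)).
  - by move=> s _; rewrite lee_fin powR_ge0.
  - by rewrite lee_fin invr_ge0 ltW.
have sn0 := disp_n0 hU; have sn1 := disp_n1 hU.
(* Splittings are attached to values of [F] rather than to times, and the value 0 is split
   trivially, so that each [Y m \o F] is again simple. *)
have /choice[g hg] (x : V) : exists z : (int -> V) * (int -> R) * (int -> R),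
    (range F x -> reiterated n0 n1 th a (nu x) (w x) C r x z.1.1 z.1.2 z.2) /\
    (x = 0 -> z.1.1 = (fun=> 0)).
  have [->|x0] := eqVneq x 0.
    have Cn : 0 <= C * nu 0 ^+ 2 := mulr_ge0 (ltW C0) (sqr_ge0 _).
    exists ((fun=> 0), (fun=> 0), (fun=> 0)); split => // _; split.
    - by move=> m; exact: jle00.
    - by move=> m; rewrite /= subrr (seminorm0 sn1).
    - by rewrite big1// => m _; rewrite mulr0 expr0n.
    - by rewrite big1// => m _; rewrite mulr0 expr0n.
  have [[s _ Fs]|nx] := pselect (range F x); last first.
    by exists ((fun=> 0), (fun=> 0), (fun=> 0)); split.
  rewrite -Fs; have [y [eta [zeta h]]] := hC _ _ (w (F s)) _ ur (hF s).
  exists (y, eta, zeta); split => // x_0.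
  by rewrite -Fs x_0 eqxx in x0.
pose Y m x := (g x).1.1 m.
pose eta m x := (g x).1.2 m.
pose zeta m x := (g x).2 m.
have hR s : reiterated n0 n1 th a (nu (F s)) (w (F s)) C r (F s) (Y^~ (F s)) (eta^~ (F s))
    (zeta^~ (F s)).
  by apply: (hg (F s)).1; exists s.
have Y0 m : Y m 0 = 0 by rewrite /Y (hg 0).2.
have eta0 m s : 0 <= eta m (F s) by have [h _ _ _] := hR s; case: (h m).
have zeta0 m s : 0 <= zeta m (F s).
  by have [_ h _ _] := hR s; apply: le_trans (h m); exact: seminorm_ge0.
pose Q := Num.sqrt C * P * A.
have Q0 : 0 < Q by rewrite !mulr_gt0.
have Q20 : 0 < 2 * Q by rewrite mulr_gt0.
(* [Q] normalises the square sum over [m]. The extra 2 meets the bound 1/2 in [l2_minkowski], since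
   2^(-p0) <= 1/2 for p0 >= 1. *)
pose h m s := expR (th * m%:~R) * eta m (F s) / (2 * Q).
pose G s := n (F s) `^ (1 - gam * th) / 2.
have h0 m s : 0 <= h m s by rewrite divr_ge0 ?(ltW Q20)// mulr_ge0 ?expR_ge0.
have hG s : \sum_(m <- r) h m s ^+ 2 <= G s ^+ 2.
  have [_ _ hs _] := hR s.
  have -> : \sum_(m <- r) h m s ^+ 2 = expR (- (2 * th * w (F s))) / (2 * Q) ^+ 2 *
     \sum_(m <- r) (expR (th * (m%:~R + w (F s))) * eta m (F s)) ^+ 2.
    rewrite mulr_sumr; apply: eq_bigr => m _; rewrite /h.
    rewrite (_ : expR (th * m%:~R) = expR (- (th * w (F s))) * expR (th * (m%:~R + w (F s))));
        last first.
      by rewrite -expRD; congr expR; ring.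
    rewrite (_ : expR (- (2 * th * w (F s))) = expR (- (th * w (F s))) ^+ 2); last first.
      by rewrite -expRM_natl; congr expR; ring.
    by field; rewrite gt_eqF.
  apply: (@le_trans _ _ (expR (- (2 * th * w (F s))) / (2 * Q) ^+ 2 * (C * nu (F s) ^+ 2))).
    by rewrite ler_wpM2l ?divr_ge0 ?expR_ge0 ?sqr_ge0.
  rewrite (_ : _ * (C * _) = (expR (- (2 * th * w (F s))) * nu (F s) ^+ 2) * (C / (2 * Q) ^+
      2)); last by ring.
  rewrite w1 /G /Q; apply: le_of_eq.
  rewrite -{1}(sqr_sqrtr (ltW C0)); field.
  by rewrite !gt_eqF.
have mh m : measurable_fun setT (h m).
  exact: (mcomp (fun x => expR (th * m%:~R) * eta m x / (2 * Q))).
have mG : measurable_fun setT G by exact: (mcomp (fun x => n x `^ (1 - gam * th) / 2)).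
have G0 s : 0 <= G s by rewrite divr_ge0 ?powR_ge0.
have mnp : measurable_fun setT (fun s => (n (F s) `^ p)%:E).
  by apply/measurable_EFinP; exact: (mcomp (fun x => n x `^ p)).
have GI : (\int[mu]_s (G s `^ p0)%:E <= (2^-1)%:E)%E.
  apply: (@le_trans _ _ (\int[mu]_s ((2^-1)%:E * (n (F s) `^ p)%:E))%E).
    apply: le_ge0_integral => s; first by rewrite lee_fin powR_ge0.
    rewrite -EFinM lee_fin /G powRM ?invr_ge0 ?powR_ge0// -powRrM gp mulrC.
    rewrite ler_wpM2r ?powR_ge0//; apply: ge1r_powR => //.
    by rewrite invr_gt0 ltr0n/= invf_le1// ler1n.
  rewrite ge0_integralZl//; last by move=> s _; rewrite lee_fin powR_ge0.
  by rewrite -[leRHS]mule1 lee_wpmul2l.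
have p012 : 1 <= p0 <= 2 by rewrite p01.
have [X [X0 XE X1]] := l2_minkowski p012 mh h0 mG G0 hG GI.
(* The part [Y m] is paired with [bb m] by energy and Strichartz, the rest by dispersion in [T2].
   The growth e^(th m) and e^(-(1-th) m) of the two norms of [bb m] is exactly what the weights of
   [reiterated] compensate. *)
have T1 m : m \in r -> `|rip (u t (bb m)) (vint (Y m \o F))| <= 2 * Q * CS * E * (X m * beta m).
  move=> mr; rewrite (ripC hH).
  apply: le_trans (rip_u_energy hU _ _ _) _.
  set cm := 2 * Q * expR (- (th * m%:~R)).
  have cm0 : 0 < cm by rewrite mulr_gt0 ?expR_gt0.
  have etaE s : eta m (F s) = cm * h m s.
    rewrite /cm /h expRN; field.
    by rewrite !gt_eqF ?expR_gt0.
  have mhp : measurable_fun setT (fun s => (h m s `^ p0)%:E).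
    by apply/measurable_EFinP; exact: (mcomp (fun x =>
        (expR (th * m%:~R) * eta m x / (2 * Q)) `^ p0)).
  have hv : rnorm rip (vint (Y m \o F)) <= CS * (cm * X m).
    have := hCS F (Y m) (eta m) ((cm * X m) `^ p0) sF (Y0 m) (powR_ge0 _ _) _ _.
    rewrite -powRrM (_ : p0 * _ = 1); last by rewrite /p0; field; rewrite gt_eqF.
    rewrite powRr1; last by rewrite mulr_ge0// ltW.
    apply; first by move=> s; have [hy _ _ _] := hR s; exact: hy.
    apply: (@le_trans _ _ (\int[mu]_s ((cm `^ p0)%:E * (h m s `^ p0)%:E))%E).
      apply: le_ge0_integral => s; first by rewrite lee_fin powR_ge0.
      by rewrite -EFinM lee_fin etaE powRM// ltW.
    rewrite ge0_integralZl//; last 2 first.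
    + by move=> s _; rewrite lee_fin powR_ge0.
    + by rewrite lee_fin powR_ge0.
    by rewrite (XE _ mr) -EFinM lee_fin (powRM _ (ltW cm0) (X0 m)) lexx.
  apply: (@le_trans _ _ (CS * (cm * X m) * (E * (expR (th * m%:~R) * beta m)))).
    apply: ler_pM => //; rewrite ?rnorm_ge0//; first by rewrite mulr_ge0 ?(n0_ge0 hU) ?(ltW E0).
    by rewrite ler_wpM2l ?(ltW E0).
  rewrite /cm expRN; apply: le_of_eq; field.
  by rewrite gt_eqF ?expR_gt0.
pose kk := D * rho `^ (- sigma).
have kk0 : 0 <= kk by rewrite mulr_ge0 ?powR_ge0 ?(ltW D0).
have kkE : kk = D * rho `^ (- sigma) by [].
clearbody kk.
have T0 m s : 0 <= kk * (beta m * (expR (- (1 - th) * m%:~R) * zeta m (F s))).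
  exact: mulr_ge0 kk0 (mulr_ge0 (beta0 m) (mulr_ge0 (expR_ge0 _) (zeta0 m s))).
have T2 m : (`|rip (u t (bb m)) (vint (fun s => F s - Y m (F s)))|%:E <=
    \int[mu]_s (kk * (beta m * (expR (- (1 - th) * m%:~R) * zeta m (F s))))%:E)%E.
  apply: (@vint_le _ _ _ _ _ _ _ _ _ _ _ hU _ _ _ t).
  - by apply: (@simple_comp _ _ _ F (fun x => x - Y m x)) => //; rewrite Y0 subrr.
  - by move=> s; rewrite lee_fin T0.
  - move=> s st; rewrite lee_fin.
    have [Fs_0|Fs0] := eqVneq (F s) 0.
      by rewrite [in leLHS]Fs_0 Y0 subrr (rip_u0 hU) normr0 T0.
    have ts : t != s by rewrite eq_sym.
    apply: le_trans (disp_decay hU _ _ ts) _.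
    have [_ hz _ _] := hR s.
    rewrite (_ : beta m * _ = expR (- (1 - th) * m%:~R) * beta m * zeta m (F s)); last by ring.
    apply: ler_pM.
    + by rewrite mulr_ge0 ?powR_ge0 ?(ltW D0).
    + by rewrite mulr_ge0 ?(n1_ge0 hU).
    + rewrite kkE ler_wpM2l ?(ltW D0)//; apply: le_powRN => //; last exact: ltW.
      exact: hrho.
    + by apply: ler_pM; rewrite ?(n1_ge0 hU)//; exact: hz.
have vE m : rip (u t (bb m)) (vint F) = rip (u t (bb m)) (vint (Y m \o F)) +
    rip (u t (bb m)) (vint (fun s => F s - Y m (F s))).
  pose GG (i : bool) := if i then Y m \o F else fun s => F s - Y m (F s).
  rewrite (@vint_sum _ _ _ _ _ _ _ _ _ _ _ hU _ [:: true; false] GG)//.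
  - by rewrite !big_cons big_nil addr0.
  - case; first by apply: simple_comp => //; exact: Y0.
    by apply: (@simple_comp _ _ _ F (fun x => x - Y m x)) => //; rewrite Y0 subrr.
  - by move=> s; rewrite !big_cons big_nil /GG addr0 /= subrKC.
rewrite bE (ripC hH) (rip_u_sum hU).
under eq_bigr do rewrite (ripC hH) vE.
rewrite big_split/=; apply: le_trans (ler_normD _ _) _.
have B1 : `|\sum_(m <- r) rip (u t (bb m)) (vint (Y m \o F))| <= 2 * Q * CS * E * c.
  apply: le_trans (ler_norm_sum _ _ _) _.
  apply: (@le_trans _ _ (\sum_(m <- r) 2 * Q * CS * E * (X m * beta m))).
    by rewrite big_seq [leRHS]big_seq; apply: ler_sum => m; exact: T1.
  rewrite -mulr_sumr ler_wpM2l//.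
    exact: mulr_ge0 (mulr_ge0 (ltW Q20) (ltW CS0)) (ltW E0).
  by rewrite -[leRHS]mul1r; apply: cauchy_sum; rewrite ?expr1n.
have B2 : `|\sum_(m <- r) rip (u t (bb m)) (vint (fun s => F s - Y m (F s)))| <=
    kk * (c * (Num.sqrt C * (rho `^ (sigma * (1 - th)) * A))).
  apply: le_trans (ler_norm_sum _ _ _) _; rewrite -lee_fin -sumEFin.
  apply: (@le_trans _ _ (\sum_(m <- r) \int[mu]_s (kk * (beta m * (expR (- (1 - th) * m%:~R) *
      zeta m (F s))))%:E)%E).
    by apply: lee_sum => m _; exact: T2.
  rewrite -ge0_integral_sum//; last 2 first.
  - move=> m; apply/measurable_EFinP.
    exact: (mcomp (fun x => kk * (beta m * (expR (- (1 - th) * m%:~R) * zeta m x)))).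
  - by move=> m s _; rewrite lee_fin T0.
  set Z := kk * _.
  apply: (@le_trans _ _ (\int[mu]_s (Z%:E * (n (F s) `^ p)%:E))%E); last first.
    have Z0 : (0 <= Z%:E)%E.
      by rewrite lee_fin /Z; do 4?[apply: mulr_ge0 => //]; rewrite ?powR_ge0 ?(ltW sC0) ?(ltW A0).
    rewrite ge0_integralZl//; last by move=> s _; rewrite lee_fin powR_ge0.
    by rewrite -[leRHS]mule1 lee_wpmul2l.
  apply: le_ge0_integral => s.
    by apply: sume_ge0 => m _; rewrite lee_fin T0.
  rewrite sumEFin -EFinM lee_fin -mulr_sumr /Z -!mulrA ler_wpM2l//.
  have [_ _ _ hz] := hR s.
  apply: (@le_trans _ _ (c * (Num.sqrt C * (expR ((1 - th) * w (F s)) * nu (F s))))).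
    apply: cauchy_sum => //; first by rewrite !mulr_ge0 ?expR_ge0 ?(ltW sC0).
    rewrite !exprMn (sqr_sqrtr (ltW C0)).
    have -> : \sum_(m <- r) (expR (- (1 - th) * m%:~R) * zeta m (F s)) ^+ 2 =
        expR ((1 - th) * w (F s)) ^+ 2 *
        \sum_(m <- r) (expR (- (1 - th) * (m%:~R + w (F s))) * zeta m (F s)) ^+ 2.
      rewrite mulr_sumr; apply: eq_bigr => m _; rewrite -exprMn; congr (_ ^+ 2).
      by rewrite mulrA -expRD; congr (expR _ * _); ring.
    rewrite mulrCA ler_wpM2l ?sqr_ge0//.
  rewrite ler_wpM2l// ler_wpM2l ?(ltW sC0)//; apply: le_trans (w2 s) _.
  by rewrite mulrA.
apply: le_trans (lerD B1 B2) _.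
have PE : rho `^ (- sigma) * rho `^ (sigma * (1 - th)) = P.
  by rewrite -ge0_powRD//; congr (_ `^ _); ring.
rewrite (_ : kk * _ = D * Num.sqrt C * (rho `^ (- sigma) * rho `^ (sigma * (1 - th))) * A * c);
    last first.
  by rewrite kkE; ring.
by rewrite PE /Q /K le_eqVlt -/P; apply/orP; left; apply/eqP; ring.
Qed.

End far_interpolation.

(** * Weak-type estimates *)

Section weak_type.
Context {R : realType} {V H : zmodType}.
Variables (n0 n1 : V -> R) (rip : H -> H -> R) (rs : R -> H -> H).
Variables (u : R -> V -> H) (sigma E D : R).
Local Notation mu := (@lebesgue_measure R).
Local Notation vint := (vint rip u).
Hypothesis hU : dispersive n0 n1 rip rs u sigma E D.
Hypothesis sigma0 : 0 < sigma.
Let hH := disp_hilbert hU.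

Lemma measurable_ltr_dist (t r : R) : measurable_fun setT (fun s : R => `|t - s| < r).
Proof.
apply: measurable_fun_ltr; last exact: measurable_cst.
apply: measurableT_comp => //.
by apply: measurable_funB => //; exact: measurable_cst.
Qed.

(** A qualitative bound with [M] depending on [F]; it serves only to make the remainder after
    finitely many dyadic shells disappear. *)
Lemma near_diagonal_le (F : R -> V) t b : simple F -> exists M, 0 <= M /\
  forall r, 0 < r -> `|rip (u t b) (vint (cut (fun s => `|t - s| < r) F))| <= M * r.
Proof.
move=> sF; have [K [K0 FK]] := simple_bounded n0 sF.
have E0 := ltW (disp_E hU).
pose N := rnorm rip (u t b) * (E * K).
have N0 : 0 <= N by rewrite !mulr_ge0 ?rnorm_ge0.
exists (N * 2); split; first by rewrite mulr_ge0.
move=> r r0; have sc := simple_cut sF (measurable_ltr_dist t r).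
rewrite -lee_fin.
apply: (@le_trans _ _ (\int[mu]_s (N%:E * (\1_`[(t - r)%R, (t + r)%R] s)%:E))%E).
  apply: (@vint_le _ _ _ _ _ _ _ _ _ _ _ hU _ _ _ t) => //.
    by move=> s; rewrite mule_ge0 ?lee_fin// indicE.
  move=> s _; rewrite -EFinM lee_fin /cut; case: ifPn => [ts|_]; last first.
    by rewrite (rip_u0 hU) normr0 mulr_ge0// indicE.
  rewrite indicE mem_set; last first.
    by rewrite /= in_itv/=; move: ts; rewrite ltr_norml => ?; lra.
  rewrite mulr1; apply: le_trans (rip_u_energy hU _ _ _) _.
  by rewrite ler_wpM2l ?rnorm_ge0// ler_wpM2l.
rewrite ge0_integralZl//.
- rewrite integral_indic// setIT /= lebesgue_measure_itv/= lte_fin.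
  case: ifP => _; last first.
    by rewrite mule0 lee_fin; apply: mulr_ge0 (ltW r0); exact: mulr_ge0.
  by rewrite -EFinD -EFinM lee_fin; apply: le_of_eq; ring.
- by apply/measurable_EFinP; exact: measurable_indic.
Qed.

Lemma vint_cut_le (F : R -> V) f (b b' : R -> bool) x : simple F -> measurable_fun setT b ->
  measurable_fun setT b' -> (forall s, b' s -> b s) ->
  `|rip f (vint (cut (fun s => ~~ b' s) (cut b F)))| <= x ->
  `|rip f (vint (cut b F))| <= x + `|rip f (vint (cut b' F))|.
Proof.
move=> sF mb mb' bb hx; rewrite (vint_cut hU f (simple_cut sF mb) mb').
rewrite (_ : cut b' (cut b F) = cut b' F); last first.
  by apply/funext => s; rewrite /cut; case: ifPn => // /bb ->.
by apply: le_trans (ler_normD _ _) _; rewrite addrC lerD2r.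
Qed.

Section dyadic.
Variables (th tt p C eps : R).
Hypotheses (C0 : 0 < C) (th0 : 0 < th) (eps0 : 0 < eps) (p0 : 0 < p).
Let beta := (sigma * th + eps) * p.
Hypothesis far : forall (F : R -> V) (nu : V -> R) B t b c rho,
  simple F -> 0 <= B -> 0 < rho ->
  (forall s, jle n0 n1 tt (F s) (nu (F s))) ->
  (\int[mu]_s (nu (F s) `^ p)%:E <= B%:E)%E -> jle n0 n1 th b c ->
  (forall s, F s != 0 -> th = 0 \/ rho <= `|t - s|) ->
  `|rip (u t b) (vint F)| <= C * rho `^ (- (sigma * th)) * B `^ p^-1 * c.
Variables (F : R -> V) (nu : V -> R) (t c w rho : R) (b : V).
Hypotheses (sF : simple F) (rho0 : 0 < rho) (w0 : 0 <= w) (nu0 : nu 0 = 0).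
Hypothesis (hF : forall s, jle n0 n1 tt (F s) (nu (F s))).
Hypothesis hb : jle n0 n1 th b c.
Hypothesis hw :
  (\int[mu]_s (nu (F s) `^ p * near_kernel beta rho (t - s))%:E <= w%:E)%E.

Let disc j := fun s => `|t - s| < rho * expR (- j%:R).

(** On the shell, |t-s|^(-beta) is at least the corresponding power of the outer radius, which turns
    [w] into a bound for the integral of nu^p. The far estimate at the inner radius costs a factor
    e^(sigma th), the ratio of the radii being e, and [eps] in [beta] leaves the decay e^(-eps
    j). *)
Lemma dyadic_shell j :
  `|rip (u t b) (vint (cut (fun s => ~~ disc j.+1 s) (cut (disc j) F)))| <=
  C * expR (sigma * th) * rho `^ eps * w `^ p^-1 * c * expR (- eps * j%:R).
Proof.
set G := cut _ _.
have mr i : measurable_fun setT (disc i) by exact: measurable_ltr_dist.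
have sG : simple G by apply: simple_cut; [exact: simple_cut|exact: measurable_neg].
pose rj := rho * expR (- j%:R); pose rj1 := rho * expR (- j.+1%:R).
have rj0 : 0 < rj by rewrite mulr_gt0 ?expR_gt0.
have rj10 : 0 < rj1 by rewrite mulr_gt0 ?expR_gt0.
have rjr : rj <= rho by rewrite ler_piMr ?(ltW rho0)// -expR0 ler_expR oppr_le0.
have nuF0 s : 0 <= nu (F s) by case: (hF s).
have b0 : 0 < beta by rewrite mulr_gt0// addr_gt0// mulr_gt0.
apply: (@le_trans _ _ (C * rj1 `^ (- (sigma * th)) * (rj `^ beta * w) `^ p^-1 * c)).
  apply: (far (nu := nu)) => //.
  - by rewrite mulr_ge0 ?powR_ge0.
  - move=> s; rewrite /G /cut; do 2?case: ifP => // _; rewrite ?nu0;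
      by [exact: hF|exact: (jle00 (disp_n0 hU) (disp_n1 hU))].
  - have mnk : measurable_fun setT (fun s : R => (nu (F s) `^ p * near_kernel beta rho (t - s))%:E).
      apply/measurable_EFinP; apply: measurable_funM.
        by apply: (measurable_simple (h := fun x _ => nu x `^ p)) => // x; exact: measurable_cst.
      apply: (measurableT_comp (measurable_near_kernel _ _)).
      by apply: measurable_funB => //; exact: measurable_cst.
    apply: (@le_trans _ _ (\int[mu]_s ((rj `^ beta)%:E * (nu (F s) `^ p * near_kernel beta rho
        (t - s))%:E))%E).
      apply: le_ge0_integral => s; first by rewrite lee_fin powR_ge0.
      rewrite -EFinM lee_fin /G /cut /disc -/rj -/rj1.
      have z0 : 0 <= rj `^ beta * (nu (F s) `^ p * near_kernel beta rho (t - s)).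
        by rewrite !mulr_ge0 ?powR_ge0 ?near_kernel_ge0.
      case: ifPn => [h1|_]; last by rewrite nu0 powR0 ?gt_eqF.
      case: ifPn => [h2|_]; last by rewrite nu0 powR0 ?gt_eqF.
      rewrite mulrCA ler_peMr ?powR_ge0// /near_kernel (lt_le_trans h2 rjr).
      move: h1; rewrite -leNgt => h1.
      have ts0 : 0 < `|t - s| by exact: lt_le_trans h1.
      by rewrite powRN ler_pdivlMr ?powR_gt0// mul1r ge0_ler_powR ?nnegrE ?(ltW b0)// ltW.
    rewrite ge0_integralZl//; last 2 first.
    + by move=> s _; rewrite lee_fin mulr_ge0 ?powR_ge0 ?near_kernel_ge0.
    + by rewrite lee_fin powR_ge0.
    by rewrite EFinM lee_wpmul2l// lee_fin powR_ge0.
  - move=> s; rewrite /G /cut; case: ifPn => [|_]; last by rewrite eqxx.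
    by rewrite /disc -leNgt; right.
rewrite powRM ?powR_ge0// /rj /rj1 /beta; move: rho0 => /pos_expR[l ->].
rewrite -!expRD !powR_expR; apply: le_of_eq.
rewrite (_ : expR (p^-1 * _) = expR (sigma * th) * expR (eps * l) * expR (- eps * j%:R) * expR
    (sigma * th * (l - j.+1%:R))).
  rewrite (_ : expR (- (sigma * th) * _) = (expR (sigma * th * (l - j.+1%:R)))^-1).
    by field; rewrite gt_eqF ?expR_gt0.
  by rewrite -expRN; congr expR; ring.
rewrite -!expRD; congr expR.
by rewrite -natr1; field; rewrite gt_eqF.
Qed.

Lemma near_le : `|rip (u t b) (vint (cut (fun s => `|t - s| < rho) F))| <=
  C * expR (sigma * th) / (1 - expR (- eps)) * rho `^ eps * w `^ p^-1 * c.
Proof.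
have c0 : 0 <= c by case: hb.
have [M [M0 hM]] := near_diagonal_le t b sF.
set K := C * expR (sigma * th) * rho `^ eps * w `^ p^-1 * c.
have K0 : 0 <= K by rewrite !mulr_ge0 ?powR_ge0 ?expR_ge0 ?(ltW C0).
have mr i : measurable_fun setT (disc i) by exact: measurable_ltr_dist.
have step J : `|rip (u t b) (vint (cut (disc 0) F))| <=
    \sum_(j < J) K * expR (- eps * j%:R) + `|rip (u t b) (vint (cut (disc J) F))|.
  elim: J => [|J IH]; first by rewrite big_ord0 add0r.
  have split : (forall s, disc J.+1 s -> disc J s) -> _ := fun h =>
      vint_cut_le sF (mr J) (mr J.+1) h (dyadic_shell J).
  apply: le_trans IH _; rewrite big_ord_recr/= -addrA lerD2l; apply: split => s.
  rewrite /disc => h; rewrite (lt_le_trans h)// ler_wpM2l ?(ltW rho0)//.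
  by rewrite ler_expR lerN2 ler_nat.
rewrite (_ : (fun s => _) = disc 0%N); last first.
  by apply/funext => s; rewrite /disc oppr0 expR0 mulr1.
apply/ler_addgt0Pr => d d0.
(* After [J] shells the remaining disc contributes at most M rho e^(-J), which is below [d] because
   e^J >= 1 + J. *)
pose J := Num.bound (M * rho / d).
have hJ : M * rho / d < J%:R by apply: archi_boundP; rewrite divr_ge0 ?mulr_ge0// ltW.
apply: le_trans (step J) _; apply: lerD.
  rewrite -mulr_sumr [leRHS](_ : _ = K * (1 - expR (- eps))^-1); last by rewrite /K; ring.
  rewrite ler_wpM2l//.
  rewrite (_ : \sum_(j < J) _ = \sum_(n <- iota 0 J) expR (- eps) ^+ n).
    by rewrite geometric_sum_le ?iota_uniq// expR_ge0 expR_lt1 oppr_lt0.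
  rewrite -[X in iota 0 X]subn0 -/(index_iota 0 J) big_mkord.
  by apply: eq_bigr => j _; rewrite -expRM_natr.
apply: le_trans (hM _ _) _; first by rewrite mulr_gt0 ?expR_gt0.
rewrite mulrA expRN ler_pdivrMr ?expR_gt0// -ler_pdivrMl// mulrC.
apply: le_trans (ltW hJ) _; apply: le_trans (expR_ge1Dx _); by rewrite lerDr.
Qed.

End dyadic.

(* The radius [rho] is chosen such that the part of [F] at distance at least [rho]
   from [t] contributes at most [lam / 4]; the near part is bounded by a power of
   the function [W], to which Chebyshev's inequality applies. *)
Lemma weak_type_le th tt p : 0 < th -> 0 < p -> sigma * th < p^-1 ->
  far_estimate n0 n1 rip u sigma th tt p -> exists C : R, 0 < C /\
  forall (F : R -> V) (nu : V -> R) B lam (S : set R), simple F -> nu 0 = 0 ->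
  (forall s, jle n0 n1 tt (F s) (nu (F s))) -> 0 < B ->
  (\int[mu]_s (nu (F s) `^ p)%:E <= B%:E)%E -> 0 < lam -> measurable S ->
  (forall t, S t -> exists b c, jle n0 n1 th b c /\
     lam * c < `|rip (u t b) (vint (cut (fun s => s < t) F))|) ->
  (mu S <= ((C * (B `^ p^-1 / lam)) `^ (sigma * th)^-1)%:E)%E.
Proof.
move=> th0 p0 hp [C [C0 far]]; set h := sigma * th in hp.
have h0 : 0 < h by exact: mulr_gt0.
(* Half of the available gap: [beta] is then below 1 and the near kernel is integrable. *)
pose eps := (p^-1 - h) / 2.
have eps0 : 0 < eps by rewrite divr_gt0// subr_gt0.
pose beta := (h + eps) * p.
have b01 : 0 <= beta < 1.
  rewrite mulr_ge0 ?addr_ge0 ?(ltW h0) ?(ltW eps0) ?(ltW p0)//=.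
  by rewrite -ltr_pdivlMr// mul1r /eps; lra.
have b1 : 0 < 1 - beta by case/andP: b01; rewrite subr_gt0.
pose K2 := C * expR h / (1 - expR (- eps)).
have K20 : 0 < K2.
  by rewrite divr_gt0 ?mulr_gt0 ?expR_gt0// subr_gt0 expR_lt1 oppr_lt0.
have K2E : K2 = C * expR h / (1 - expR (- eps)) by [].
clearbody K2.
(* Constants of the final product. The powers of [rho] from [1 / w] and from the mass of the kernel
   combine to [1 - h * p], where [eps] has cancelled; with [rho] a power [1 / h], this is the
   exponent of [4 * C], and [A / lam] ends up with exponent [1 / h]. *)
pose K3 := 2 / (1 - beta) * (4 * K2) `^ p * (4 * C) `^ ((1 - h * p) / h).
have e10 : 0 < 4 * C by rewrite mulr_gt0.
have e20 : 0 < 4 * K2 by rewrite mulr_gt0.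
have K30 : 0 < K3.
  have b20 : 0 < 2 / (1 - beta) by rewrite divr_gt0.
  exact: mulr_gt0 (mulr_gt0 b20 (powR_gt0 _ e20)) (powR_gt0 _ e10).
exists (K3 `^ h); split; first exact: powR_gt0.
move=> F nu B lam S sF nu0 hF B0 hB lam0 mS hS.
set A := B `^ p^-1.
have A0 : 0 < A by exact: powR_gt0.
have BA : B = A `^ p by rewrite -powRrM mulVf ?gt_eqF// powRr1// ltW.
(* Chosen so that the far estimate equals [lam / 4]; likewise [w] below is the level at which
   [near_le] gives [lam / 4]. Together they stay below [lam], which forces [W] above [w] on [S]. *)
pose rho := (4 * C * A / lam) `^ h^-1.
have rho0 : 0 < rho by exact: powR_gt0 _ (divr_gt0 (mulr_gt0 e10 A0) lam0).
pose w := (lam / (4 * K2 * rho `^ eps)) `^ p.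
have re0 : 0 < rho `^ eps by exact: powR_gt0.
have lr0 : 0 < lam / (4 * K2 * rho `^ eps) by exact: divr_gt0 lam0 (mulr_gt0 e20 re0).
have w0 : 0 < w by exact: powR_gt0.
have nuF0 s : 0 <= nu (F s) by case: (hF s).
pose W t := (\int[mu]_s (nu (F s) `^ p * near_kernel beta rho (t - s))%:E)%E.
have W0 t : (0 <= W t)%E.
  by apply: integral_ge0 => s _; rewrite lee_fin mulr_ge0 ?powR_ge0 ?near_kernel_ge0.
have SW t : S t -> (w%:E < W t)%E.
  move=> /hS[b [c [hb lamc]]]; rewrite ltNge; apply/negP => Ww.
  have c0 : 0 <= c by case: hb.
  suff : `|rip (u t b) (vint (cut (fun s => s < t) F))| <= lam / 4 * c + lam / 4 * c.
    have lc : 0 <= lam * c := mulr_ge0 (ltW lam0) c0.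
    move=> /(lt_le_trans lamc); rewrite (_ : _ + _ = lam * c / 2); last by field.
    by rewrite ltNge ler_piMr// invf_le1// ler1n.
  set G := cut _ F.
  have mt : measurable_fun setT (fun s : R => s < t).
    by apply: measurable_fun_ltr => //; exact: measurable_cst.
  have sG : simple G by exact: simple_cut.
  have hG s : jle n0 n1 tt (G s) (nu (G s)).
    rewrite /G /cut; case: ifP => // _; rewrite nu0.
    exact: (jle00 (disp_n0 hU) (disp_n1 hU)).
  have Gp s : nu (G s) `^ p <= nu (F s) `^ p.
    by rewrite /G /cut; case: ifP => // _; rewrite nu0 powR0 ?gt_eqF ?powR_ge0.
  rewrite (vint_cut hU _ sG (measurable_ltr_dist t rho)).
  apply: le_trans (ler_normD _ _) _; apply: lerD.
    have hw : (\int[mu]_s (nu (G s) `^ p * near_kernel beta rho (t - s))%:E <= w%:E)%E.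
      apply: le_trans Ww; apply: le_ge0_integral => s.
        by rewrite lee_fin mulr_ge0 ?powR_ge0 ?near_kernel_ge0.
      by rewrite lee_fin ler_wpM2r ?near_kernel_ge0.
    apply: le_trans (near_le C0 th0 eps0 p0 far sG rho0 (ltW w0) nu0 hG hb hw) _.
    rewrite ler_wpM2r// -/h -K2E /w -powRrM mulfV ?gt_eqF// (powRr1 (ltW lr0)).
    apply: le_of_eq; field.
    by rewrite !gt_eqF.
  apply: (@le_trans _ _ (C * rho `^ (- (sigma * th)) * B `^ p^-1 * c)).
    apply: (far _ nu _ _ _ _ _ _ _ _ _ _ hb).
    - by apply: simple_cut => //; apply: measurable_neg; exact: measurable_ltr_dist.
    - exact: ltW.
    - exact: rho0.
    - move=> s; rewrite {1 2}/cut; case: ifP => // _; rewrite nu0.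
      exact: (jle00 (disp_n0 hU) (disp_n1 hU)).
    - apply: le_trans hB; apply: le_ge0_integral => s; first by rewrite lee_fin powR_ge0.
      rewrite lee_fin; apply: le_trans (Gp s); rewrite {1}/cut; case: ifP => // _.
      by rewrite nu0 powR0 ?gt_eqF ?powR_ge0.
    - move=> s; rewrite {1}/cut; case: ifPn => [|_]; last by rewrite eqxx.
      by rewrite -leNgt; right.
  rewrite ler_wpM2r// -/A -/h /rho -powRrM mulrN mulVf ?gt_eqF// powR_inv1; last first.
    by rewrite divr_ge0 ?mulr_ge0// ltW.
  apply: le_of_eq; field.
  by rewrite !gt_eqF.
have key : (w%:E * mu S <= (2 / (1 - beta) * rho `^ (1 - beta))%:E * B%:E)%E.
  apply: (@le_trans _ _ (\int[mu]_t W t)%E).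
    rewrite -[X in (_ * X)%E](_ : (\int[mu]_t (\1_S t)%:E)%E = _); last first.
      by rewrite integral_indic// setIT.
    rewrite -ge0_integralZl//; last 2 first.
    - by apply/measurable_EFinP; exact: measurable_indic.
    - by rewrite lee_fin ltW.
    apply: le_ge0_integral => t; first by rewrite mule_ge0 ?lee_fin ?(ltW w0)// indicE.
    rewrite indicE; case: (boolP (t \in S)) => [/set_mem/SW/ltW|_]; first by rewrite mule1.
    by rewrite mule0.
  apply: le_trans (tonelli_conv (A := 2 / (1 - beta) * rho `^ (1 - beta)) _ _ _ _ _) _.
  - by apply: (measurable_simple (h := fun x _ => nu x `^ p)) => // x; exact: measurable_cst.
  - exact: measurable_near_kernel.
  - by move=> s; rewrite powR_ge0.
  - by move=> s; rewrite near_kernel_ge0.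
  - by move=> t; exact: integral_near_kernel.
  by rewrite lee_wpmul2l// lee_fin mulr_ge0 ?powR_ge0// divr_ge0// ltW.
have muE : (mu S <= (w^-1 * (2 / (1 - beta) * rho `^ (1 - beta) * B))%:E)%E.
  by rewrite EFinM lee_pdivlMl// EFinM.
apply: le_trans muE _; rewrite lee_fin; apply: le_of_eq.
rewrite BA; rewrite (powRM _ (powR_ge0 _ _)) ?divr_ge0 ?(ltW A0) ?(ltW lam0)//.
rewrite -powRrM mulfV ?gt_eqF// powRr1 ?(ltW K30)// /K3 /w /rho.
have bE : 1 - beta = 1 - h * p - eps * p by rewrite /beta; ring.
rewrite bE; move: A0 lam0 e10 e20 => /pos_expR[a ->] /pos_expR[l ->] /pos_expR[x ->]
    /pos_expR[y ->].
rewrite -/h; set Z := 2 / _; clearbody Z.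
clearbody eps h.
rewrite -!mulrA [LHS]mulrCA; congr (Z * _).
rewrite !(powR_expR, =^~ expRD, =^~ expRN); congr expR; field.
by rewrite gt_eqF.
Qed.

End weak_type.

(** * Banach couples and the K-functional *)

Section scalars.
Context {R : realType} {k : scalar_kind}.
Local Notation K := (scalar_field R k).
Implicit Types (x y : R) (z w : K).

Definition rc x : K := smk x 0.

Lemma sRe_rc x : sRe (rc x) = x. Proof. by rewrite /rc; case: k. Qed.
Lemma sReD z w : sRe (z + w) = sRe z + sRe w.
Proof. by move: z w; case: k => //= -[a b] [c d]. Qed.
Lemma sRe0 : sRe (0 : K) = 0.
Proof. by case: k. Qed.
Lemma sRe_rcM x z : sRe (rc x * z) = x * sRe z.
Proof. by rewrite /rc; move: z; case: k => //= -[a b] /=; rewrite mul0r subr0. Qed.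
Lemma normr_rc x : `|rc x| = rc `|x|.
Proof.
rewrite /rc; case: k => //=; apply/eqP.
by rewrite eq_complex /= expr0n addr0 sqrtr_sqr !eqxx.
Qed.
Lemma ge0_rcE z : 0 <= z -> z = rc (sRe z).
Proof. by rewrite /rc; move: z; case: k => //= -[a b]; rewrite lecE /= => /andP[/eqP-> _]. Qed.
Lemma le_sRe z w : z <= w -> sRe z <= sRe w.
Proof. by move: z w; case: k => //= -[a b] [c d]; rewrite lecE /= => /andP[]. Qed.
Lemma ltr_rc x y : (rc x < rc y) = (x < y).
Proof. by rewrite /rc; case: k => //=; rewrite ltcE /= eqxx. Qed.
Lemma rc0 : rc 0 = 0. Proof. by rewrite /rc; case: k. Qed.
Lemma real_absE z : real_abs z = Num.sqrt (sRe z ^+ 2 + sIm z ^+ 2).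
Proof.
rewrite /real_abs; move: z; case: k => [z|[a b]] //=.
by rewrite expr0n addr0 sqrtr_sqr.
Qed.
Lemma normr_sRe_le z : `|sRe z| <= real_abs z.
Proof. by rewrite real_absE -sqrtr_sqr ler_wsqrtr// lerDl sqr_ge0. Qed.
Lemma real_abs_le z : real_abs z <= `|sRe z| + `|sIm z|.
Proof.
rewrite real_absE -[leRHS]ger0_norm ?addr_ge0// -sqrtr_sqr ler_wsqrtr//.
by rewrite sqrrD !real_normK ?num_real// -addrA lerD2l lerDr mulrn_wge0 ?mulr_ge0.
Qed.

End scalars.

Section real_norm.
Context {R : realType} {k : scalar_kind}.
Local Notation K := (scalar_field R k).
Variable V : normedModType K.
Implicit Types (v w : V).

Lemma normr_real_norm v : `|v| = rc (real_norm v) :> K.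
Proof. exact: ge0_rcE. Qed.
Lemma real_norm_ge0 v : 0 <= real_norm v.
Proof. by rewrite -[leLHS](sRe0 (k := k)) le_sRe. Qed.
Lemma real_normD v w : real_norm (v + w) <= real_norm v + real_norm w.
Proof. by rewrite /real_norm -sReD le_sRe// ler_normD. Qed.
Lemma real_norm0 : real_norm (0 : V) = 0.
Proof. by rewrite /real_norm normr0 sRe0. Qed.
Lemma real_normN v : real_norm (- v) = real_norm v.
Proof. by rewrite /real_norm normrN. Qed.
Lemma real_norm_rcZ x v : real_norm (rc x *: v) = `|x| * real_norm v.
Proof. by rewrite /real_norm normrZ normr_rc sRe_rcM. Qed.
End real_norm.

Section hilbert.
Context {R : realType} {k : scalar_kind}.
Local Notation K := (scalar_field R k).
Variables (H : completeNormedModType K) (ip : {dot H for sconj}).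
Hypothesis H_hilbert : hilbert_norm ip.

Definition rip (x y : H) : R := sRe (ip x y).
Definition rscale (c : R) (x : H) : H := rc c *: x.

Lemma ipC x y : ip x y = sconj (ip y x).
Proof. by rewrite hermitian_subproof expr0 mul1r. Qed.

Lemma rnorm_rip x : rnorm rip x = real_norm x.
Proof.
rewrite /rnorm /rip -H_hilbert normr_real_norm expr2 sRe_rcM sRe_rc -expr2 sqrtr_sqr.
by rewrite ger0_norm ?real_norm_ge0.
Qed.

Lemma hilbert_real : real_hilbert rip rscale.
Proof.
split.
- by move=> x y z; rewrite /rip linearDl sReD.
- by move=> x y; rewrite /rip ipC; case: k (ip y x) => //= -[].
- by move=> x; rewrite /rip -H_hilbert normr_real_norm expr2 sRe_rcM sRe_rc -expr2 sqr_ge0.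
- by move=> c x y; rewrite /rip /rscale linearZl_LR sRe_rcM.
- move=> f cf.
  have cauchyf : cauchy (f @ \oo).
    apply: cauchy_exP => e e0.
    have eE : e = rc (sRe e) by apply: ge0_rcE; exact: ltW.
    have e'0 : 0 < sRe e.
      by rewrite -(ltr_rc (k := k)) rc0 -eE.
    have [|N hN] := cf (sRe e / 2); first by rewrite divr_gt0.
    exists (f N); exists N => // n /= Nn.
    rewrite -ball_normE /= normr_real_norm eE.
    have := hN N n (leqnn _) Nn; rewrite rnorm_rip => h.
    by rewrite ltr_rc; apply: le_lt_trans h _; lra.
  have /cvg_ex[v fv] : cvg (f @ \oo) by exact: cauchy_cvg.
  exists v => e e0.
  have e'0 : 0 < rc e :> K.
    by rewrite -[ltLHS]rc0 ltr_rc.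
  have /cvgrPdist_le /(_ _ e'0)[N _ hN] := fv.
  exists N => n Nn; rewrite rnorm_rip.
  have := hN n Nn; rewrite /= distrC => /le_sRe.
  by rewrite sRe_rc.
Qed.

End hilbert.

Section intersection.
Context {R : realType} {k : scalar_kind} (B : banach_couple R k).
Local Notation K := (scalar_field R k).

Definition cap_pred : {pred sp0 B * sp1 B} := fun x => `[< couple_cap x >].

Lemma cap_predP x : reflect (couple_cap x) (x \in cap_pred).
Proof. exact: asboolP. Qed.

Lemma cap_zmod_closed : zmod_closed cap_pred.
Proof.
split; first by apply/cap_predP; rewrite /couple_cap /= !linear0.
move=> x y /cap_predP hx /cap_predP hy; apply/cap_predP.
by rewrite /couple_cap /= !linearB /= hx hy.
Qed.
HB.instance Definition _ := GRing.isZmodClosed.Build _ cap_pred cap_zmod_closed.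

(** The intersection as a type, with the additive structure that the abstract estimates ask for;
    multiples are supplied separately by [cap_scale]. *)
Record cap := Cap { cap_val : sp0 B * sp1 B ; _ : cap_val \in cap_pred }.
HB.instance Definition _ := [isSub for cap_val].
HB.instance Definition _ := [Choice of cap by <:].
HB.instance Definition _ := [SubChoice_isSubZmodule of cap by <:].

Lemma capP (x : cap) : couple_cap (val x).
Proof. exact/cap_predP/valP. Qed.

Definition cap0 (x : cap) := real_norm (val x).1.
Definition cap1 (x : cap) := real_norm (val x).2.

Lemma seminorm_cap0 : seminorm cap0.
Proof.
split; rewrite /cap0.
- by rewrite raddf0 real_norm0.
- by move=> x; rewrite raddfN /= real_normN.
- by move=> x y; rewrite raddfD /= real_normD.
Qed.

Lemma seminorm_cap1 : seminorm cap1.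
Proof.
split; rewrite /cap1.
- by rewrite raddf0 real_norm0.
- by move=> x; rewrite raddfN /= real_normN.
- by move=> x y; rewrite raddfD /= real_normD.
Qed.

Lemma cap_scale_subproof a (x : cap) : a *: val x \in cap_pred.
Proof. by apply/cap_predP; rewrite /couple_cap /= !linearZ /= capP. Qed.

Definition cap_scale a x : cap := Cap (cap_scale_subproof a x).

End intersection.

Section dual_estimates.
Context {R : realType} {k : scalar_kind} (B : banach_couple R k).
Local Notation K := (scalar_field R k).

(** Homogeneity, with [x] divided by [n x + e] rather than [n x], so that vectors with [n x = 0] are
    covered. *)
Lemma dual_norm_le (th : R) (h : sp0 B -> K) (n : cap B -> R) (x : cap B) (M : R) :
  scalar h -> 0 <= n x -> (forall c : R, n (cap_scale (rc c) x) = `|c| * n x) ->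
  (forall y : cap B, n y <= 1 -> (interp_norm th (val y) <= 1)%E) ->
  (dual_norm th h <= M%:E)%E -> real_abs (h (val x).1) <= M * n x.
Proof.
move=> lh n0 nZ nI hM.
have h00 : h 0 = 0.
  by apply: (@addrI _ (h 0)); have := lh 1 0 0; rewrite scaler0 !addr0 mul1r => <-.
have step e : 0 < e -> real_abs (h (val x).1) <= M * (n x + e).
  move=> e0; have ne : 0 < n x + e by rewrite ltr_wpDl.
  pose y := cap_scale (rc (n x + e)^-1) x.
  have y1 : n y <= 1.
    rewrite nZ ger0_norm ?invr_ge0 ?(ltW ne)// mulrC ler_pdivrMr// mul1r lerDl.
    exact: ltW.
  have hE : real_abs (h (val y).1) = (n x + e)^-1 * real_abs (h (val x).1).
    have -> : h (val y).1 = rc (n x + e)^-1 * h (val x).1.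
      by have := lh (rc (n x + e)^-1) (val x).1 0; rewrite h00 !addr0.
    have i0 : 0 <= (n x + e)^-1 by rewrite invr_ge0 ltW.
    by rewrite /real_abs normrM normr_rc sRe_rcM (ger0_norm i0).
  have : ((real_abs (h (val y).1))%:E <= M%:E)%E.
    apply: le_trans hM; apply: ereal_sup_ubound; exists (val y) => //.
    by split; [exact: capP|exact: nI].
  by rewrite lee_fin hE mulrC ler_pdivrMr.
apply/ler_addgt0Pr => d d0.
have M1 : 0 < `|M| + 1 by rewrite ltr_wpDl.
apply: le_trans (step (d / (`|M| + 1)) _) _; first exact: divr_gt0.
rewrite mulrDr lerD2l mulrA ler_pdivrMr// mulrC ler_wpM2l ?(ltW d0)//.
by apply: le_trans (ler_norm _) _; rewrite lerDl.
Qed.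

Lemma cap0Z (c : R) (x : cap B) : cap0 (cap_scale (rc c) x) = `|c| * cap0 x.
Proof. by rewrite /cap0 /= real_norm_rcZ. Qed.

Lemma cap1Z (c : R) (x : cap B) : cap1 (cap_scale (rc c) x) = `|c| * cap1 x.
Proof. by rewrite /cap1 /= real_norm_rcZ. Qed.

Lemma interp_norm0 (x : cap B) : interp_norm 0 (val x) = (cap0 x)%:E.
Proof. by rewrite /interp_norm eqxx. Qed.

Lemma interp_norm1 (x : cap B) : interp_norm 1 (val x) = (cap1 x)%:E.
Proof. by rewrite /interp_norm oner_eq0 eqxx. Qed.

Variables (H : completeNormedModType K) (ip : {dot H for sconj}).
Variables (U : R -> H -> sp0 B -> K) (Ustar : R -> sp0 B -> H) (sigma : R).
Hypothesis H_hilbert : hilbert_norm ip.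
Hypothesis U_dual : forall t, dual_operator (U t).
Hypothesis U_adjoint : forall t (f : H) (g : sp0 B), U t f g = ip f (Ustar t g).
Hypothesis U_measurable : forall (f : H) (b : sp0 B * sp1 B), couple_cap b ->
     scalar_measurable (fun t => U t f b.1).
Hypothesis U_energy : exists C : R, 0 < C /\
     forall (t : R) (f : H), (dual_norm 0 (U t f) <= (C * real_norm f)%:E)%E.
Hypothesis U_dispersive : exists C : R, 0 < C /\
     forall (t s : R) (g : sp0 B * sp1 B), t != s -> couple_cap g ->
       (dual_norm 1 (U t (Ustar s g.1))
          <= (C * `|t - s| `^ (- sigma) * real_norm g.2)%:E)%E.

Definition adj (s : R) (x : cap B) : H := Ustar s (val x).1.

Lemma rip_adj f s x : rip ip f (adj s x) = sRe (U s f (val x).1).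
Proof. by rewrite U_adjoint. Qed.

(** The kernel [rip (u s x) (u t y)] is the real part of [U t (Ustar s x)] tested on [y], so the
    dispersive hypothesis bounds it by testing on unit vectors of the intersection. *)
Lemma dispersive_adj : exists E D,
  dispersive (@cap0 _ _ B) (@cap1 _ _ B) (rip ip) (@rscale R k H) adj sigma E D.
Proof.
have hH := hilbert_real H_hilbert.
have [E [E0 hE]] := U_energy; have [D [D0 hD]] := U_dispersive.
have sc t f : scalar (U t f) by have [h _] := U_dual t; case: (h f).
exists E, D; split => //.
- exact: seminorm_cap0.
- exact: seminorm_cap1.
- move=> s x y f; rewrite !rip_adj -sReD raddfD /=.
  by have := sc s f 1 (val x).1 (val y).1; rewrite scale1r mul1r => ->.
(* Testing [U s v] on [x] itself gives |v|^2 <= E |v| [cap0 x], and one factor |v| is divided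
   out. *)
- move=> s x; set v := adj s x.
  have h : real_abs (U s v (val x).1) <= E * real_norm v * cap0 x.
    apply: (@dual_norm_le 0 _ (@cap0 _ _ B)) => //.
    + exact: real_norm_ge0.
    + by move=> c; exact: cap0Z.
    + by move=> y; rewrite interp_norm0 lee_fin.
  have := rnorm_ge0 (rip ip) v; rewrite le_eqVlt => /predU1P[<-|v0].
    by rewrite mulr_ge0 ?real_norm_ge0 ?(ltW E0).
  rewrite -(ler_pM2l v0) -expr2 (sqr_rnorm hH) /v rip_adj -/v.
  apply: le_trans (ler_norm _) _; apply: le_trans (normr_sRe_le _) _.
  by apply: le_trans h _; rewrite rnorm_rip// mulrCA mulrA.
- move=> s t x y st; rewrite rip_adj; apply: le_trans (normr_sRe_le _) _.
  have ts : t != s by rewrite eq_sym.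
  rewrite mulrA distrC.
  apply: (@dual_norm_le 1 _ (@cap1 _ _ B)) => //.
  + exact: real_norm_ge0.
  + by move=> c; exact: cap1Z.
  + by move=> z; rewrite interp_norm1 lee_fin.
  + by apply: hD => //; exact: capP.
- move=> f x; have [+ _] := U_measurable f (capP x).
  by congr (measurable_fun _ _); apply/funext => s; rewrite rip_adj.
Qed.

(* Multiplication by [minus_i] turns imaginary parts into real parts; it is [0]
   for real scalars. *)
Definition minus_i : K := smk 0 (-1).

Lemma sIm_minus_i (z : K) : sIm z = sRe (minus_i * z).
Proof.
by rewrite /minus_i; move: z; case: k => [z|[a b]] /=; rewrite ?mul0r// mulN1r sub0r opprK.
Qed.

Lemma real_norm_minus_iZ (V : normedModType K) (v : V) : real_norm (minus_i *: v) <= real_norm v.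
Proof.
rewrite /real_norm normrZ (_ : `|minus_i| = rc (sRe `|minus_i|)); last exact: ge0_rcE.
rewrite sRe_rcM ler_piMl ?real_norm_ge0//.
rewrite /minus_i; case: (k) => /=; first by rewrite normr0.
by rewrite expr0n sqrrN expr1n add0r sqrtr1.
Qed.

(** [minus_i] has modulus at most 1 for either field of scalars, so a decomposition can be
    multiplied term by term with the same bounds [phi]. *)
Lemma jle_minus_i th x c : jle (@cap0 _ _ B) (@cap1 _ _ B) th x c ->
  jle (@cap0 _ _ B) (@cap1 _ _ B) th (cap_scale minus_i x) c.
Proof.
move=> [c0 h]; split=> //; move: h.
have i0 y : cap0 (cap_scale minus_i y) <= cap0 y by exact: real_norm_minus_iZ.
have i1 y : cap1 (cap_scale minus_i y) <= cap1 y by exact: real_norm_minus_iZ.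
case: ifP => _ h; first exact: le_trans h.
move: h; case: ifP => _ h; first exact: le_trans h.
have s0 : cap_scale minus_i (0 : cap B) = 0 by apply: val_inj; rewrite SubK !GRing.val0 scaler0.
have sD : {morph @cap_scale _ _ B minus_i : y z / y + z}.
  have vD (y z : cap B) : val (y + z) = val y + val z by exact: raddfD.
  move=> y z; apply: val_inj; rewrite [RHS]vD.
  by rewrite -[LHS]/(minus_i *: val (y + z)) vD scalerDr.
case: h => r [d [phi [ur -> out h0 h1 hs]]].
exists r, (cap_scale minus_i \o d), phi; split => //.
- exact: (big_morph _ sD s0).
- by move=> m /out[dm pm]; split=> //=; rewrite dm s0.
- by move=> m; exact: le_trans (i0 _ _) (h0 m).
- by move=> m; exact: le_trans (i1 _ _) (h1 m).
Qed.

End dual_estimates.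

(** * The K-functional and its discretisation *)

Section K_functional.
Context {R : realType} {k : scalar_kind} (B : banach_couple R k).
Local Notation K := (scalar_field R k).
Local Notation mu := (@lebesgue_measure R).

Lemma Kfunctional_ge0 (t : R) (v : ambient B) : 0 <= t -> (0 <= Kfunctional t v)%E.
Proof.
move=> t0; apply: le_ereal_inf_tmp => _ [x _ <-].
by rewrite lee_fin addr_ge0 ?mulr_ge0 ?real_norm_ge0.
Qed.

Lemma Kfunctional_le (t : R) (v : ambient B) a b : emb0 a + emb1 b = v ->
  (Kfunctional t v <= (real_norm a + t * real_norm b)%:E)%E.
Proof. by move=> abv; apply: ereal_inf_lbound; exists (a, b). Qed.

Lemma le_Kfunctional (s t : R) (v : ambient B) : s <= t ->
  (Kfunctional s v <= Kfunctional t v)%E.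
Proof.
move=> st; apply: le_ereal_inf_tmp => _ [[a b] /= abv <-].
apply: le_trans (Kfunctional_le s abv) _.
by rewrite lee_fin lerD2l ler_wpM2r ?real_norm_ge0.
Qed.

Lemma Kfunctional_lt (t : R) (v : ambient B) (M : R) : (Kfunctional t v < M%:E)%E ->
  exists x : sp0 B * sp1 B, emb0 x.1 + emb1 x.2 = v /\
    real_norm x.1 + t * real_norm x.2 < M.
Proof. by move=> /ereal_inf_lt[_ [x xv <-]]; rewrite lte_fin => ?; exists x. Qed.

Lemma cvg_real_norm0 (V : normedModType K) (a : nat -> V) (c : R) :
  (forall n, real_norm (a n) <= c * n.+1%:R^-1) -> a @ \oo --> (0 : V).
Proof.
move=> ac; apply/cvgr0Pnorm_le => e e0.
have eE : e = rc (sRe e) by apply: ge0_rcE; exact: ltW.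
have e'0 : 0 < sRe e by rewrite -(ltr_rc (k := k)) rc0 -eE.
exists (Num.bound `|c / sRe e|) => // n /= hn.
rewrite normr_real_norm eE.
suff : real_norm (a n) < sRe e by rewrite -(ltr_rc (k := k)) => /ltW.
apply: le_lt_trans (ac n) _; rewrite ltr_pdivrMr// -ltr_pdivrMl// mulrC.
apply: le_lt_trans (ler_norm _) _; apply: lt_le_trans (archi_boundP (normr_ge0 _)) _.
by rewrite ler_nat leqW.
Qed.

(** Splittings small in both spaces tend to 0 in the Hausdorff ambient space, yet their sum is
    always [v]. This makes the K-functional positive at nonzero vectors, so that splittings optimal
    up to a factor 2 exist. *)
Lemma Kfunctional_eq0 (t : R) (v : ambient B) : 0 < t ->
  (Kfunctional t v <= 0)%E -> v = 0.
Proof.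
move=> t0 K0.
have /choice[x hx] (n : nat) : exists x : sp0 B * sp1 B, emb0 x.1 + emb1 x.2 = v /\
    real_norm x.1 + t * real_norm x.2 < n.+1%:R^-1.
  by apply: Kfunctional_lt; apply: le_lt_trans K0 _; rewrite lte_fin invr_gt0.
have a0 : (fst \o x) @ \oo --> (0 : sp0 B).
  apply: (@cvg_real_norm0 _ _ 1) => n; rewrite mul1r.
  have [_ h] := hx n; apply: le_trans (ltW h).
  by rewrite lerDl mulr_ge0 ?real_norm_ge0// ltW.
have b0 : (snd \o x) @ \oo --> (0 : sp1 B).
  apply: (@cvg_real_norm0 _ _ t^-1) => n; rewrite ler_pdivlMl//.
  have [_ h] := hx n; apply: le_trans (ltW h).
  by rewrite lerDr real_norm_ge0.
have ea : (fun n => emb0 (x n).1) @ \oo --> (0 : ambient B).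
  rewrite -[X in _ --> X](linear0 emb0).
  exact: (cvg_comp _ _ a0 (@emb0_continuous _ _ B 0)).
have eb : (fun n => emb1 (x n).2) @ \oo --> (0 : ambient B).
  rewrite -[X in _ --> X](linear0 emb1).
  exact: (cvg_comp _ _ b0 (@emb1_continuous _ _ B 0)).
have ev : (fun n => emb0 (x n).1 + emb1 (x n).2) @ \oo --> (0 : ambient B).
  rewrite -[X in _ --> X](addr0 (0 : ambient B)).
  exact: (cvg_comp _ _ (cvg_pair ea eb) (@tvs.add_continuous (ambient B) (0, 0))).
have vv : (fun n => emb0 (x n).1 + emb1 (x n).2) @ \oo --> v.
  rewrite (_ : (fun n => _) = cst v); first exact: cvg_cst.
  by apply/funext => n; have [-> _] := hx n.
exact: (cvg_unique (@ambient_hausdorff _ _ B) vv ev).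
Qed.

Lemma Kfunctional_fin (t : R) (x : cap B) : 0 <= t ->
  Kfunctional t (emb0 (val x).1) \is a fin_num.
Proof.
move=> t0; rewrite ge0_fin_numE ?Kfunctional_ge0//.
apply: le_lt_trans (ltry (cap0 x)).
have := @Kfunctional_le t (emb0 (val x).1) (val x).1 0.
by rewrite linear0 addr0 real_norm0 mulr0 addr0; apply.
Qed.

Definition Kexp (x : cap B) (m : int) : R :=
  fine (Kfunctional (expR m%:~R) (emb0 (val x).1)).

Lemma KexpE x m : Kfunctional (expR m%:~R) (emb0 (val x).1) = (Kexp x m)%:E.
Proof. by rewrite fineK// Kfunctional_fin// expR_ge0. Qed.

Lemma Kexp_ge0 x m : 0 <= Kexp x m.
Proof. by rewrite fine_ge0// Kfunctional_ge0// expR_ge0. Qed.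

Lemma Kexp_gt0 x m : x != 0 -> 0 < Kexp x m.
Proof.
rewrite lt_neqAle Kexp_ge0 andbT; apply: contraNN => /eqP K0.
have v0 : emb0 (val x).1 = 0 :> ambient B.
  by apply: (@Kfunctional_eq0 (expR m%:~R)); rewrite ?expR_gt0// KexpE -K0.
have x1 : (val x).1 = 0 by apply: (@emb0_injective _ _ B); rewrite v0 linear0.
have x2 : (val x).2 = 0 by apply: (@emb1_injective _ _ B); rewrite -(capP x) v0 linear0.
by apply/eqP/val_inj; rewrite [LHS]surjective_pairing x1 x2.
Qed.

Local Notation interp_integral th x :=
  (\int[mu]_(t in `]0%R, +oo[)
    (((t `^ (- th))%:E * Kfunctional t (emb0 (val x).1)) ^+ 2 * (t^-1)%:E))%E.

(** On the cell from e^m to e^(m+1) the K-functional is at least its value at the left end and the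
    power of [t] at least its value at the right end (the product is [v m]); the cell has length (1
    - e^(-1)) e^(m+1). *)
Lemma sum_Kexp_le th x (r : seq int) : 0 <= th -> uniq r ->
  (((1 - expR (-1)) * expR (- (2 * th)) *
     \sum_(m <- r) (expR (- th * m%:~R) * Kexp x m) ^+ 2)%:E <= interp_integral th x)%E.
Proof.
move=> th0 ur.
pose v (m : int) := expR (- (2 * th + 1) * (m%:~R + 1)) * Kexp x m ^+ 2.
have v0 m : 0 <= v m by rewrite mulr_ge0 ?expR_ge0 ?sqr_ge0.
have q0 : (0 < 1 - expR (-1) :> R) by rewrite subr_gt0 expR_lt1 oppr_lt0.
have vE m : (1 - expR (-1)) * expR (- (2 * th)) * (expR (- th * m%:~R) * Kexp x m) ^+ 2 =
    v m * (expR (m%:~R + 1) - expR m%:~R).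
  rewrite /v exprMn -expRM_natl mulrA -mulrA -[RHS]mulrA [_ ^+ 2 * _]mulrC [RHS]mulrA mulrA.
  congr (_ * _).
  rewrite (_ : expR (m%:~R + 1) - expR m%:~R = (1 - expR (-1)) * expR (m%:~R + 1)); last first.
    by rewrite mulrBl mul1r -expRD; congr (_ - expR _); ring.
  rewrite [RHS]mulrCA -mulrA -!expRD; congr (_ * expR _); ring.
pose chi (m : int) (t : R) : R := (expR m%:~R <= t < expR (m%:~R + 1))%R%:R.
rewrite mulr_sumr; under eq_bigr do rewrite vE.
rewrite [leRHS]integral_mkcond.
apply: (@le_trans _ _ (\int[mu]_t (\sum_(m <- r) (v m)%:E * (chi m t)%:E))%E); last first.
  apply: le_ge0_integral => t.
    by apply: sume_ge0 => m _; rewrite -EFinM lee_fin mulr_ge0// ler0n.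
  rewrite /patch mem_setE in_itv/= andbT.
  have [t0|t0] := ltP 0 t; last first.
    rewrite big1// => m _; rewrite /chi (_ : _ && _ = false) ?mule0//.
    by apply/negbTE/negP => /andP[/(lt_le_trans (expR_gt0 _))]; rewrite ltNge t0.
  (* The cells are disjoint, so at most one term of the sum is nonzero at [t]. *)
  have [/hasP[m mr mt]|nr] := boolP (has (fun m : int => expR m%:~R <= t < expR (m%:~R + 1)) r);
      last first.
    rewrite big1_seq; last first.
      move=> m /andP[_ mr]; rewrite /chi (negbTE (hasPn nr _ mr)) mule0//.
    by rewrite !mule_ge0 ?lee_fin ?invr_ge0 ?powR_ge0 ?Kfunctional_ge0 ?(ltW t0).
  rewrite (bigD1_seq m)//= big1; last first.
    move=> j jm; rewrite /chi (_ : _ && _ = false) ?mule0//; apply/negbTE/negP => jt.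
    move: mt jt; have [/pos_expR[l ->]] := t0.
    rewrite -(intrD _ m 1) -(intrD _ j 1) !ler_expR !ltr_expR.
    move=> /andP[ml lm] /andP[jl lj]; move/eqP: jm; apply.
    have := le_lt_trans ml lj; have := le_lt_trans jl lm; rewrite !ltr_int; lia.
  have /andP[mt1 mt2] := mt.
  set f := fine (Kfunctional t (emb0 (val x).1)).
  have fE : Kfunctional t (emb0 (val x).1) = f%:E by rewrite fineK// Kfunctional_fin// ltW.
  have fK : Kexp x m <= f by rewrite -lee_fin -KexpE -fE le_Kfunctional.
  rewrite adde0 /chi mt mule1 -[cap_val x]/(val x) fE -!EFinM lee_fin /v.
  rewrite (_ : _ * f * _ * _ = (t `^ (- th)) ^+ 2 * t^-1 * f ^+ 2); last by ring.
  apply: ler_pM; rewrite ?expR_ge0 ?sqr_ge0//; last first.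
    by rewrite ler_pXn2r ?nnegrE ?Kexp_ge0// (le_trans (Kexp_ge0 x m)).
  move: t0 mt2 => /pos_expR[l ->]; rewrite ltr_expR => lm.
  rewrite powR_expR -expRM_natl -expRN -expRD ler_expR.
  have : 0 <= (2 * th + 1) * (m%:~R + 1 - l).
    by rewrite mulr_ge0 ?subr_ge0 ?(ltW lm)// addr_ge0 ?mulr_ge0.
  by move=> ?; lra.
have mchi m : measurable_fun setT (fun t : R => (chi m t)%:E).
  apply/measurable_EFinP; rewrite (_ : chi m = \1_`[expR m%:~R, expR (m%:~R + 1)[%classic).
    exact: measurable_indic.
  by apply/funext => t; rewrite /chi indicE mem_setE in_itv.
rewrite ge0_integral_sum//; last 2 first.
- move=> m; have mc : measurable_fun setT (fun t : R => v m * chi m t).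
    by apply: measurable_funM => //; apply/measurable_EFinP; exact: mchi.
  exact/measurable_EFinP.
- by move=> m t _; rewrite -EFinM lee_fin mulr_ge0// ler0n.
rewrite -sumEFin; apply: lee_sum => m _.
rewrite ge0_integralZl//; last 2 first.
- by move=> t _; rewrite lee_fin ler0n.
- by rewrite lee_fin.
rewrite EFinM lee_wpmul2l ?lee_fin//.
rewrite (_ : (\int[mu]_t _)%E = (\int[mu]_t (\1_`[expR m%:~R, expR (m%:~R + 1)[ t)%:E)%E);
    last first.
  by apply: eq_integral => t _; rewrite /chi indicE mem_setE in_itv.
rewrite integral_indic// setIT /= lebesgue_measure_itv/= lte_fin ltr_expR ltrDl ltr01.
  by rewrite -EFinD.
exact: mchi.
Qed.

End K_functional.

(** * From K-functional bounds to finite J-decompositions *)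

Section discrete_decomposition.
Context {R : realType} {k : scalar_kind} (B : banach_couple R k).
Local Notation K := (scalar_field R k).
Local Notation mu := (@lebesgue_measure R).
Local Notation jle := (jle (@cap0 _ _ B) (@cap1 _ _ B)).

Lemma exp_decay (n s d : R) : 0 < s -> 0 < d ->
  exists M : nat, forall N : nat, (M <= N)%N -> expR (- d * N%:R) * n <= s.
Proof.
move=> s0 d0; exists (Num.bound (`|n| / (s * d))) => N MN.
have sd : 0 < s * d by rewrite mulr_gt0.
have h : `|n| / (s * d) < N%:R.
  by apply: lt_le_trans (archi_boundP _) _; rewrite ?divr_ge0 ?(ltW sd)// ler_nat.
rewrite mulNr expRN mulrC ler_pdivrMr ?expR_gt0//.
apply: le_trans (ler_norm _) _.
move: h; rewrite ltr_pdivrMr// => /ltW h; apply: le_trans h _.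
rewrite mulrCA ler_pM2l// mulrC; apply: le_trans (expR_ge1Dx _); by rewrite lerDr.
Qed.

(** A one-term decomposition. It provides a finite bound in the case of an infinite interpolation
    integral, where any finite bound will do. *)
Lemma jle_trivial th x : 0 <= th <= 1 -> jle th x (cap0 x + cap1 x).
Proof.
move=> /andP[th0 th1].
have n0 : 0 <= cap0 x by exact: real_norm_ge0.
have n1 : 0 <= cap1 x by exact: real_norm_ge0.
split; first exact: addr_ge0.
case: ifP => _; first by rewrite lerDl.
case: ifP => _; first by rewrite lerDr.
exists [:: 0], (fun m => if m == 0 then x else 0), (fun m => if m == 0 then cap0 x + cap1 x else 0).
split => //.
- by rewrite big_seq1 eqxx.
- by move=> m; rewrite inE => /negbTE ->.
- move=> m; case: eqVneq => [->|_]; first by rewrite mulr0 expR0 mul1r lerDl.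
  by rewrite mulr0 (seminorm0 (seminorm_cap0 B)).
- move=> m; case: eqVneq => [->|_]; first by rewrite mulr0 expR0 mul1r lerDr.
  by rewrite mulr0 (seminorm0 (seminorm_cap1 B)).
- by rewrite big_seq1 eqxx.
Qed.

Lemma cap_diff_subproof (v : ambient B) (a b : sp0 B * sp1 B) :
  emb0 a.1 + emb1 a.2 = v -> emb0 b.1 + emb1 b.2 = v ->
  (a.1 - b.1, b.2 - a.2) \in @cap_pred _ _ B.
Proof.
move=> <- ab; apply/cap_predP; rewrite /couple_cap /= !linearB /=.
have -> : emb0 a.1 = emb0 b.1 + emb1 b.2 - emb1 a.2 by rewrite ab addrK.
by rewrite -(addrA (emb0 b.1)) [LHS]addrC addKr.
Qed.

(* [A m] is a splitting of [x] at scale e^m, trivial for large [|m|]; the terms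
   [A m - A (m - 1)] telescope. *)
Lemma jle_discrete th (x : cap B) (M : nat) (A : int -> sp0 B * sp1 B) (c : R) :
  let g m := expR (- th * m%:~R) * (real_norm (A m).1 + expR m%:~R * real_norm (A m).2) in
  0 < th < 1 ->
  (forall m, emb0 (A m).1 + emb1 (A m).2 = emb0 (val x).1) ->
  (forall m : int, m < - M%:Z -> A m = (0, (val x).2)) ->
  (forall m : int, M%:Z < m -> A m = ((val x).1, 0)) -> 0 <= c ->
  expR 1 ^+ 2 * 4 * (\sum_(i < (M + M).+3) g (i%:Z - M%:Z - 1) ^+ 2) <= c ^+ 2 ->
  jle th x c.
Proof.
move=> g /andP[th0 th1] hA Alo Ahi c0 hc; split=> //.
rewrite gt_eqF// lt_eqF//.
(* All splittings have the same sum, so the increment of the first component and minus the increment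
   of the second are one element of the intersection. *)
pose d m : cap B := Cap (cap_diff_subproof (hA m) (hA (m - 1))).
pose r := [seq i%:Z - M%:Z | i <- iota 0 (M + M).+2].
have memr m : (m \in r) = (- M%:Z <= m <= M%:Z + 1).
  apply/mapP/idP => [[j] | /andP[lm um]].
    by rewrite mem_iota => /andP[_ ?] ->; lia.
  by exists (absz (m + M%:Z)%R); [rewrite mem_iota; lia|lia].
have g0 m : 0 <= g m by rewrite mulr_ge0 ?expR_ge0 ?addr_ge0 ?mulr_ge0 ?expR_ge0 ?real_norm_ge0.
(* The factor e pays for measuring at scale [m] the second component of the splitting made at scale
   [m - 1]. *)
pose phi m := if m \in r then expR 1 * (g m + g (m - 1)) else 0.
have e1 : 1 <= expR 1 :> R by rewrite -expR0 ler_expR.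
have eth : 1 <= expR th :> R by rewrite -expR0 ler_expR ltW.
have d_out m : m \notin r -> d m = 0.
  rewrite memr => hm; apply: val_inj; rewrite SubK.
  have [lm|lm] := ltP m (- M%:Z).
    rewrite (Alo m)// (Alo (m - 1)); last by lia.
    by rewrite /= !subrr.
  rewrite (Ahi m); last by lia.
  rewrite (Ahi (m - 1)); last by lia.
  by rewrite /= !subrr.
pose a m := real_norm (A m).1; pose b m := real_norm (A m).2.
have a0 m : 0 <= a m by exact: real_norm_ge0.
have b0 m : 0 <= b m by exact: real_norm_ge0.
have n0 m : cap0 (d m) <= a m + a (m - 1).
  by rewrite /cap0 SubK /=; apply: le_trans (real_normD _ _) _; rewrite real_normN.
have n1 m : cap1 (d m) <= b m + b (m - 1).
  by rewrite /cap1 SubK /=; apply: le_trans (real_normD _ _) _; rewrite real_normN addrC.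
have em m : expR (m%:~R) = expR ((m - 1)%:~R) * expR 1 :> R.
  by rewrite -expRD intrB; congr expR; ring.
exists r, d, phi; split.
- by rewrite map_inj_uniq ?iota_uniq// => i j; lia.
- apply: val_inj; rewrite /r big_map.
  pose f1 (i : nat) := (A (i%:Z - M%:Z - 1)).1; pose f2 (i : nat) := - (A (i%:Z - M%:Z - 1)).2.
  have step (i : nat) : i.+1%:Z - M%:Z - 1 = i%:Z - M%:Z by lia.
  rewrite -[X in iota 0 X]subn0 -/(index_iota 0 (M + M).+2).
  rewrite raddf_sum (eq_bigr (fun i => (f1 i.+1 - f1 i, f2 i.+1 - f2 i))); last first.
    move=> i _; rewrite -[LHS]/((A (i%:Z - M%:Z)).1 - (A (i%:Z - M%:Z - 1)).1,
        (A (i%:Z - M%:Z - 1)).2 - (A (i%:Z - M%:Z)).2).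
    by rewrite /f1 /f2 !step opprK; congr pair; exact: addrC.
  rewrite [RHS]surjective_pairing [LHS]surjective_pairing; congr pair.
    rewrite (raddf_sum fst) /= telescope_sumr// /f1 Ahi; last by lia.
    by rewrite Alo ?subr0//; lia.
  rewrite (raddf_sum snd) /= telescope_sumr// /f2 Ahi; last by lia.
  by rewrite Alo /= ?oppr0 ?opprK ?add0r//; lia.
- by move=> m mr; rewrite /phi (negbTE mr) d_out.
- move=> m; rewrite /phi; case: ifPn => [_|/d_out ->]; last first.
    by rewrite (seminorm0 (seminorm_cap0 B)) mulr0.
  apply: le_trans (n0 m) _.
  have -> : expR (th * m%:~R) * (expR 1 * (g m + g (m - 1))) =
      expR 1 * ((a m + expR m%:~R * b m) + expR th * (a (m - 1) + expR (m - 1)%:~R * b (m - 1))).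
    rewrite /g -/(a m) -/(b m) -/(a (m - 1)) -/(b (m - 1)) intrB.
    rewrite (_ : expR (- th * (m%:~R - 1%:~R)) = expR th * (expR (th * m%:~R))^-1); last first.
      by rewrite -expRN -expRD; congr expR; ring.
    by rewrite mulNr expRN; field; rewrite gt_eqF// expR_gt0.
  apply: (@le_trans _ _ (1 * ((a m + expR m%:~R * b m) + 1 * (a (m - 1) + expR (m - 1)%:~R * b
      (m - 1))))).
    by rewrite !mul1r; apply: lerD; rewrite lerDl mulr_ge0 ?expR_ge0.
  have p m' : 0 <= a m' + expR m'%:~R * b m' by rewrite addr_ge0 ?mulr_ge0 ?expR_ge0.
  move: (p m) (p (m - 1)); set y := _ + _; set z := _ + _ => y0 z0.
  apply: ler_pM => //; first by rewrite mul1r addr_ge0.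
  by rewrite mul1r lerD2l ler_peMl.
- move=> m; rewrite /phi; case: ifPn => [_|/d_out ->]; last first.
    by rewrite (seminorm0 (seminorm_cap1 B)) mulr0.
  apply: le_trans (n1 m) _.
  have -> : expR (- (1 - th) * m%:~R) * (expR 1 * (g m + g (m - 1))) =
      expR 1 * ((expR m%:~R)^-1 * a m + b m) + (expR th * expR 1) * ((expR m%:~R)^-1 * a (m - 1)) +
       expR th * b (m - 1).
    rewrite /g -/(a m) -/(b m) -/(a (m - 1)) -/(b (m - 1)).
    rewrite (_ : expR (- th * (m - 1)%:~R) = expR th * (expR (th * m%:~R))^-1); last first.
      by rewrite intrB -expRN -expRD; congr expR; ring.
    rewrite (_ : expR (- (1 - th) * m%:~R) = expR (th * m%:~R) * (expR m%:~R)^-1); last first.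
      by rewrite -expRN -expRD; congr expR; ring.
    by rewrite mulNr expRN (em m); field; rewrite !gt_eqF// expR_gt0.
  apply: (@le_trans _ _ (1 * (0 + b m) + 0 + 1 * b (m - 1))).
    by rewrite !mul1r add0r addr0.
  apply: lerD; last by rewrite ler_wpM2r.
  apply: lerD; last by rewrite !mulr_ge0 ?invr_ge0 ?expR_ge0.
  apply: ler_pM; rewrite ?addr_ge0//.
  by rewrite lerD2r mulr_ge0 ?invr_ge0 ?expR_ge0.
- apply: le_trans hc; rewrite /r big_map -[X in iota 0 X]subn0 -/(index_iota 0 (M + M).+2)
    big_mkord.
  pose G (i : nat) := g (i%:Z - M%:Z - 1).
  apply: (@le_trans _ _ (\sum_(i < (M + M).+2) (expR 1 ^+ 2 * 2) * (G i.+1 ^+ 2 + G i ^+ 2))).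
    apply: ler_sum => i _; rewrite /phi; case: ifP => _; last first.
      by rewrite expr0n mulr_ge0 ?addr_ge0 ?sqr_ge0// mulr_ge0 ?sqr_ge0.
    rewrite /G (_ : i.+1%:Z - M%:Z - 1 = i%:Z - M%:Z); last by lia.
    set y := g _; set z := g _; rewrite exprMn -mulrA ler_wpM2l ?sqr_ge0//.
    by have := sqr_ge0 (y - z); rewrite !expr2 => ?; lra.
  rewrite -mulr_sumr (_ : _ * 4 * _ = expR 1 ^+ 2 * 2 * (\sum_(i < (M + M).+3) G i ^+ 2 +
      \sum_(i < (M + M).+3) G i ^+ 2)); last first.
    by rewrite /G; ring.
  rewrite ler_wpM2l ?mulr_ge0 ?sqr_ge0// big_split lerD//.
    by rewrite [leRHS]big_ord_recl lerDr sqr_ge0.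
  by rewrite [leRHS]big_ord_recr lerDl sqr_ge0.
Qed.

(** The fundamental lemma of interpolation: differences of nearly optimal splittings at consecutive
    scales form a J-decomposition. For elements of the intersection it can be made finite, by
    trivial splittings at extreme scales. *)
Lemma jle_interp th : 0 <= th <= 1 -> exists C : R, 0 < C /\
  forall x : cap B, exists c, jle th x c /\ (c%:E <= C%:E * interp_norm th (val x))%E.
Proof.
move=> th01; have /andP[th0 th1] := th01.
have [th_0|nth0] := eqVneq th 0.
  exists 1; split=> // x; exists (cap0 x); rewrite th_0 mul1e interp_norm0; split=> //.
  by split; [exact: real_norm_ge0|rewrite eqxx].
have [th_1|nth1] := eqVneq th 1.
  exists 1; split=> // x; exists (cap1 x); rewrite th_1 mul1e interp_norm1; split=> //.
  by split; [exact: real_norm_ge0|rewrite eqxx oner_eq0].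
have {}th0 : 0 < th by rewrite lt_neqAle eq_sym nth0.
have {}th1 : th < 1 by rewrite lt_neqAle nth1.
pose q : R := (1 - expR (-1)) * expR (- (2 * th)).
have q0 : 0 < q by rewrite mulr_gt0 ?expR_gt0// subr_gt0 expR_lt1 oppr_lt0.
(* The first factors come from [jle_discrete], [4 / q] from splittings optimal up to a factor 2
   together with [sum_Kexp_le], and [2] from the two trivial end terms. *)
pose C2 := expR 1 ^+ 2 * 4 * (4 / q + 2).
have C20 : 0 < C2 by rewrite !mulr_gt0 ?exprn_gt0 ?expR_gt0// addr_gt0// divr_gt0.
exists (Num.sqrt C2); split; first by rewrite sqrtr_gt0.
move=> x; rewrite /interp_norm (negbTE nth0) (negbTE nth1).
set I := (\int[mu]_(t in _) _)%E.
have I0 : (0 <= I)%E.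
  apply: integral_ge0 => t /=; rewrite in_itv/= andbT => t0.
  by rewrite !mule_ge0 ?lee_fin ?invr_ge0 ?powR_ge0 ?Kfunctional_ge0 ?(ltW t0).
have SI r : uniq r -> ((q * \sum_(m <- r) (expR (- th * m%:~R) * Kexp x m) ^+ 2)%:E <= I)%E.
  by move=> ur; exact: sum_Kexp_le (ltW th0) ur.
clearbody I; case: I I0 SI => [i||] // I0 SI; last first.
  exists (cap0 x + cap1 x); split; first by apply: jle_trivial.
  by rewrite poweRyr ?invr_eq0// gt0_muley ?leey// lte_fin sqrtr_gt0.
rewrite lee_fin in I0.
have [->|x0] := eqVneq x 0.
  exists 0; split; first exact: (jle00 (seminorm_cap0 B) (seminorm_cap1 B)).
  by apply: mule_ge0; rewrite ?poweR_ge0 ?lee_fin ?sqrtr_ge0 ?powR_ge0.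
have i0 : 0 < i.
  have := SI [:: 0] isT; rewrite lee_fin big_seq1; apply: lt_le_trans.
  by rewrite mulr_gt0// exprn_gt0// mulr_gt0 ?expR_gt0 ?Kexp_gt0.
pose s := Num.sqrt i.
have s0 : 0 < s by rewrite sqrtr_gt0.
have s2 : s ^+ 2 = i by rewrite sqr_sqrtr.
exists (Num.sqrt C2 * s); split; last first.
  by rewrite poweR_EFin powR12_sqrt// -EFinM.
have /choice[D hD] (m : int) : exists y : sp0 B * sp1 B, emb0 y.1 + emb1 y.2 = emb0 (val x).1 /\
    real_norm y.1 + expR m%:~R * real_norm y.2 < 2 * Kexp x m.
  by apply: Kfunctional_lt; rewrite KexpE lte_fin ltr_pMl ?Kexp_gt0// ltr1n.
have [M0 hM0] := exp_decay (cap0 x) s0 th0.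
have d0 : 0 < 1 - th by rewrite subr_gt0.
have [M1 hM1] := exp_decay (cap1 x) s0 d0.
have [M [hM0' hM1']] : exists M : nat, expR (- th * M.+1%:R) * cap0 x <= s /\
    expR (- (1 - th) * M.+1%:R) * cap1 x <= s.
  exists (maxn M0 M1); split; [apply: hM0|apply: hM1].
    by rewrite ltnW// ltnS leq_maxl.
  by rewrite ltnW// ltnS leq_maxr.
have MN (m : int) : M%:Z < m -> (m < - M%:Z) = false by clear; lia.
(* [M] makes each of the two end terms, at scales -(M+1) and M+1, at most the square root [s] of the
   interpolation integral. *)
pose A (m : int) := if m < - M%:Z then (0, (val x).2) else if M%:Z < m then ((val x).1, 0) else D m.
have Alo (m : int) : m < - M%:Z -> A m = (0, (val x).2) by rewrite /A => ->.
have Ahi (m : int) : M%:Z < m -> A m = ((val x).1, 0) by rewrite /A => h; rewrite MN h.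
have Amid (m : int) : - M%:Z <= m <= M%:Z -> A m = D m.
  by rewrite /A => /andP[h1 h2]; rewrite ltNge h1 ltNge h2.
apply: (@jle_discrete th x M A) => //.
- by rewrite th0.
- move=> m; rewrite /A; case: ifP => _; first by rewrite linear0 add0r (capP x).
  by case: ifP => _; [rewrite linear0 addr0|have [h _] := hD m].
- by rewrite mulr_ge0 ?sqrtr_ge0 ?(ltW s0).
rewrite exprMn (sqr_sqrtr (ltW C20)) s2 /C2 -[leRHS]mulrA ler_wpM2l//.
rewrite big_ord_recl big_ord_recr/=.
set T := \sum_(j < _) _.
have hT : T <= 4 / q * i.
  pose r := [seq j%:Z - M%:Z | j <- iota 0 (M + M).+1].
  have ur : uniq r by rewrite map_inj_uniq ?iota_uniq// => j1 j2; clear; lia.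
  have := SI r ur; rewrite lee_fin mulrC -ler_pdivlMr// => h.
  rewrite mulrAC -mulrA; apply: le_trans (ler_wpM2l _ h) => //.
  rewrite /r big_map -[X in iota 0 X]subn0 -/(index_iota 0 (M + M).+1) big_mkord mulr_sumr.
  apply: ler_sum => j _; rewrite /bump/= add1n.
  rewrite (_ : j.+1%:Z - M%:Z - 1 = j%:Z - M%:Z); last by clear; lia.
  rewrite Amid; last by have := ltn_ord j; rewrite ltnS; clear; lia.
  set m := j%:Z - M%:Z.
  rewrite (_ : 4 * _ = (expR (- th * m%:~R) * (2 * Kexp x m)) ^+ 2); last by ring.
  rewrite ler_pXn2r ?nnegrE//.
  - by rewrite ler_wpM2l ?expR_ge0//; have [_ /ltW] := hD m.
  - by rewrite mulr_ge0 ?expR_ge0// addr_ge0 ?mulr_ge0 ?real_norm_ge0 ?expR_ge0.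
  - by rewrite !mulr_ge0 ?expR_ge0 ?Kexp_ge0.
have h1 : forall y : R, 0 <= y -> y <= s -> y ^+ 2 <= i.
  by move=> y y0 ys; rewrite -s2 ler_pXn2r ?nnegrE ?(ltW s0).
have n00 : 0 <= cap0 x by exact: real_norm_ge0.
have n10 : 0 <= cap1 x by exact: real_norm_ge0.
rewrite (_ : (4 / q + 2) * i = i + (4 / q * i + i)); last by ring.
apply: lerD; last (apply: lerD; first exact: hT).
- rewrite Alo; last by clear; lia.
  rewrite (_ : _ - M%:Z - 1 = - M.+1%:Z); last by clear; lia.
  rewrite /= real_norm0 add0r -/(cap1 x) mulrA -expRD.
  apply: h1; first by rewrite mulr_ge0 ?expR_ge0.
  apply: le_trans hM1'; rewrite rmorphN /= -pmulrn.
  by apply: le_of_eq; congr (expR _ * _); ring.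
- rewrite /bump/= add1n Ahi; last by clear; lia.
  rewrite /= real_norm0 mulr0 addr0 -/(cap0 x).
  apply: h1; first by rewrite mulr_ge0 ?expR_ge0.
  rewrite (_ : _.+1%:Z - M%:Z - 1 = M.+1%:Z)//; clear; lia.
Qed.

End discrete_decomposition.

(** * The retarded operator *)

Section far_estimate_cases.
Context {R : realType} {V H : zmodType}.
Variables (n0 n1 : V -> R) (rip : H -> H -> R) (rs : R -> H -> H).
Variables (u : R -> V -> H) (sigma E D : R).
Hypothesis hU : dispersive n0 n1 rip rs u sigma E D.
Hypothesis sigma0 : 0 < sigma.

Lemma far_estimate_range th tt :
  0 <= th -> th <= 1 -> 0 <= tt -> tt <= 1 -> th <= tt ->
  sigma < 1 \/ (sigma = 1 /\ th < 1 /\ tt < 1) \/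
    (1 < sigma /\ (sigma - 1) / sigma * (1 - th) <= 1 - tt) ->
  far_estimate n0 n1 rip u sigma th tt (1 - sigma * (tt / 2 - th / 2))^-1.
Proof.
move=> th0 th1 tt0 tt1 thtt cases.
move: thtt; rewrite le_eqVlt => /predU1P[<-|thtt].
  by rewrite subrr mulr0 subr0 invr1; apply: (far_estimate_diag hU) => //; rewrite th0.
have thlt1 : th < 1 by exact: lt_le_trans tt1.
have d0 : 0 < 1 - th by rewrite subr_gt0.
(* Solves tt = th + (1 - th) a. The condition for sigma > 1 says precisely that sigma a <= 1, and
   for sigma = 1 the bound tt < 1 gives a < 1. *)
pose a := (tt - th) / (1 - th).
have ttE : tt = th + (1 - th) * a by rewrite /a; field; rewrite gt_eqF.
have a0 : 0 < a by rewrite divr_gt0// subr_gt0.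
have a1 : a <= 1 by rewrite ler_pdivrMr// mul1r lerD2r.
have sa : sigma * a < 1 \/ (sigma * a = 1 /\ 1 < sigma).
  case: cases => [s1|[[-> [_ tt_1]]|[s1 h]]].
  - by left; apply: le_lt_trans s1; rewrite ler_piMr// ltW.
  - by left; rewrite mul1r ltr_pdivrMr// mul1r ltrD2r.
  - have : sigma * a <= 1.
      rewrite /a mulrA ler_pdivrMr// mul1r -ler_pdivlMl//.
      rewrite mulrBl divff ?gt_eqF// mulrBl mul1r in h.
      by move: h; rewrite mul1r; lra.
    by rewrite le_eqVlt => /predU1P[|]; [right|left].
have pE : (1 - sigma * (tt / 2 - th / 2))^-1 = 2 / (2 - sigma * ((1 - th) * a)).
  have e1 : sigma * ((1 - th) * a) <= 1.
    have sa1 : sigma * a <= 1 by case: sa => [/ltW|[-> _]].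
    have sa0 : 0 <= sigma * a := mulr_ge0 (ltW sigma0) (ltW a0).
    rewrite mulrCA -[leRHS]mulr1; apply: ler_pM => //; first exact: ltW.
    by rewrite gerBl.
  rewrite {1}ttE; field.
  by apply: lt0r_neq0; lra.
rewrite pE ttE.
move: th0; rewrite le_eqVlt => /predU1P[th_0|th0].
  rewrite -th_0 subr0 !mul1r add0r; by apply: (far_estimate_energy hU) => //; rewrite a0.
by apply: (far_estimate_interp hU) => //; rewrite ?th0 ?a0.
Qed.

End far_estimate_cases.

Section extended_powers.
Context {R : realType}.

Lemma poweR_le (J : \bar R) (n p : R) : 0 < p -> (0 <= J)%E ->
  (J `^ p^-1 <= n%:E)%E -> (J <= (n `^ p)%:E)%E.
Proof.
move=> p0; case: J => [j||] //; rewrite ?poweRyr ?invr_eq0 ?gt_eqF// poweR_EFin !lee_fin => j0 jn.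
rewrite -[leLHS](powRr1 j0) -[in leLHS](mulVf (lt0r_neq0 p0)) powRrM.
by rewrite ge0_ler_powR ?nnegrE ?powR_ge0 ?(ltW p0)// (le_trans (powR_ge0 _ _) jn).
Qed.

Lemma powR_le_poweR (I : \bar R) (a c p : R) : 0 < p -> 0 <= a -> 0 < c -> (0 <= I)%E ->
  (a%:E <= c%:E * I)%E -> ((a `^ p)%:E <= (c `^ p)%:E * `|I| `^ p)%E.
Proof.
move=> p0 a0 c0; case: I => [i||] //; last first.
  move=> _ _; rewrite (_ : `|+oo|%E = +oo%E :> \bar R)//.
  by rewrite poweRyr ?gt_eqF// gt0_muley ?leey// lte_fin powR_gt0.
move=> i0; rewrite (gee0_abs i0) poweR_EFin -!EFinM !lee_fin => ac; rewrite lee_fin in i0.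
by rewrite -powRM ?(ltW c0)// ge0_ler_powR ?nnegrE ?(ltW p0)// mulr_ge0 ?(ltW c0).
Qed.

End extended_powers.

Section retarded.
Context {R : realType} {k : scalar_kind} (B : banach_couple R k).
Local Notation K := (scalar_field R k).
Local Notation mu := (@lebesgue_measure R).

Lemma time_simple_cap (F : R -> sp0 B * sp1 B) : time_simple F ->
  exists G : R -> cap B, simple G /\ forall s, val (G s) = F s.
Proof.
move=> [finF mF sF capF].
have valE s : val (insubd (0 : cap B) (F s)) = F s.
  by rewrite insubdK//; exact/cap_predP.
exists (insubd (0 : cap B) \o F); split => //.
apply: simple_comp; first by split.
by apply: val_inj; rewrite insubdK ?GRing.val0//; apply/cap_predP; rewrite /couple_cap /= !linear0.
Qed.

Lemma interp_norm_ge0 th (x : sp0 B * sp1 B) : (0 <= interp_norm th x)%E.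
Proof.
rewrite /interp_norm; case: ifP => _; first by rewrite lee_fin real_norm_ge0.
by case: ifP => _; [rewrite lee_fin real_norm_ge0|exact: poweR_ge0].
Qed.

(** The normalisation [nu 0 = 0] makes [nu] compatible with [cut], which replaces values by 0. *)
Lemma interp_jle th : 0 <= th <= 1 -> exists C (nu : cap B -> R),
  [/\ 0 < C, nu 0 = 0, forall x, jle (@cap0 _ _ B) (@cap1 _ _ B) th x (nu x) &
    forall x, ((nu x)%:E <= C%:E * interp_norm th (val x))%E].
Proof.
move=> th01; have [C [C0 /choice[c hc]]] := jle_interp B th01.
exists C, (fun x => if x == 0 then 0 else c x); split => //; first by rewrite eqxx.
  move=> x; case: eqVneq => [->|_]; last by case: (hc x).
  exact: (jle00 (seminorm_cap0 B) (seminorm_cap1 B)).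
move=> x; case: eqVneq => _; last by case: (hc x).
by apply: mule_ge0; rewrite ?lee_fin ?(ltW C0)// interp_norm_ge0.
Qed.

Lemma integral_powR_le th C (nu : cap B -> R) (F : R -> sp0 B * sp1 B)
    (G : R -> cap B) (p n : R) : 0 < p -> 0 < C ->
  (forall x, 0 <= nu x) -> (forall x, ((nu x)%:E <= C%:E * interp_norm th (val x))%E) ->
  simple G -> (forall s, val (G s) = F s) ->
  ('N[mu]_(p%:E) [interp_norm th \o F] <= n%:E)%E ->
  (\int[mu]_s (nu (G s) `^ p)%:E <= ((C * n) `^ p)%:E)%E.
Proof.
move=> p0 C0 nu0 nuC sG GF; rewrite unlock /= => hn.
set J := (\int[mu]_s (`|interp_norm th (F s)| `^ p))%E in hn *.
have J0 : (0 <= J)%E by apply: integral_ge0 => s _; exact: poweR_ge0.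
have n0 : 0 <= n by rewrite -lee_fin; apply: le_trans hn; exact: poweR_ge0.
have Jn : (J <= (n `^ p)%:E)%E by exact: poweR_le.
apply: (@le_trans _ _ (\int[mu]_s ((C `^ p)%:E * `|interp_norm th (F s)| `^ p))%E).
  apply: le_ge0_integral => s; first by rewrite lee_fin powR_ge0.
  have h := nuC (G s); rewrite GF in h.
  exact: powR_le_poweR p0 (nu0 _) C0 (interp_norm_ge0 _ _) h.
rewrite ge0_integralZl//.
- by rewrite (powRM _ (ltW C0) n0) EFinM lee_wpmul2l// lee_fin powR_ge0.
- rewrite (_ : (fun s => _) = (fun s => `|interp_norm th (val (G s))| `^ p)%E).
    by apply: (measurable_simple (h := fun x _ => `|interp_norm th (val x)| `^ p)%E).
  by apply/funext => s; rewrite GF.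
- by move=> s _; exact: poweR_ge0.
- by rewrite lee_fin powR_ge0.
Qed.

Variables (H : completeNormedModType K) (ip : {dot H for sconj}).
Variables (U : R -> H -> sp0 B -> K) (Ustar : R -> sp0 B -> H) (sigma E D : R).
Hypothesis U_dual : forall t, dual_operator (U t).
Hypothesis U_adjoint : forall t (f : H) (g : sp0 B), U t f g = ip f (Ustar t g).
Local Notation adj := (@adj R k B H Ustar).
Local Notation vint := (vint (rip ip) adj).
Hypothesis hU : dispersive (@cap0 _ _ B) (@cap1 _ _ B) (rip ip) (@rscale R k H) adj sigma E D.

Lemma Rintegral_adj (G : R -> cap B) t b : simple G ->
  \int[mu]_(s in `]-oo, t[) sRe (U t (Ustar s (val (G s)).1) (val b).1) =
  rip ip (adj t b) (vint (cut (fun s => s < t) G)).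
Proof.
move=> sG; have mt : measurable_fun setT (fun s : R => s < t).
  by apply: measurable_fun_ltr => //; exact: measurable_cst.
rewrite (vintP hU _ (simple_cut sG mt)).
rewrite Rintegral_mkcond; apply: eq_Rintegral => s _.
rewrite /patch mem_setE in_itv/= /cut; case: ifP => _; last by rewrite (rip_u0 hU).
by rewrite (ripC (disp_hilbert hU)) U_adjoint.
Qed.

(** The imaginary part of the functional at [b] is its real part at [minus_i] times [b], so two real
    pairings bound its modulus. *)
Lemma retarded_le (F : R -> sp0 B * sp1 B) (G : R -> cap B) t b : simple G ->
  (forall s, val (G s) = F s) ->
  real_abs (retarded U Ustar F t (val b).1) <=
    `|rip ip (adj t b) (vint (cut (fun s => s < t) G))| +
    `|rip ip (adj t (cap_scale minus_i b)) (vint (cut (fun s => s < t) G))|.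
Proof.
move=> sG GF; rewrite -!Rintegral_adj//.
have h : retarded U Ustar F t (val b).1 =
    smk (\int[mu]_(s in `]-oo, t[) sRe (U t (Ustar s (val (G s)).1) (val b).1))
        (\int[mu]_(s in `]-oo, t[) sRe (U t (Ustar s (val (G s)).1) (val (cap_scale minus_i b)).1)).
  rewrite /retarded /scalar_integral; congr smk; apply: eq_Rintegral => s _; rewrite GF//.
  rewrite sIm_minus_i; congr sRe.
  have [/(_ (Ustar s (F s).1))[lU _] _] := U_dual t.
  have U0 : U t (Ustar s (F s).1) 0 = 0.
    by apply: (@addrI _ (U t (Ustar s (F s).1) 0)); have := lU 1 0 0;
        rewrite scaler0 !addr0 mul1r => <-.
  by have := lU minus_i (val b).1 0; rewrite U0 !addr0 => <-.
apply: le_trans (real_abs_le _) _; rewrite h; move: (Rintegral _ _ _) (Rintegral _ _ _) => x y.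
by case: (k) => /=; rewrite ?normr0 ?lerD2l.
Qed.

(** A test vector of interpolation norm at most 1 has J-bound at most [C], and one of its two real
    pairings carries at least half of the modulus; hence the [2 * C]. *)
Lemma exists_dual_norm_gt th C (nu : cap B -> R) (F : R -> sp0 B * sp1 B)
    (G : R -> cap B) t lam : 0 < C -> 0 <= lam ->
  (forall x, jle (@cap0 _ _ B) (@cap1 _ _ B) th x (nu x)) ->
  (forall x, ((nu x)%:E <= C%:E * interp_norm th (val x))%E) ->
  simple G -> (forall s, val (G s) = F s) ->
  (lam%:E < dual_norm th (retarded U Ustar F t))%E ->
  exists b c, jle (@cap0 _ _ B) (@cap1 _ _ B) th b c /\
    lam / (2 * C) * c < `|rip ip (adj t b) (vint (cut (fun s => s < t) G))|.
Proof.
move=> C0 lam0 hnu nuC sG GF /ereal_sup_gt[_ [b [capb b1] <-]]; rewrite lte_fin => lamb.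
have C20 : 0 < 2 * C by rewrite mulr_gt0.
pose bb : cap B := insubd 0 b.
have bbE : val bb = b by rewrite insubdK//; exact/cap_predP.
have nbC : nu bb <= C.
  have := nuC bb; rewrite bbE => h; rewrite -lee_fin; apply: le_trans h _.
  by rewrite -[leRHS]mule1 lee_wpmul2l// lee_fin ltW.
have lamC : lam / (2 * C) * nu bb <= lam / 2.
  rewrite (_ : lam / 2 = lam / (2 * C) * C); last by field; rewrite gt_eqF.
  by rewrite ler_wpM2l// divr_ge0// ltW.
have := retarded_le t bb sG GF; rewrite bbE => /(lt_le_trans lamb) h.
set x := `|_| in h *; set y := `|_| in h.
have [xl|xl] := ltP (lam / 2) x.
  by exists bb, (nu bb); split => //; exact: le_lt_trans xl.
exists (cap_scale minus_i bb), (nu bb); split; first exact: jle_minus_i.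
by apply: (le_lt_trans lamC); rewrite -/y; lra.
Qed.

End retarded.

Lemma dual_norm0_ge0 (R : realType) (k : scalar_kind) (B : banach_couple R k)
  (h : sp0 B -> scalar_field R k) : (0 <= dual_norm 0 h)%E.
Proof.
apply: (@le_trans _ _ (real_abs (h 0))%:E).
  by rewrite lee_fin; apply: le_trans (normr_sRe_le _); exact: normr_ge0.
apply: ereal_sup_ubound; exists (0, 0) => //; split.
  by rewrite /couple_cap /= !linear0.
by rewrite /interp_norm eqxx /= real_norm0.
Qed.

Theorem theorem1p1 (R : realType) (k : scalar_kind) (sigma : R)
  (H : completeNormedModType (scalar_field R k)) (ip : {dot H for sconj})
  (B : banach_couple R k)
  (U : R -> H -> sp0 B -> scalar_field R k) (Ustar : R -> sp0 B -> H)
  (sigma_gt0 : 0 < sigma)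
  (H_hilbert : hilbert_norm ip)
  (U_dual : forall t, dual_operator (U t))
  (U_adjoint : forall t (f : H) (g : sp0 B), U t f g = ip f (Ustar t g))
  (U_measurable : forall (f : H) (b : sp0 B * sp1 B), couple_cap b ->
     scalar_measurable (fun t => U t f b.1))
  (U_energy : exists C : R, 0 < C /\
     forall (t : R) (f : H), (dual_norm 0 (U t f) <= (C * real_norm f)%:E)%E)
  (U_dispersive : exists C : R, 0 < C /\
     forall (t s : R) (g : sp0 B * sp1 B), t != s -> couple_cap g ->
       (dual_norm 1 (U t (Ustar s g.1))
          <= (C * `|t - s| `^ (- sigma) * real_norm g.2)%:E)%E)
  (theta thetat : R)
  (theta_ge0 : 0 <= theta) (theta_le1 : theta <= 1)
  (thetat_ge0 : 0 <= thetat) (thetat_le1 : thetat <= 1)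
  (cases : sigma < 1 \/
           (sigma = 1 /\ theta < 1 /\ thetat < 1) \/
           (1 < sigma /\
            (sigma - 1) / sigma * (1 - theta) <= 1 - thetat /\
            (sigma - 1) / sigma * (1 - thetat) <= 1 - theta))
  (q qt : \bar R)
  (q_ge1 : (1 <= q)%E) (qt_ge1 : (1 <= qt)%E)
  (q_eq : (q^-1 = (sigma * theta)%:E)%E)
  (q_lt : (q^-1 < (hoelder_conjugate qt)^-1)%E)
  (qt_eq : ((hoelder_conjugate qt)^-1
             = (1 - sigma * (thetat / 2 - theta / 2))%:E)%E)
  (theta_le : theta <= thetat) :
  exists C : R, 0 < C /\
    forall F : R -> sp0 B * sp1 B, time_simple F ->
      measurable_fun [set: R]
        (fun t => dual_norm theta (retarded U Ustar F t)) ->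
      (weak_Lnorm q (fun t => dual_norm theta (retarded U Ustar F t))
         <= C%:E * 'N[lebesgue_measure]_(hoelder_conjugate qt)
                     [interp_norm thetat \o F])%E.
Proof.
have [E [D hU]] := dispersive_adj H_hilbert U_dual U_adjoint U_measurable U_energy U_dispersive.
have th01 : 0 <= theta <= 1 by rewrite theta_ge0.
have tt01 : 0 <= thetat <= 1 by rewrite thetat_ge0.
set d := 1 - sigma * (thetat / 2 - theta / 2) in qt_eq.
have sth0 : 0 <= sigma * theta by rewrite mulr_ge0// ltW.
have sd : sigma * theta < d by move: q_lt; rewrite q_eq qt_eq lte_fin.
have d0 : 0 < d by exact: le_lt_trans sd.
have p0 : 0 < d^-1 by rewrite invr_gt0.
have qtE : hoelder_conjugate qt = (d^-1)%:E.
  by rewrite -[LHS]inveK qt_eq inver gt_eqF.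
rewrite qtE.
have far : far_estimate (@cap0 _ _ B) (@cap1 _ _ B) (rip ip) (@adj _ _ B H Ustar) sigma theta
    thetat d^-1.
  apply: (far_estimate_range hU) => //.
  by case: cases => [|[|[? []]]]; [left|right; left|right; right].
have [Ct [nu [Ct0 nu0 hnu nuC]]] := interp_jle B tt01.
have [Cb [nb [Cb0 _ hnb nbC]]] := interp_jle B th01.
have nu_ge0 x : 0 <= nu x by case: (hnu x).
have N0 (F : R -> sp0 B * sp1 B) : (0 <= 'N[lebesgue_measure]_(d^-1)%:E [interp_norm thetat \o
    F])%E.
  exact: Lnorm_ge0.
have qE : q = if sigma * theta == 0 then +oo%E else ((sigma * theta)^-1)%:E.
  by rewrite -[LHS]inveK q_eq inver.
(* Here q is infinite and theta = 0: the far estimate then needs no separation of supports and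
   bounds the dual norm at every time. *)
have [st_0|st0] := eqVneq (sigma * theta) 0.
  rewrite qE st_0 eqxx.
  have th_0 : theta = 0 by move/eqP: st_0; rewrite mulf_eq0 gt_eqF//= => /eqP.
  have [C [C0 hC]] := far.
  exists (2 * Cb * (C * Ct)); split; first by rewrite !mulr_gt0.
  move=> F sF mF; have [G [sG GF]] := time_simple_cap sF.
  move: (N0 F); case NE : ('N[_]__[_])%E => [n||] // n0; last first.
    by rewrite gt0_muley ?leey// lte_fin !mulr_gt0.
  rewrite lee_fin in n0.
  have hN : ('N[lebesgue_measure]_(d^-1)%:E [interp_norm thetat \o F] <= n%:E)%E by rewrite NE.
  have hJ := integral_powR_le p0 Ct0 nu_ge0 nuC sG GF hN.
  have Cn0 : 0 <= C * (Ct * n) by rewrite !mulr_ge0 ?(ltW C0) ?(ltW Ct0).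
  have gM t : (dual_norm theta (retarded U Ustar F t) <= (2 * Cb * (C * (Ct * n)))%:E)%E.
    have M0 : 0 <= 2 * Cb * (C * (Ct * n)) by rewrite mulr_ge0// mulr_ge0// ltW.
    rewrite leNgt; apply/negP => /(exists_dual_norm_gt U_dual U_adjoint hU Cb0 M0 hnb nbC sG GF).
    move=> [b [c [hb]]]; apply/negP; rewrite -leNgt.
    rewrite (_ : 2 * Cb * _ / _ = C * (Ct * n)); last by field; rewrite gt_eqF.
    have mt : measurable_fun setT (fun s : R => s < t).
      by apply: measurable_fun_ltr => //; exact: measurable_cst.
    (* The radius 1 is arbitrary, since its exponent vanishes. *)
    have := hC (cut (fun s => s < t) G) nu ((Ct * n) `^ d^-1) t b c 1 (simple_cut sG mt)
        (powR_ge0 _ _) ltr01 _ _ hb _.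
    rewrite st_0 oppr0 powR1 mulr1 -powRrM mulfV ?gt_eqF// powRr1; last first.
      by rewrite mulr_ge0// ltW.
    apply.
    + by move=> s; exact: hnu.
    + apply: le_trans hJ; apply: le_ge0_integral => s; first by rewrite lee_fin powR_ge0.
      rewrite lee_fin /cut; case: ifP => // _.
      by rewrite nu0 powR0 ?powR_ge0// gt_eqF.
    + by move=> s _; left.
  rewrite /weak_Lnorm unlock; case: ifP => _; last first.
    by rewrite -EFinM lee_fin !mulr_ge0 ?(ltW C0) ?(ltW Ct0) ?(ltW Cb0).
  apply/ess_sup_inf.ess_supP; apply: nearW => t /=.
  rewrite gee0_abs; last by rewrite th_0 dual_norm0_ge0.
  apply: le_trans (gM t) _; rewrite -EFinM lee_fin; apply: le_of_eq; ring.
have th0 : 0 < theta.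
  by rewrite lt_neqAle theta_ge0 andbT eq_sym; apply: contraNneq st0 => ->; rewrite mulr0.
have sd' : sigma * theta < d^-1^-1 by rewrite invrK.
have [C [C0 hC]] := weak_type_le hU sigma_gt0 th0 p0 sd' far.
rewrite qE (negbTE st0).
have st_gt0 : 0 < sigma * theta by exact: mulr_gt0.
exists (2 * Cb * (C * Ct)); split; first by rewrite !mulr_gt0.
move=> F sF mF; have [G [sG GF]] := time_simple_cap sF.
move: (N0 F); case NE : ('N[_]__[_])%E => [n||] // n0; last first.
  by rewrite gt0_muley ?leey// lte_fin !mulr_gt0.
rewrite lee_fin in n0.
apply: ge_ereal_sup => _ [lam lam0 <-]; rewrite /= in lam0.
apply/lee_addgt0Pr => e e0.
have CC0 : 0 < 2 * Cb * (C * Ct) by rewrite !mulr_gt0.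
(* [weak_type_le] asks for a positive bound, while [n] may be 0; this increment costs exactly [e] in
   the final estimate. *)
pose n' := n + e / (2 * Cb * (C * Ct)).
have n'0 : 0 < n' by rewrite ltr_wpDl ?divr_gt0.
have hN : ('N[lebesgue_measure]_(d^-1)%:E [interp_norm thetat \o F] <= n'%:E)%E.
  by rewrite NE lee_fin lerDl ltW ?divr_gt0.
have hJ := integral_powR_le p0 Ct0 nu_ge0 nuC sG GF hN.
set S := [set t | _].
have mS : measurable S.
  by rewrite -[S]setTI; apply: emeasurable_fun_o_infty.
have Cn'0 : 0 < Ct * n' by rewrite mulr_gt0.
have lC0 : 0 < lam / (2 * Cb) by rewrite divr_gt0 ?mulr_gt0.
have hmu := hC G nu _ (lam / (2 * Cb)) S sG nu0 (fun s => hnu (G s)) (powR_gt0 _ Cn'0) hJ lC0 mS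
  (fun t => exists_dual_norm_gt U_dual U_adjoint hU Cb0 (ltW lam0) hnb nbC sG GF).
rewrite -powRrM mulfV ?gt_eqF// (powRr1 (ltW Cn'0)) in hmu.
set X := C * _ in hmu.
have X0 : 0 <= X := mulr_ge0 (ltW C0) (divr_ge0 (ltW Cn'0) (ltW lC0)).
apply: (@le_trans _ _ (lam%:E * X%:E)%E).
  rewrite lee_wpmul2l ?lee_fin ?(ltW lam0)//.
  rewrite invrK (_ : X = (X `^ (sigma * theta)^-1) `^ (sigma * theta)); last first.
    by rewrite -powRrM mulVf ?powRr1.
  rewrite -poweR_EFin gt0_ler_poweR ?(ltW st_gt0)//.
  - by rewrite in_itv/= measure_ge0 leey.
  - by rewrite in_itv/= lee_fin powR_ge0 leey.
rewrite -!EFinM -EFinD lee_fin /X /n'; apply: le_of_eq; field.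
by rewrite !gt_eqF.
Qed.
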